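(* Assume (cc1)–(cc6) with $\mathfrak g\in C^{0,2}(\Omega\times\mathbb R,\mathbb R)$. (i) If for some $\lambda_2<\lambda^+$ there exists a continuous strict global $\tau_{\lambda_2}$-lower solution $\mathfrak s_{\lambda_2}:\Omega\to\mathbb R$ with $\mathfrak s_{\lambda_2}>\mathfrak l_{\lambda_2}$ such that $\mathfrak l_{\lambda_2}$ and $\mathfrak s_{\lambda_2}$ are jointly included in $\mathcal D^*_{\mathfrak g}$, then the family $x'=\mathfrak c(\omega\cdot t)+\mathfrak d(\omega\cdot t)x+\mathfrak g(\omega\cdot t,x)+\lambda$ exhibits a local saddle-node bifurcation as $\lambda\uparrow\xi^+$ for some $\xi^+>\lambda_2$. (ii) If for some $\lambda_1>\lambda_-$ there exists a continuous strict global $\tau_{\lambda_1}$-upper solution $\mathfrak s_{\lambda_1}$ with $\mathfrak s_{\lambda_1}<\mathfrak u_{\lambda_1}$ such that $\mathfrak s_{\lambda_1}$ and $\mathfrak u_{\lambda_1}$ are jointly included in $\mathcal D^*_{\mathfrak g}$, then the family exhibits a local saddle-node bifurcation as $\lambda\downarrow\xi_-$ for some $\xi_-<\lambda_1$.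
   Context: $(\Omega,\sigma)$ is a continuous global flow on a compact metric space, $\omega\cdot t:=\sigma(t,\omega)$; $\mathfrak M_{\rm erg}$ is the set of $\sigma$-ergodic invariant Borel probability measures. Hypotheses (cc1)–(cc6) on $\mathfrak c,\mathfrak d,\mathfrak g$: (cc1) $\mathfrak c,\mathfrak d\in C(\Omega,\mathbb R)$, $\mathfrak g$ continuous with continuous $\mathfrak g_x$; (cc2) $\int_\Omega\mathfrak d\,dm>0$ for all $m$; (cc3) $\lim_{x\to\pm\infty}(\mathfrak d(\omega)x+\mathfrak g(\omega,x))=\mp\infty$ uniformly; (cc4) $\mathfrak g(\omega,0)=\mathfrak g_x(\omega,0)=0$, $\mathfrak g\le0$ on $\Omega\times[0,\infty)$, $\mathfrak g\ge0$ on $\Omega\times(-\infty,0]$, $m(\{\omega:\mathfrak g(\omega,x)<0\ \forall x>0,\ \mathfrak g(\omega,x)>0\ \forall x<0\})=1$ for all $m$; (cc5) $m(\{\omega:\mathfrak g(\omega,\cdot)\text{ concave on }[0,\infty)\text{, convex on }(-\infty,0]\})=1$ for all $m$; (cc6) $m(\{\omega:\mathfrak g_x(\omega,\cdot)\text{ strictly decreasing on }\mathcal J\text{, strictly increasing on }-\mathcal J\})>0$ for all compact intervals $\mathcal J\subset[0,\infty)$ and all $m$. $\tau_\lambda$ is the flow of $x'=\mathfrak h(\omega\cdot t,x)+\lambda$, $\mathfrak h:=\mathfrak c+\mathfrak d x+\mathfrak g$, with global attractor $\bigcup_\omega\{\omega\}\times[\mathfrak l_\lambda(\omega),\mathfrak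 u_\lambda(\omega)]$. $\lambda_-$ (resp. $\lambda^+$) is the value such that the family with $\mathfrak g$ replaced by $\min(0,\mathfrak g)$ (resp. $\max(0,\mathfrak g)$) has an attractor–repeller pair of hyperbolic copies of the base exactly for $\lambda>\lambda_-$ (resp. $\lambda<\lambda^+$). A continuous map $\mathfrak s$ such that $t\mapsto\mathfrak s(\omega\cdot t)$ is $C^1$ for each $\omega$, with $\mathfrak s'(\omega):=\frac{d}{dt}\mathfrak s(\omega\cdot t)|_{t=0}$ continuous, is a strict global $\tau_\lambda$-lower (resp. upper) solution if $\mathfrak s'(\omega)<\mathfrak h(\omega,\mathfrak s(\omega))+\lambda$ (resp. $>$) for all $\omega$. Strict d-concavity band: $\alpha^*(\omega):=\inf\{x<0:\mathfrak g_x(\omega,\cdot)\text{ strictly concave on }[x,0]\}$ ($0$ if empty), $\beta^*(\omega):=\sup\{x>0:\mathfrak g_x(\omega,\cdot)\text{ strictly concave on }[0,x]\}$ ($0$ if empty), $\mathcal D^*_{\mathfrak g}:=\{(\omega,x):\alpha^*(\omega)\le x\le\beta^*(\omega)\}$; $\mathcal D_{\mathfrak g}$ defined identically with ''concave''. Continuous $\mathfrak b_1<\mathfrak b_2$ are jointly included in $\mathcal D^*_{\mathfrak g}$ if for all $m\in\mathfrak M_{\rm erg}$, $m(\{\omega:[\mathfrak b_1(\omega),\mathfrak b_2(\omega)]\subseteq(\mathcal D_{\mathfrak g})_\omega\})=1$ and $m(\{\omega:[\mathfrak b_1(\omega),\mathfrak b_2(\omega)]\subseteq(\mathcal D^*_{\mathfrak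 g})_\omega\})>0$. Local saddle-node bifurcation as $\lambda\uparrow\xi$ (resp. $\downarrow\xi$): there is $\delta>0$ such that for $\lambda\in(\xi-\delta,\xi)$ (resp. $(\xi,\xi+\delta)$) there are an attractive hyperbolic $\tau_\lambda$-copy of the base $\{\mathfrak a_\lambda\}$ and a repulsive one $\{\mathfrak r_\lambda\}$ with $\mathfrak a_\lambda<\mathfrak r_\lambda$ (resp. $\mathfrak r_\lambda<\mathfrak a_\lambda$), $\lambda\mapsto\mathfrak a_\lambda$ and $\lambda\mapsto-\mathfrak r_\lambda$ continuous (sup norm) and strictly increasing, whose pointwise limits as $\lambda\to\xi$ are $\tau_\xi$-equilibria that are not uniformly separated ($\inf_\omega|\mathfrak a_\xi-\mathfrak r_\xi|=0$). *)

(* Defs.v *)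
From HB Require Import structures.
From mathcomp Require Import all_boot all_order all_algebra.
From mathcomp Require Import all_classical all_reals all_analysis.

Set Implicit Arguments.
Unset Strict Implicit.
Unset Printing Implicit Defensive.

Import Order.TTheory GRing.Theory Num.Theory.
Import numFieldNormedType.Exports.

Local Open Scope classical_set_scope.
Local Open Scope ring_scope.


Section Defs.
Context {R : realType} {Om : pseudoPMetricType R}.

Definition borelOm := g_sigma_algebraType (@open Om).

Definition is_flow (sig : R -> Om -> Om) : Prop :=
  continuous (fun p : R * Om => sig p.1 p.2) /\
  (forall w, sig 0 w = w) /\
  (forall s t w, sig (s + t) w = sig t (sig s w)).

Definition invariant_meas (sig : R -> Om -> Om) (m : probability borelOm R) :=
  forall t (A : set borelOm), measurable A ->
    m ((sig t : borelOm -> borelOm) @^-1` A) = m A.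

Definition ergodic_meas (sig : R -> Om -> Om) (m : probability borelOm R) :=
  invariant_meas sig m /\
  forall A : set borelOm, measurable A ->
    (forall t, (sig t : borelOm -> borelOm) @^-1` A = A) ->
    m A = 0%E \/ m A = 1%E.

(* "m(S) = 1" and "m(S) > 0" (read through measurable subsets) *)
Definition full_meas (m : probability borelOm R) (S : set Om) :=
  exists A : set borelOm, [/\ measurable A, A `<=` S & m A = 1%E].
Definition pos_meas (m : probability borelOm R) (S : set Om) :=
  exists A : set borelOm, [/\ measurable A, A `<=` S & (0 < m A)%E].

End Defs.

Definition gx {R : realType} {T : Type} (g : T -> R -> R) (w : T) (x : R) : R := derive1 (g w) x.
Definition gxx {R : realType} {T : Type} (g : T -> R -> R) (w : T) (x : R) : R := derive1 (gx g w) x.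

Definition concave_on {R : realType} (f : R -> R) (I : set R) :=
  forall a b t, I a -> I b -> 0 < t < 1 ->
    t * f a + (1 - t) * f b <= f (t * a + (1 - t) * b).
Definition strictly_concave_on {R : realType} (f : R -> R) (I : set R) :=
  forall a b t, I a -> I b -> a != b -> 0 < t < 1 ->
    t * f a + (1 - t) * f b < f (t * a + (1 - t) * b).
Definition convex_on {R : realType} (f : R -> R) (I : set R) :=
  forall a b t, I a -> I b -> 0 < t < 1 ->
    f (t * a + (1 - t) * b) <= t * f a + (1 - t) * f b.
Definition strictly_decreasing_on {R : realType} (f : R -> R) (I : set R) :=
  forall a b, I a -> I b -> a < b -> f b < f a.
Definition strictly_increasing_on {R : realType} (f : R -> R) (I : set R) :=
  forall a b, I a -> I b -> a < b -> f a < f b.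

Definition C02 {R : realType} {Om : topologicalType} (g : Om -> R -> R) :=
  (forall w x, derivable (g w) x 1) /\ (forall w x, derivable (gx g w) x 1) /\
  continuous (fun p : Om * R => g p.1 p.2) /\
  continuous (fun p : Om * R => gx g p.1 p.2) /\
  continuous (fun p : Om * R => gxx g p.1 p.2).

Section Hyps.
Context {R : realType} {Om : pseudoPMetricType R}.
Variable sig : R -> Om -> Om.

Definition cc_hyps (c d : Om -> R) (g : Om -> R -> R) :=
  [/\ continuous c, continuous d,
      continuous (fun p : Om * R => g p.1 p.2),
      (forall w x, derivable (g w) x 1) &
      continuous (fun p : Om * R => gx g p.1 p.2)] /\
  (forall m : probability borelOm R, ergodic_meas sig m ->
     (0 < \int[m]_w (d w)%:E)%E) /\
  (forall M : R, exists K : R, forall w x,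
     (K <= x -> d w * x + g w x <= - M) /\ (x <= - K -> M <= d w * x + g w x)) /\
  ((forall w, g w 0 = 0 /\ gx g w 0 = 0) /\
   (forall w x, 0 <= x -> g w x <= 0) /\ (forall w x, x <= 0 -> 0 <= g w x) /\
   (forall m : probability borelOm R, ergodic_meas sig m ->
      full_meas m [set w | (forall x, 0 < x -> g w x < 0) /\
                           (forall x, x < 0 -> 0 < g w x)])) /\
  (forall m : probability borelOm R, ergodic_meas sig m ->
     full_meas m [set w | concave_on (g w) [set x | 0 <= x] /\
                          convex_on (g w) [set x | x <= 0]]) /\
  (forall a b : R, 0 <= a -> a <= b ->
   forall m : probability borelOm R, ergodic_meas sig m ->
     pos_meas m [set w | strictly_decreasing_on (gx g w) [set x | a <= x <= b] /\
                         strictly_increasing_on (gx g w) [set x | - b <= x <= - a]]).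

Definition entire_sol (f : Om -> R -> R) (w : Om) (v : R -> R) :=
  forall t, derivable v t 1 /\ derive1 v t = f (sig t w) (v t).

(* tau-equilibrium: a map whose graph is invariant (no continuity required) *)
Definition equilibrium (f : Om -> R -> R) (b : Om -> R) :=
  forall w, entire_sol f w (fun t => b (sig t w)).

Definition copy_base (f : Om -> R -> R) (b : Om -> R) :=
  continuous b /\ equilibrium f b.

Definition lin_sol (f : Om -> R -> R) (b : Om -> R) (w : Om) (z : R -> R) :=
  forall t, derivable z t 1 /\
    derive1 z t = derive1 (f (sig t w)) (b (sig t w)) * z t.

Definition hyp_attractive (f : Om -> R -> R) (b : Om -> R) :=
  copy_base f b /\
  exists k beta : R, [/\ 0 < k, 0 < beta &
    forall w z, lin_sol f b w z ->
      forall t, 0 <= t -> `|z t| <= k * expR (- (beta * t)) * `|z 0| ].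

Definition hyp_repulsive (f : Om -> R -> R) (b : Om -> R) :=
  copy_base f b /\
  exists k beta : R, [/\ 0 < k, 0 < beta &
    forall w z, lin_sol f b w z ->
      forall t, t <= 0 -> `|z t| <= k * expR (beta * t) * `|z 0| ].

Definition AR_pair (f : Om -> R -> R) :=
  exists a r, hyp_attractive f a /\ hyp_repulsive f r.

(* fibre of the global attractor: points with a bounded entire solution *)
Definition attractor_fiber (f : Om -> R -> R) (w : Om) : set R :=
  [set x | exists v, [/\ entire_sol f w v, v 0 = x &
                         exists M : R, forall t, `|v t| <= M] ].
Definition l_att (f : Om -> R -> R) (w : Om) : R := inf (attractor_fiber f w).
Definition u_att (f : Om -> R -> R) (w : Om) : R := sup (attractor_fiber f w).

Definition orbit_deriv (s : Om -> R) (w : Om) : R := derive1 (fun t => s (sig t w)) 0.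

Definition orbit_C1 (s : Om -> R) :=
  continuous s /\
  (forall w, (forall t, derivable (fun t => s (sig t w)) t 1) /\
             continuous (derive1 (fun t => s (sig t w)))) /\
  continuous (orbit_deriv s).

Definition strict_lower_sol (f : Om -> R -> R) (s : Om -> R) :=
  orbit_C1 s /\ forall w, orbit_deriv s w < f w (s w).
Definition strict_upper_sol (f : Om -> R -> R) (s : Om -> R) :=
  orbit_C1 s /\ forall w, f w (s w) < orbit_deriv s w.

Definition alpha_band (P : (R -> R) -> set R -> Prop) (f : R -> R) : \bar R :=
  let S := [set x : R | x < 0 /\ P f [set y | x <= y <= 0]] in
  if pselect (S !=set0) then ereal_inf [set x%:E | x in S] else 0%E.
Definition beta_band (P : (R -> R) -> set R -> Prop) (f : R -> R) : \bar R :=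
  let S := [set x : R | 0 < x /\ P f [set y | 0 <= y <= x]] in
  if pselect (S !=set0) then ereal_sup [set x%:E | x in S] else 0%E.

(* fibre of D_g (P = concave_on) or D*_g (P = strictly_concave_on) *)
Definition band_fiber (P : (R -> R) -> set R -> Prop) (g : Om -> R -> R)
    (w : Om) : set R :=
  [set x | (alpha_band P (gx g w) <= x%:E)%E /\ (x%:E <= beta_band P (gx g w))%E].

Definition jointly_included (g : Om -> R -> R) (b1 b2 : Om -> R) :=
  forall m : probability borelOm R, ergodic_meas sig m ->
    full_meas m [set w | [set x | b1 w <= x <= b2 w] `<=` band_fiber concave_on g w] /\
    pos_meas m [set w | [set x | b1 w <= x <= b2 w] `<=`
                          band_fiber strictly_concave_on g w].

Definition sup_continuous_on (I : set R) (a : R -> Om -> R) :=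
  forall l0, I l0 -> forall e : R, 0 < e -> exists2 dl : R, 0 < dl &
    forall l, I l -> `|l - l0| < dl -> forall w, `|a l w - a l0 w| < e.
Definition strictly_incr_on (I : set R) (a : R -> Om -> R) :=
  forall l1 l2, I l1 -> I l2 -> l1 < l2 -> forall w, a l1 w < a l2 w.

(* local saddle-node bifurcation of the family F as lambda -> xi from the
   side described by I (an interval having xi as an endpoint), filter Fl,
   and the order relation between attractor and repeller. *)
Definition saddle_node_gen (F : R -> Om -> R -> R) (xi : R) (I : set R)
    (Fl : set_system R) (a_below_r : bool) :=
  exists a r : R -> Om -> R, exists aX rX : Om -> R,
  [/\ forall l, I l ->
        [/\ hyp_attractive (F l) (a l), hyp_repulsive (F l) (r l) &
            forall w, if a_below_r then a l w < r l w else r l w < a l w],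
      sup_continuous_on I a /\ sup_continuous_on I (fun l w => - r l w),
      strictly_incr_on I a /\ strictly_incr_on I (fun l w => - r l w),
      (forall w, (fun l => a l w) @ Fl --> aX w) /\
      (forall w, (fun l => r l w) @ Fl --> rX w) &
      [/\ equilibrium (F xi) aX, equilibrium (F xi) rX &
          forall e : R, 0 < e -> exists w, `|aX w - rX w| < e] ].

Definition saddle_node_up (F : R -> Om -> R -> R) (xi : R) :=
  exists2 delta : R, 0 < delta &
    saddle_node_gen F xi [set l | xi - delta < l < xi] (xi^'-) true.
Definition saddle_node_down (F : R -> Om -> R -> R) (xi : R) :=
  exists2 delta : R, 0 < delta &
    saddle_node_gen F xi [set l | xi < l < xi + delta] (xi^'+) false.

End Hyps.

Definition rhs {R : realType} {Om : Type} (c d : Om -> R) (g : Om -> R -> R) (l : R) :=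
  fun w x => c w + d w * x + g w x + l.
Definition gmin {R : realType} {Om : Type} (g : Om -> R -> R) := fun w x => Num.min 0 (g w x).
Definition gmax {R : realType} {Om : Type} (g : Om -> R -> R) := fun w x => Num.max 0 (g w x).

(* Main.v *)
Require Import Defs.
From HB Require Import structures.
From mathcomp Require Import all_boot all_order all_algebra.
From mathcomp Require Import all_classical all_reals all_analysis.
From mathcomp Require Import ring lra measurable_realfun.
Import Order.TTheory GRing.Theory Num.Theory.
Import numFieldNormedType.Exports.
Local Open Scope classical_set_scope.
Local Open Scope ring_scope.
Set Implicit Arguments.
Unset Strict Implicit.
Unset Printing Implicit Defensive.

(* Put [h = c + d x + g] and let [l] be the lower equilibrium at level [l2]. It is continuous and
   attracting, because it lies below the attractor of the family with [max 0 g], along which (and,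
   by concavity of [g], below which) the slope of [h] is uniformly negative on average.

   Let [p] be an upper and [s] a strict lower solution with values in a band where [h_x] is concave
   in [x]. In the coordinate [ln |x - p| - ln (s - x)] the equation becomes
   a uniform contraction, forwards in time for [x < p < s] and backwards for [p < x < s]: the rate
   [h_x(x) + h[s,p] - h[x,p] - h[s,x]] (divided differences) has the sign of [x - p], since [h_x]
   is concave. So every strict upper solution between [l] and [s] separates a unique hyperbolic
   attractor [a] from a unique hyperbolic repeller [r], and both depend monotonically and
   Lipschitz-continuously on the level.

   Let [xi] be the supremum of the levels admitting such an upper solution. If the limits of [a]
   and [r] at [xi] were uniformly separated, [a + d exp(V) (r - a)(s - a)/(s - r)] would be a strict
   upper solution beyond [xi], for a suitable [V] and small [d].

   Almost everywhere hypotheses become pointwise ones as follows: if a continuous [f] is [<= 0]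
   almost everywhere for every ergodic measure, some finite average of [f] along the flow is
   uniformly [< e]. Otherwise an extremal linear functional dominated by the sublinear functional
   [max_avg] is represented (Riesz) by an ergodic measure contradicting the hypothesis.
   Finite averages are then absorbed in an orbit derivative [V'] with [psi + e <= V'].

   The second statement is the first one for [x -> - x]. *)

(** * Real analysis *)

Section real_analysis.
Context {R : realType}.
Implicit Types (f df g dg u du w dw : R -> R) (a b c d e x y t s K M dl eta : R).

Lemma isD_eq f t d e : is_derive t 1 f d -> d = e -> is_derive t 1 f e.
Proof. by move=> + <-. Qed.

Lemma isD_cst c t : is_derive t 1 (fun _ : R => c) (0 : R).
Proof. exact: is_derive_cst. Qed.

Lemma isD_id t : is_derive t 1 (fun t : R => t) (1 : R).
Proof. exact: is_derive_id. Qed.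

Lemma isD_add f g a b t : is_derive t 1 f a -> is_derive t 1 g b ->
  is_derive t 1 (fun t => f t + g t) (a + b).
Proof. by move=> ? ?; exact: is_deriveD. Qed.

Lemma isD_opp f a t : is_derive t 1 f a -> is_derive t 1 (fun t => - f t) (- a).
Proof. by move=> ?; exact: is_deriveN. Qed.

Lemma isD_sub f g a b t : is_derive t 1 f a -> is_derive t 1 g b ->
  is_derive t 1 (fun t => f t - g t) (a - b).
Proof. by move=> ? ?; exact: is_deriveB. Qed.

Lemma isD_mul f g a b t : is_derive t 1 f a -> is_derive t 1 g b ->
  is_derive t 1 (fun t => f t * g t) (a * g t + f t * b).
Proof.
move=> fa gb; apply: (isD_eq (@is_deriveM R _ f g t 1 a b fa gb)).
by rewrite /GRing.scale /=; ring.
Qed.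

Lemma isD_scale c f a t : is_derive t 1 f a -> is_derive t 1 (fun t => c * f t) (c * a).
Proof.
move=> fa; apply: (isD_eq (isD_mul (isD_cst c t) fa)).
by rewrite mul0r add0r.
Qed.

Lemma isD_comp f g a b t : is_derive (g t) 1 f a -> is_derive t 1 g b ->
  is_derive t 1 (fun t => f (g t)) (a * b).
Proof. by move=> ? ?; exact: is_derive1_comp. Qed.

Lemma isD_exp f a t : is_derive t 1 f a ->
  is_derive t 1 (fun t => expR (f t)) (expR (f t) * a).
Proof. by move=> fa; apply: isD_comp => //; exact: is_derive_expR. Qed.

Lemma isD_ln f a t : 0 < f t -> is_derive t 1 f a ->
  is_derive t 1 (fun t => ln (f t)) (a / f t).
Proof.
by move=> f0 fa; rewrite mulrC; apply: isD_comp => //; exact: is_derive1_ln.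
Qed.

Lemma isD_inv f a t : f t != 0 -> is_derive t 1 f a ->
  is_derive t 1 (fun t => (f t)^-1) (- a / f t ^+ 2).
Proof.
move=> f0 fa; apply: (isD_eq (@is_deriveV R f t a 1 f0 fa)).
by rewrite mulNr mulrC; exact: mulNr.
Qed.

Lemma isD_div f g a b t : g t != 0 -> is_derive t 1 f a -> is_derive t 1 g b ->
  is_derive t 1 (fun t => f t / g t) ((a * g t - f t * b) / g t ^+ 2).
Proof.
move=> g0 fa gb; apply: (isD_eq (isD_mul fa (isD_inv g0 gb))).
by field.
Qed.

Lemma is_derive_epsP f x d : is_derive x 1 f d <->
  forall e, 0 < e -> exists2 dl, 0 < dl &
    forall y, `|y - x| < dl -> `|f y - f x - d * (y - x)| <= e * `|y - x|.
Proof.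
split=> [fd e e0|H].
  have /cvgrPdist_le/(_ e e0) : (h^-1 *: (f (h *: 1 + x) - f x)) @[h --> 0^'] --> d.
    have [der val] := fd; rewrite -val; exact: der.
  rewrite near_withinE => -[/= dl dl0 Hdl]; exists dl => // y yx.
  have [->|yNx] := eqVneq y x; first by rewrite !subrr mulr0 subr0 !normr0 mulr0.
  have yx0 : y - x != 0 by rewrite subr_eq0.
  have := Hdl (y - x); rewrite /= sub0r normrN => /(_ yx yx0).
  rewrite [(y - x) *: _]mulr1 subrK => Hle.
  have -> : f y - f x - d * (y - x) = - ((d - (y - x)^-1 * (f y - f x)) * (y - x)).
    by field.
  by rewrite normrN normrM ler_wpM2r.
have cv : (h^-1 *: (f (h *: 1 + x) - f x)) @[h --> 0^'] --> d.
  apply/cvgrPdist_le => e e0; have [dl dl0 Hdl] := H e e0.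
  rewrite near_withinE; exists dl => //= h; rewrite /= sub0r normrN => hdl h0.
  have := Hdl (h + x); rewrite addrK => /(_ hdl) Hle.
  rewrite [h *: 1]mulr1 -(ler_pM2r (_ : 0 < `|h|)) ?normr_gt0// -normrM.
  rewrite -normrN; apply: le_trans Hle; rewrite le_eqVlt; apply/orP; left; apply/eqP.
  by congr `| _ |; rewrite /GRing.scale /=; field.
split; first by apply/cvg_ex; exists d.
exact: cvg_lim cv.
Qed.

Lemma is_derive_cont f x d : is_derive x 1 f d -> {for x, continuous f}.
Proof.
by move=> [der _]; apply: differentiable_continuous; exact/derivable1_diffP.
Qed.

Lemma is_derive_ext f f' x d d' : (forall y, f y = f' y) -> d = d' ->
  is_derive x 1 f d -> is_derive x 1 f' d'.
Proof. by move=> /funext -> ->. Qed.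

Lemma entire_derP f x d : (derivable f x 1 /\ derive1 f x = d) <-> is_derive x 1 f d.
Proof.
by split=> [[der]|[der val]]; rewrite derive1E // => H; split.
Qed.

Lemma mvt f df a b : a < b ->
  (forall x, a <= x <= b -> is_derive x 1 f (df x)) ->
  exists2 c, a < c < b & f b - f a = df c * (b - a).
Proof.
move=> ab H; have [||c cab E] := @MVT R f df a b ab.
- by move=> x; rewrite in_itv/= => /andP[/ltW ? /ltW ?]; apply: H; apply/andP.
- apply: derivable_within_continuous => x; rewrite in_itv/= => xab.
  by have [] := H x xab.
by exists c => //; rewrite in_itv/= in cab.
Qed.

Lemma derive_le0_le f df a b : a <= b ->
  (forall x, a <= x <= b -> is_derive x 1 f (df x)) ->
  (forall x, a <= x <= b -> df x <= 0) -> f b <= f a.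
Proof.
rewrite le_eqVlt => /predU1P[->//|ab] H df0.
have [c /andP[ac cb] E] := mvt ab H.
rewrite -subr_le0 E mulr_le0_ge0 ?subr_ge0 ?(ltW ab)//.
by apply: df0; apply/andP; split; apply: ltW.
Qed.

Lemma derive_ge0_le f df a b : a <= b ->
  (forall x, a <= x <= b -> is_derive x 1 f (df x)) ->
  (forall x, a <= x <= b -> 0 <= df x) -> f a <= f b.
Proof.
move=> ab H df0; rewrite -lerN2.
apply: (@derive_le0_le (fun x => - f x) (fun x => - df x) a b ab).
  by move=> x xab; have := H x xab => ?; exact: is_deriveN.
by move=> x /df0; rewrite oppr_le0.
Qed.

Lemma derive_bound f df a b K : (forall x, is_derive x 1 f (df x)) ->
  (forall x, `|df x| <= K) -> `|f b - f a| <= K * `|b - a|.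
Proof.
move=> H dK; have K0 : 0 <= K by apply: le_trans (dK 0).
wlog ab : a b / a < b.
  move=> W; have [ab|ba|->] := ltgtP a b; first exact: W.
    by rewrite distrC (distrC b); exact: W.
  by rewrite !subrr normr0 mulr0.
have [c _ ->] := mvt ab (fun x _ => H x).
by rewrite normrM ler_wpM2r.
Qed.

Lemma derive_lt0_right f a b d : a < b -> is_derive a 1 f d -> d < 0 ->
  exists2 c, a < c < b & f c < f a.
Proof.
move=> ab /is_derive_epsP H d0; have [|dl dl0 Hd] := H (- d / 2).
  by rewrite divr_gt0 // oppr_gt0.
pose c := a + Num.min (dl / 2) ((b - a) / 2).
have m0 : 0 < Num.min (dl / 2) ((b - a) / 2).
  by rewrite lt_min !divr_gt0 ?subr_gt0.
have ca : c - a = Num.min (dl / 2) ((b - a) / 2) by rewrite /c addrC addKr.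
have mdl : Num.min (dl / 2) ((b - a) / 2) <= dl / 2 by rewrite ge_min lexx.
have mba : Num.min (dl / 2) ((b - a) / 2) <= (b - a) / 2 by rewrite ge_min lexx orbT.
exists c; first by rewrite /c; lra.
have := Hd c; rewrite ca (gtr0_norm m0) => /(_ _)/wrap[]; first by lra.
set m := Num.min _ _ in ca m0 mdl mba *.
rewrite ler_norml => /andP[_ h]; nra.
Qed.

Lemma barrier w dw dl eta M : 0 < eta -> (forall t, is_derive t 1 w (dw t)) ->
  (forall t, w t <= dl -> dw t <= - eta) -> (forall t, M <= w t) ->
  forall t, dl < w t.
Proof.
move=> eta0 H Hw Mw t0; rewrite ltNge; apply/negP => wt0.
have stay t1 : t0 <= t1 -> w t1 <= dl.
  rewrite le_eqVlt => /predU1P[<-//|t01]; rewrite leNgt; apply/negP => wt1.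
  have [|m m01 minm] := @EVT_min R w t0 t1 (ltW t01).
    by apply: derivable_within_continuous => x _; have [] := H x.
  rewrite in_itv/= in m01; case/andP: m01 => t0m mt1.
  have wm : w m <= dl by apply: le_trans wt0; apply: minm; rewrite in_itv/= lexx ltW.
  have mt1' : m < t1.
    by rewrite lt_neqAle mt1 andbT; apply/eqP => E; move: wm; rewrite E leNgt wt1.
  have [|c /andP[mc ct1] wc] := derive_lt0_right mt1' (H m).
    by rewrite (le_lt_trans (Hw m wm))// oppr_lt0.
  have := minm c; rewrite in_itv/= (ltW ct1) (le_trans t0m (ltW mc)) => /(_ isT).
  by rewrite leNgt wc.
pose T := t0 + (w t0 - M + 1) / eta.
have T0 : t0 < T.
  rewrite /T ltrDl divr_gt0 // ; have := Mw t0; lra.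
have [c /andP[t0c cT] E] := mvt T0 (fun x _ => H x).
have dwc : dw c <= - eta by apply: Hw; apply: stay; exact: ltW.
have : w T - w t0 <= - eta * (T - t0) by rewrite E ler_wpM2r// subr_ge0 ltW.
have -> : - eta * (T - t0) = - (w t0 - M + 1) by rewrite /T; field; rewrite gt_eqF.
have := Mw T; lra.
Qed.

Lemma is_derive_rev f df t : is_derive (- t) 1 f (df (- t)) ->
  is_derive t 1 (fun t => f (- t)) (- df (- t)).
Proof.
move=> H; apply: (isD_eq (isD_comp H (isD_opp (isD_id t)))).
by rewrite mulrN1.
Qed.

Lemma barrier_rev w dw dl eta M : 0 < eta -> (forall t, is_derive t 1 w (dw t)) ->
  (forall t, w t <= dl -> eta <= dw t) -> (forall t, M <= w t) ->
  forall t, dl < w t.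
Proof.
move=> eta0 H Hw Mw t; rewrite -(opprK t).
apply: (@barrier (fun t => w (- t)) (fun t => - dw (- t)) dl eta M eta0) => //.
- by move=> s; apply: is_derive_rev.
- by move=> s ws; rewrite lerN2; apply: Hw.
Qed.

Lemma derive_zero u du K t0 : (forall t, is_derive t 1 u (du t)) ->
  (forall t, `|du t| <= K * `|u t|) -> u t0 = 0 -> forall t, u t = 0.
Proof.
move=> H HK u0 t.
have sq s : 2 * (u s * du s) <= 2 * K * u s ^+ 2 /\ - (2 * K * u s ^+ 2) <= 2 * (u s * du s).
  have : `|u s * du s| <= K * u s ^+ 2.
    rewrite normrM -(real_normK (num_real (u s))) expr2 mulrCA.
    by apply: ler_wpM2l.
  by rewrite ler_norml => /andP[? ?]; split; lra.
have D1 (c s : R) : is_derive s 1 (fun s => u s * u s * expR (c * s))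
    ((2 * (u s * du s) + c * u s ^+ 2) * expR (c * s)).
  apply: (isD_eq (isD_mul (isD_mul (H s) (H s)) (isD_exp (isD_scale c (isD_id s))))).
  by ring.
suff : u t * u t * expR ((if t0 <= t then - (2 * K) else 2 * K) * t) <= 0.
  rewrite pmulr_lle0 ?expR_gt0// -expr2 => h.
  by apply/eqP; rewrite -sqrf_eq0 eq_le h sqr_ge0.
have [le|gt] := leP t0 t.
  have := @derive_le0_le _ _ t0 t le (fun x _ => D1 (- (2 * K)) x).
  rewrite u0 !mul0r; apply => x _.
  by rewrite pmulr_lle0 ?expR_gt0//; have := sq x; lra.
have := @derive_ge0_le _ _ t t0 (ltW gt) (fun x _ => D1 (2 * K) x).
rewrite u0 !mul0r; apply => x _.
by rewrite pmulr_lge0 ?expR_gt0//; have := sq x; lra.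
Qed.

Lemma derive_pos u du K t0 : (forall t, is_derive t 1 u (du t)) ->
  (forall t, `|du t| <= K * `|u t|) -> 0 < u t0 -> forall t, 0 < u t.
Proof.
move=> H HK u0 t; rewrite ltNge; apply/negP => ut.
have cu s : {for s, continuous u} by apply: is_derive_cont (H s).
have [c _ uc] : exists2 c, c \in `[Num.min t0 t, Num.max t0 t] & u c = 0.
  apply: IVT; first by rewrite ge_min le_max lexx.
    by apply: continuous_subspaceT => s; apply: cu.
  have [h|h] := leP t0 t; rewrite ge_min le_max ut (ltW u0) ?orbT //.
by have := derive_zero H HK uc t0 => E; move: u0; rewrite E ltxx.
Qed.

Lemma derive_limit {T : Type} {F : set_system T} {FF : ProperFilter F}
    (u du : T -> R -> R) (u0 : R -> R) d t0 :
  (forall t, u^~ t @ F --> u0 t) -> (du^~ t0 @ F --> d) ->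
  (\forall i \near F, forall t, is_derive t 1 (u i) (du i t)) ->
  (forall e, 0 < e -> exists2 dl, 0 < dl &
     \forall i \near F, forall t, `|t - t0| < dl -> `|du i t - du i t0| <= e) ->
  is_derive t0 1 u0 d.
Proof.
move=> cu cd Hd He; apply/is_derive_epsP => e e0.
have [dl dl0 Hdl] := He e e0; exists dl => // y ydl.
have C1 : `|u i y - u i t0 - du i t0 * (y - t0)| @[i --> F] -->
    `|u0 y - u0 t0 - d * (y - t0)|.
  apply: cvg_norm; apply: cvgB; first exact: cvgB.
  by apply: cvgMl.
apply: (cvgr_to_le C1).
near=> i => /=.
have Hi : forall t, is_derive t 1 (u i) (du i t) by near: i.
have Hj : forall t, `|t - t0| < dl -> `|du i t - du i t0| <= e by near: i.
have seg (a b : R) : a < b -> (a = t0 \/ b = t0) -> `|b - a| < dl ->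
   `|u i b - u i a - du i t0 * (b - a)| <= e * `|b - a|.
  move=> ab or bdl; have [c /andP[ac cb] ->] := mvt ab (fun x _ => Hi x).
  rewrite -mulrBl normrM ler_wpM2r// Hj//.
  rewrite gtr0_norm ?subr_gt0// in bdl.
  by rewrite ltr_norml; case: or => <-; apply/andP; split; lra.
have [yt|ty|->] := ltgtP y t0; last by rewrite !subrr mulr0 subrr !normr0 mulr0.
  rewrite -normrN (distrC y); have := seg y t0 yt; rewrite (distrC t0 y) => /(_ _ ydl)/wrap[].
    by right.
  by congr (`| _ | <= _); ring.
by apply: seg => //; left.
Unshelve. all: end_near. Qed.

Lemma antiderivative f : (forall x, {for x, continuous f}) ->
  exists F : R -> R, forall x, is_derive x 1 F (f x).
Proof.
move=> cf.
have loc (n : R) : 0 < n -> exists2 G : R -> R, G 0 = 0 &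
    forall x, - n < x < n -> is_derive x 1 G (f x).
  move=> n0; pose F x := (\int[lebesgue_measure]_(t in `[- n, x]) f t)%R.
  exists (fun x => F x - F 0); first by rewrite subrr.
  move=> x /andP[nx xn]; apply: (isD_eq (isD_sub _ (isD_cst (F 0) x)) (subr0 _)).
  apply/entire_derP; apply: (@continuous_FTC1 R f (BLeft (- n)) x n xn) => //.
  apply: continuous_compact_integrable; first exact: segment_compact.
  by apply: continuous_subspaceT => y; exact: cf.
have locn (n : nat) := loc n.+1%:R (ltr0Sn _ _).
have /choice[G HG] : forall n : nat, exists G : R -> R, G 0 = 0 /\
    forall x, - n.+1%:R < x < n.+1%:R -> is_derive x 1 G (f x).
  by move=> n; have [G G0 G1] := locn n; exists G.
have agree (n m : nat) x : (n <= m)%N -> - n.+1%:R < x < n.+1%:R -> G n x = G m x.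
  move=> nm /andP[nx xn].
  have nmR : n.+1%:R <= m.+1%:R :> R by rewrite ler_nat.
  have D0 y : - n.+1%:R < y < n.+1%:R -> is_derive y 1 (fun y => G n y - G m y) (0 : R).
    move=> /andP[ny yn]; apply: (isD_eq (isD_sub ((HG n).2 y _) ((HG m).2 y _))).
    - by rewrite ny yn.
    - by apply/andP; split; lra.
    - by rewrite subrr.
  have z (a b : R) : a <= b -> - n.+1%:R < a -> b < n.+1%:R -> G n b - G m b = G n a - G m a.
    move=> ab na bn; have Dab y : a <= y <= b -> is_derive y 1 (fun y => G n y - G m y) (0 : R).
      by move=> /andP[ay yb]; apply: D0; apply/andP; split; lra.
    apply/eqP; rewrite eq_le (derive_le0_le ab Dab)// (derive_ge0_le ab Dab)//.
  have n0 : 0 < n.+1%:R :> R by rewrite ltr0n.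
  apply/eqP; rewrite -subr_eq0; apply/eqP.
  have [x0|x0] := leP 0 x.
    by rewrite (z 0 x x0) ?oppr_lt0// (HG n).1 (HG m).1 subrr.
  by rewrite -(z x 0 (ltW x0))// (HG n).1 (HG m).1 subrr.
pose N x := (Num.truncn `|x|).+1.
have Nx x : - (N x).+1%:R < x < (N x).+1%:R.
  have : `|x| < (N x).+1%:R.
    rewrite (lt_trans (truncnS_gt _))// ltr_nat //.
  by rewrite ltr_norml.
exists (fun x => G (N x) x) => x.
have [m [Nm xm]] : exists m : nat, (N x <= m)%N /\ `|x| + 1 < m.+1%:R.
  exists (N x).+1; split=> //; rewrite -addn1 natrD ltrD2r.
  by have := Nx x; rewrite -ltr_norml.
have : is_derive x 1 (G m) (f x).
  by apply: (HG m).2; rewrite -ltr_norml; lra.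
move/is_derive_epsP => H; apply/is_derive_epsP => e e0; have [dl dl0 Hd] := H e e0.
exists (Num.min dl 1); first by rewrite lt_min dl0 ltr01.
have E y : `|y - x| < 1 -> G (N y) y = G m y.
  move=> yx; have ym : - m.+1%:R < y < m.+1%:R.
    rewrite -ltr_norml; have := ler_normD x (y - x); rewrite addrC subrK; lra.
  have [h|h] := leqP (N y) m; first exact: agree.
  by rewrite -(agree _ _ _ (ltnW h)).
move=> y; rewrite lt_min => /andP[y1 y2].
by rewrite (E y y2) (E x) ?subrr ?normr0// Hd.
Qed.

(* Subtracting the quadratic interpolant of [F] at [p], [x], [s], Rolle's
   theorem gives two zeros of a concave function on either side of the middle
   node; concavity then fixes the sign of its value at [x]. *)
Lemma concave_derive_four_points (F dF : R -> R) (p x s lo : R) :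
  lo <= p -> lo <= x -> p < s -> x < s -> p != x ->
  (forall z : R, is_derive z 1 F (dF z)) ->
  concave_on dF [set z | lo <= z <= s] ->
  0 <= (x - p) * (dF x + (F s - F p) / (s - p) - (F x - F p) / (x - p)
                  - (F s - F x) / (s - x)).
Proof.
move=> lop lox ps xs pNx HF conc.
have sp0 : s - p != 0 by rewrite subr_eq0 gt_eqF.
have sx0 : s - x != 0 by rewrite subr_eq0 gt_eqF.
have xp0 : x - p != 0 by rewrite subr_eq0 eq_sym.
pose m := (F s - F p) / (s - p).
pose k := (F x - F p - (x - p) * m) / ((x - p) * (x - s)).
pose E z := F z - (F p + (z - p) * m + (z - p) * (z - s) * k).
pose dE z := dF z - (m + (2 * z - p - s) * k).
have HE (z : R) : is_derive z 1 E (dE z).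
  have H1 (c : R) : is_derive z 1 (fun z : R => z - c) (1 : R).
    by apply: (isD_eq (isD_sub (isD_id z) (isD_cst c z))); rewrite subr0.
  apply: isD_sub (HF z) _; rewrite /=.
  apply: (isD_eq (isD_add (isD_add (isD_cst (F p) z) (isD_mul (H1 p) (isD_cst m z)))
     (isD_mul (isD_mul (H1 p) (H1 s)) (isD_cst k z)))).
  by ring.
have Ep : E p = 0 by rewrite /E; ring.
have Es : E s = 0 by rewrite /E /m; field.
have xs0 : x - s != 0 by rewrite -opprB oppr_eq0.
have Ex : E x = 0 by rewrite /E /k /m; field; rewrite xs0 sp0 xp0.
have goalE : dF x + (F s - F p) / (s - p) - (F x - F p) / (x - p) - (F s - F x) / (s - x) = dE x.
  by rewrite /dE /k /m; field; rewrite xs0 sp0 xp0 sx0.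
rewrite goalE.
have zero (a b : R) : a < b -> E a = 0 -> E b = 0 -> exists2 c, a < c < b & dE c = 0.
  move=> ab Ea Eb; have [c cab] := mvt ab (fun y _ => HE y).
  rewrite Ea Eb subrr => /esym/eqP; rewrite mulf_eq0 (subr_eq0 b) (gt_eqF ab) orbF => /eqP.
  by exists c.
have concE (a b t : R) : lo <= a <= s -> lo <= b <= s -> 0 < t < 1 ->
    t * dE a + (1 - t) * dE b <= dE (t * a + (1 - t) * b).
  move=> ha hb ht; have := conc a b t ha hb ht; rewrite /dE; lra.
have [px|xp|/esym/eqP] := ltgtP p x; last by move=> E0; rewrite eq_sym E0 in pNx.
- have [c1 /andP[pc1 c1x] dc1] := zero p x px Ep Ex.
  have [c2 /andP[xc2 c2s] dc2] := zero x s xs Ex Es.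
  apply: mulr_ge0; first by rewrite subr_ge0 ltW.
  pose t := (c2 - x) / (c2 - c1).
  have c21 : 0 < c2 - c1 by lra.
  have := concE c1 c2 t; rewrite dc1 dc2 !mulr0 addr0.
  have -> : t * c1 + (1 - t) * c2 = x by rewrite /t; field; rewrite gt_eqF.
  have t0 : 0 < t by rewrite /t divr_gt0//; lra.
  apply; [lra|lra|]; rewrite t0 /= /t ltr_pdivrMr// mul1r; lra.
- have [c1 /andP[xc1 c1p] dc1] := zero x p xp Ex Ep.
  have [c2 /andP[pc2 c2s] dc2] := zero p s ps Ep Es.
  have x0 : x - p <= 0 by lra.
  apply: mulr_le0 => //.
  pose t := (c2 - c1) / (c2 - x).
  have c2x : 0 < c2 - x by lra.
  have t0 : 0 < t by rewrite /t divr_gt0//; lra.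
  have := concE x c2 t; rewrite dc2 mulr0 addr0.
  have -> : t * x + (1 - t) * c2 = c1 by rewrite /t; field; rewrite gt_eqF.
  rewrite dc1 pmulr_rle0//; apply; [lra|lra|].
  by rewrite t0 /t /= ltr_pdivrMr// mul1r; lra.
Qed.

End real_analysis.

Section compactness.
Context {R : realType}.

Lemma continuous_at2 {X Y Z : topologicalType} {T : topologicalType} (f : X * Y -> Z) (a : T -> X)
  (b : T -> Y) (t : T) : {for (a t, b t), continuous f} -> {for t, continuous a} ->
  {for t, continuous b} -> {for t, continuous (fun t => f (a t, b t))}.
Proof.
move=> cf ca cb; apply: (@continuous_comp _ _ _ (fun t => (a t, b t)) f) => //.
exact: cvg_pair.
Qed.

Lemma compact_tube {X Y : topologicalType} (q : X * Y -> R) (K : set Y) (x0 : X) (e : R) :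
  compact K -> (forall y, K y -> {for (x0, y), continuous q}) -> 0 < e ->
  \forall x \near x0, forall y, K y -> `|q (x, y) - q (x0, y)| < e.
Proof.
move=> cK cq e0.
have := (compact_near_coveringP K).1 cK X (nbhs x0)
  (fun x y => `|q (x, y) - q (x0, y)| < e) _.
apply => y Ky.
have e20 : 0 < e / 2 by rewrite divr_gt0.
have /cvgrPdist_lt/(_ _ e20) : q z @[z --> (x0, y)] --> q (x0, y) by exact: cq.
move=> [[A B] /= [Ax By] AB].
exists (B, A) => //= -[y' x] /= [By' Ax'].
have h1 := AB (x, y') (conj Ax' By').
have h2 := AB (x0, y') (conj (nbhs_singleton Ax) By').
rewrite /= in h1 h2.
have := ler_distD (q (x0, y)) (q (x, y')) (q (x0, y')).
rewrite (distrC (q (x0, y)) (q (x, y'))) in h1; lra.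
Qed.

Definition sup_over {X Y : Type} (q : X * Y -> R) (K : set Y) (x : X) : R :=
  sup [set q (x, y) | y in K].

Section sup_over.
Context {X Y : topologicalType} (q : X * Y -> R) (K : set Y).
Hypotheses (cK : compact K) (K0 : K !=set0) (cq : continuous q).

Lemma sup_over_attained x : exists2 y, K y & sup_over q K x = q (x, y) /\
  forall z, K z -> q (x, z) <= q (x, y).
Proof.
have [|y Ky Hy] := @compact_EVT_max Y R (fun y => q (x, y)) K K0 cK.
  apply: continuous_subspaceT => y; apply: (@continuous_at2 _ _ _ _ q).
  - exact: cq.
  - exact: cst_continuous.
  - by [].
exists y; first exact: set_mem.
have mx z : K z -> q (x, z) <= q (x, y) by move=> Kz; apply: Hy; exact/mem_set.
split=> //; apply/eqP; rewrite eq_le; apply/andP; split.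
  apply: ge_sup; first by exists (q (x, y)), y => //; exact: set_mem.
  by move=> _ [z Kz <-]; exact: mx.
apply: ub_le_sup; last by exists y => //; exact: set_mem.
by exists (q (x, y)) => _ [z Kz <-]; exact: mx.
Qed.

Lemma sup_over_ub x y : K y -> q (x, y) <= sup_over q K x.
Proof. by move=> Ky; have [z Kz [-> ]] := sup_over_attained x; apply. Qed.

Lemma sup_over_continuous : continuous (sup_over q K).
Proof.
move=> x; apply/cvgrPdist_lt => /= e e0.
have := @compact_tube X Y q K x e cK (fun y _ => @cq (x, y)) e0.
apply: filterS => x' Hx'.
have [y Ky [Ey my]] := sup_over_attained x.
have [y' Ky' [Ey' my']] := sup_over_attained x'.
rewrite Ey Ey'; have := Hx' y Ky; have := Hx' y' Ky'.
have := my y' Ky'; have := my' y Ky.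
rewrite !ltr_norml => ? ? /andP[? ?] /andP[? ?]; apply/andP; split; lra.
Qed.

End sup_over.

Lemma compact_lower_bound {X : topologicalType} (f : X -> R) (K : set X) : compact K ->
  continuous f -> (forall x, K x -> 0 < f x) -> exists2 e : R, 0 < e & forall x, K x -> e <= f x.
Proof.
move=> cK cf f0; have [K0|/nonemptyPn K0] := pselect (K !=set0); last first.
  by exists 1 => // x; rewrite K0.
have [|y /set_mem Ky Hy] := @compact_EVT_min X R f K K0 cK.
  exact: continuous_subspaceT.
by exists (f y); [exact: f0|move=> x Kx; apply: Hy; exact/mem_set].
Qed.

Lemma compact_norm_bound {X : topologicalType} (f : X -> R) (K : set X) : compact K ->
  continuous f -> exists2 M : R, 0 < M & forall x, K x -> `|f x| <= M.
Proof.
move=> cK cf; have [K0|/nonemptyPn K0] := pselect (K !=set0); last first.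
  by exists 1 => // x; rewrite K0.
have [|y /set_mem Ky Hy] := @compact_EVT_max X R (fun x => `|f x|) K K0 cK.
  apply: continuous_subspaceT => x; apply: (@continuous_comp _ _ _ f (fun y : R => `|y|)); first exact: cf.
  exact: norm_continuous.
exists (`|f y| + 1); first by rewrite ltr_wpDl.
by move=> x Kx; have := Hy x (mem_set Kx); lra.
Qed.

End compactness.

(** * Extremal functionals dominated by a sublinear one *)

Section extremal_functional.
Context {R : realType} {V : lmodType R} (D : set V).
Hypothesis DD : forall f g, D f -> D g -> D (f + g).
Hypothesis DZ : forall (a : R) f, D f -> D (a *: f).

Definition sublinear_on (q : V -> R) :=
  (forall f g, D f -> D g -> q (f + g) <= q f + q g) /\
  (forall (a : R) f, 0 <= a -> D f -> q (a *: f) = a * q f).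

Definition linear_on (L : V -> R) :=
  (forall f g, D f -> D g -> L (f + g) = L f + L g) /\
  (forall (a : R) f, D f -> L (a *: f) = a * L f).

Definition le_on (L q : V -> R) := forall f, D f -> L f <= q f.

Definition face_of (p q : V -> R) := forall (L1 L2 : V -> R) (al : R), 0 < al < 1 ->
  linear_on L1 -> linear_on L2 -> le_on L1 p -> le_on L2 p ->
  le_on (fun f => al * L1 f + (1 - al) * L2 f) q -> le_on L1 q.

Definition tilt (q : V -> R) (phi psi : V) : R :=
  inf [set q (psi + t *: phi) - t * q phi | t in [set t : R | 0 <= t]].

Let DN f : D f -> D (- f). Proof. by move=> Df; rewrite -scaleN1r; exact: DZ. Qed.

Lemma sublinear_on0 q : sublinear_on q -> D 0 -> q 0 = 0.
Proof. by move=> [_ qZ] D0; rewrite -(scale0r 0) qZ // mul0r. Qed.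

Lemma sublinear_onN q f : sublinear_on q -> D f -> - q (- f) <= q f.
Proof.
move=> Sq Df; have [qD _] := Sq; have := qD f (- f) Df (DN Df).
rewrite subrr sublinear_on0//; last by rewrite -(scale0r f); exact: DZ.
by lra.
Qed.

Section tilt.
Variables (q : V -> R) (phi : V).
Hypotheses (Sq : sublinear_on q) (Dphi : D phi).

Let tilt_lb psi : D psi ->
  lbound [set q (psi + t *: phi) - t * q phi | t in [set t : R | 0 <= t]] (- q (- psi)).
Proof.
move=> Dpsi _ [t t0 <-]; have [qD qZ] := Sq.
have := qD (psi + t *: phi) (- psi) (DD Dpsi (DZ _ Dphi)) (DN Dpsi).
by rewrite addrC addKr qZ//; lra.
Qed.

Lemma tilt_le psi (t : R) : D psi -> 0 <= t -> tilt q phi psi <= q (psi + t *: phi) - t * q phi.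
Proof.
by move=> Dpsi t0; apply: ge_inf; [exists (- q (- psi)); exact: tilt_lb|exists t].
Qed.

Lemma le_tilt psi (c : R) : (forall t : R, 0 <= t -> c <= q (psi + t *: phi) - t * q phi) ->
  c <= tilt q phi psi.
Proof.
move=> H; apply: lb_le_inf; first by exists (q (psi + 0 *: phi) - 0 * q phi), 0 => /=.
by move=> _ [t t0 <-]; exact: H.
Qed.

Lemma tilt_lower : le_on (tilt q phi) q.
Proof.
move=> psi Dpsi; have := @tilt_le psi 0 Dpsi (lexx _).
by rewrite scale0r addr0 mul0r subr0.
Qed.

Lemma tilt_opp : tilt q phi (- phi) <= - q phi.
Proof.
have := @tilt_le (- phi) 1 (DN Dphi) ler01.
rewrite scale1r addNr mul1r sublinear_on0// ?sub0r//.
by rewrite -(scale0r phi); exact: DZ.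
Qed.

Lemma tilt_sublinear : sublinear_on (tilt q phi).
Proof.
have [qD qZ] := Sq; split=> [f g Df Dg|a f].
  rewrite -lerBlDr; apply: le_tilt => t t0.
  rewrite lerBlDr -lerBlDl; apply: le_tilt => s s0.
  have := @tilt_le (f + g) (t + s) (DD Df Dg) (addr_ge0 t0 s0).
  have := qD _ _ (DD Df (DZ t Dphi)) (DD Dg (DZ s Dphi)).
  by rewrite addrACA -scalerDl; lra.
rewrite le_eqVlt => /predU1P[<- Df|a0 Df].
  rewrite scale0r mul0r; apply/eqP; rewrite eq_le; apply/andP; split.
    have D0 : D 0 by rewrite -(scale0r f); exact: DZ.
    by have := tilt_lower D0; rewrite (sublinear_on0 Sq D0).
  by apply: le_tilt => t t0; rewrite add0r qZ// subrr.
have ai : 0 < a^-1 by rewrite invr_gt0.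
apply/eqP; rewrite eq_le; apply/andP; split.
  rewrite -ler_pdivrMl//; apply: le_tilt => t t0; rewrite ler_pdivrMl//.
  have := @tilt_le (a *: f) (a * t) (DZ a Df) (mulr_ge0 (ltW a0) t0).
  rewrite -scalerA -scalerDr qZ ?(ltW a0)//; last exact: DD Df (DZ _ Dphi).
  by rewrite mulrBr mulrA.
apply: le_tilt => t t0; rewrite -ler_pdivlMl//.
have := @tilt_le f (a^-1 * t) Df (mulr_ge0 (ltW ai) t0).
congr (_ <= _); rewrite mulrBr mulrA -(qZ a^-1) ?(ltW ai)//; last exact: DD (DZ _ Df) (DZ _ Dphi).
by rewrite scalerDr !scalerA mulVf ?gt_eqF// scale1r.
Qed.

Lemma tilt_face p : face_of p q -> le_on q p -> face_of p (tilt q phi).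
Proof.
move=> Fq qp L1 L2 al al01 l1 l2 L1p L2p H f Df; have /andP[a0 a1] := al01.
have Hq : le_on (fun f => al * L1 f + (1 - al) * L2 f) q.
  by move=> g Dg; exact: le_trans (H g Dg) (tilt_lower Dg).
have L1q := Fq _ _ _ al01 l1 l2 L1p L2p Hq.
have L2q : le_on L2 q.
  apply: (Fq L2 L1 (1 - al)) => //; first by apply/andP; split; lra.
  by move=> g Dg; have := Hq g Dg; lra.
have E1 : L1 phi = q phi.
  have := le_trans (H _ (DN Dphi)) tilt_opp.
  rewrite -scaleN1r l1.2// l2.2//; have := L1q _ Dphi; have := L2q _ Dphi.
  by move=> ? ? ?; apply/eqP; rewrite eq_le; apply/andP; split; nra.
apply: le_tilt => t t0; have := L1q _ (DD Df (DZ t Dphi)).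
by rewrite l1.1 ?l1.2// ?E1; [lra|exact: DZ].
Qed.

End tilt.

(* A minimal element of the set of sublinear functionals that cut out a face of
   [{L | L <= p}] must be fixed by every [tilt], hence linear and extremal. *)
Lemma extremal_linear_functional (p : V -> R) (phi : V) : sublinear_on p -> D phi ->
  exists L : V -> R, [/\ linear_on L, le_on L p, L phi = p phi &
    forall (L1 L2 : V -> R) (al : R), 0 < al < 1 -> linear_on L1 -> linear_on L2 ->
      le_on L1 p -> le_on L2 p ->
      (forall f, D f -> L f = al * L1 f + (1 - al) * L2 f) ->
      forall f, D f -> L1 f = L f].
Proof.
move=> Sp Dphi.
pose good q := [/\ sublinear_on q, le_on q p, face_of p q & q (- phi) <= - p phi].
pose T := {q : V -> R | good q}.
pose r (a b : T) := `[< le_on (sval b) (sval a) >].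
have tilt_good q psi : good q -> D psi -> good (tilt q psi).
  move=> [Sq qp Fq qphi] Dpsi; split.
  - exact: tilt_sublinear.
  - by move=> f Df; exact: le_trans (tilt_lower Sq Dpsi Df) (qp _ Df).
  - exact: tilt_face.
  - exact: le_trans (tilt_lower Sq Dpsi (DN Dphi)) qphi.
have t0 : good (tilt p phi).
  split; [exact: tilt_sublinear|exact: tilt_lower| |exact: tilt_opp].
  by apply: tilt_face => //; move=> L1 L2 al _ _ _ L1p.
have [| | |[q gq] qmax] := @ZL_preorder T (exist _ _ t0) r.
- by move=> a; apply/asboolP => f _.
- by move=> a b c /asboolP ab /asboolP bc; apply/asboolP => f Df; exact: le_trans (bc f Df) (ab f Df).
- move=> A Atot; have [A0|/nonemptyPn ->] := pselect (A !=set0); last by exists (exist _ _ t0).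
  pose S f := [set sval a f | a in A].
  have lbS f : D f -> lbound (S f) (- p (- f)).
    move=> Df _ [[a [Sa ap Fa aphi]] Aa <-] /=.
    by apply: le_trans (sublinear_onN Sa Df); rewrite lerN2; exact/ap/DN.
  pose q f := inf (S f).
  have q_le f a : D f -> A a -> q f <= sval a f.
    by move=> Df Aa; apply: ge_inf; [exists (- p (- f)); exact: lbS|exists a].
  have le_q f c : (forall a, A a -> c <= sval a f) -> c <= q f.
    move=> H; apply: lb_le_inf; last by move=> _ [a Aa <-]; exact: H.
    by have [a Aa] := A0; exists (sval a f), a.
  have gq : good q.
    split.
    + split=> [f g Df Dg|a f a0 Df].
        rewrite -lerBlDr; apply: (le_q) => a Aa; rewrite lerBlDr -lerBlDl.
        apply: (le_q) => b Ab; rewrite lerBlDl.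
        have [/asboolP ab|/asboolP ba] := Atot _ _ Aa Ab.
          have [[+ _] _ _ _] := svalP b => /(_ f g Df Dg) H.
          by have := q_le (f + g) b (DD Df Dg) Ab; have := ab f Df; lra.
        have [[+ _] _ _ _] := svalP a => /(_ f g Df Dg) H.
        by have := q_le (f + g) a (DD Df Dg) Aa; have := ba g Dg; lra.
      have aZ (b : T) : sval b (a *: f) = a * sval b f by have [[_ +] _ _ _] := svalP b; exact.
      move: a0; rewrite le_eqVlt => /predU1P[a0|a0].
        have E (b : T) : sval b (a *: f) = 0 by rewrite aZ -a0 mul0r.
        have -> : a * q f = 0 by rewrite -a0 mul0r.
        apply/eqP; rewrite eq_le; apply/andP; split.
          by have [b Ab] := A0; rewrite -(E b); apply: (q_le) => //; exact: DZ.
        by apply: (le_q) => b _; rewrite E.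
      apply/eqP; rewrite eq_le; apply/andP; split.
        rewrite -ler_pdivrMl//; apply: (le_q) => b Ab; rewrite ler_pdivrMl// -aZ.
        by apply: (q_le) => //; exact: DZ.
      by apply: (le_q) => b Ab; rewrite aZ ler_pM2l//; exact: q_le.
    + move=> f Df; have [a Aa] := A0; apply: le_trans (q_le f a Df Aa) _.
      by have [_ + _ _] := svalP a; exact.
    + move=> L1 L2 al al01 l1 l2 L1p L2p H f Df; apply: (le_q) => a Aa.
      have [_ _ + _] := svalP a; apply; [exact: al01|exact: l1|exact: l2|exact: L1p|exact: L2p| |exact: Df].
      by move=> g Dg; exact: le_trans (H g Dg) (q_le g a Dg Aa).
    + have [a Aa] := A0; apply: le_trans (q_le _ a (DN Dphi) Aa) _.
      by have [_ _ _ +] := svalP a.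
  by exists (exist _ q gq) => a Aa; apply/asboolP => f Df /=; exact: q_le.
have [Sq qp Fq qphi] := gq.
have tq psi f : D psi -> D f -> q f <= tilt q psi f.
  move=> Dpsi Df; have lt : r (exist _ q gq) (exist _ _ (tilt_good _ _ gq Dpsi)).
    by apply/asboolP => g Dg; exact: tilt_lower.
  by have /asboolP := qmax _ lt; apply.
have qN f : D f -> q (- f) = - q f.
  move=> Df; apply/eqP; rewrite eq_le; apply/andP; split.
    exact: le_trans (tq f (- f) Df (DN Df)) (tilt_opp Sq Df).
  by rewrite lerNl; exact: sublinear_onN.
have linq : linear_on q.
  split=> [f g Df Dg|a f Df].
    apply/eqP; rewrite eq_le Sq.1//=.
    have := Sq.1 _ _ (DD Df Dg) (DN Dg); rewrite addrK qN//; lra.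
  have [a0|a0] := leP 0 a; first by rewrite Sq.2.
  have := Sq.2 (- a) f; rewrite oppr_ge0 (ltW a0) => /(_ isT Df).
  by rewrite scaleNr qN ?mulNr; [move/oppr_inj|exact: DZ].
exists q; split=> //.
  apply/eqP; rewrite eq_le qp//=; move: qphi; rewrite qN// lerN2.
  by [].
move=> L1 L2 al al01 l1 l2 L1p L2p H f Df.
have L1q := Fq _ _ _ al01 l1 l2 L1p L2p (fun g Dg => ltac:(rewrite H//)).
apply/eqP; rewrite eq_le L1q//=.
have := L1q _ (DN Df); rewrite qN// -scaleN1r l1.2// mulN1r lerN2.
by [].
Qed.

End extremal_functional.

(** * Riesz representation on a compact space *)

Section urysohn_distance.
Context {R : realType} {Om : pseudoPMetricType R}.
Implicit Types (U : set Om) (w : Om) (e : R).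

Definition depth (U : set Om) (w : Om) : R :=
  sup [set r : R | 0 <= r <= 1 /\ (r = 0 \/ ball w r `<=` U)].

Let depth_ub U w : ubound [set r : R | 0 <= r <= 1 /\ (r = 0 \/ ball w r `<=` U)] 1.
Proof. by move=> r [/andP[]]. Qed.

Let depth_mem0 U w : [set r : R | 0 <= r <= 1 /\ (r = 0 \/ ball w r `<=` U)] 0.
Proof. by rewrite /= lexx ler01; split=> //; left. Qed.

Lemma depth_ge0 U w : 0 <= depth U w.
Proof. by apply: ub_le_sup; [exists 1; exact: depth_ub|exact: depth_mem0]. Qed.

Lemma depth_out U w : ~ U w -> depth U w = 0.
Proof.
move=> Uw; apply/eqP; rewrite eq_le depth_ge0 andbT.
apply: ge_sup; first by exists 0; exact: depth_mem0.
move=> r [/andP[r0 _] [->//|H]]; rewrite leNgt; apply/negP => r0'.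
by apply: Uw; apply: H; exact: ballxx.
Qed.

Lemma depth_in U w : open U -> U w -> 0 < depth U w.
Proof.
move=> oU Uw; have /nbhs_ballP[e /= e0 He] : nbhs w U by exact: open_nbhs_nbhs.
apply: (@lt_le_trans _ _ (Num.min e 1)); first by rewrite lt_min e0 ltr01.
apply: ub_le_sup; first by exists 1; exact: depth_ub.
split; first by rewrite le_min ltW//= ler01 ge_min lexx orbT.
by right=> w' /(@le_ball _ _ w _ e); rewrite ge_min lexx => /(_ isT)/He.
Qed.

Let depth_lip U w w' e : 0 < e -> ball w e w' -> depth U w - e <= depth U w'.
Proof.
move=> e0 ww'; rewrite lerBlDr; apply: ge_sup; first by exists 0; exact: depth_mem0.
move=> r [/andP[r0 r1] H]; have [re|er] := leP r e.
  by rewrite (le_trans re)// lerDr depth_ge0.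
rewrite -lerBlDr; apply: ub_le_sup; first by exists 1; exact: depth_ub.
split; first by apply/andP; split; lra.
case: H => [r00|H]; first by move: er; rewrite r00 ltNge ltW.
by right=> z w'z; apply: H; rewrite -(subrK e r) addrC; exact: ball_triangle ww' w'z.
Qed.

Lemma depth_continuous U : continuous (depth U).
Proof.
move=> w; apply/cvgrPdist_le => /= e e0; apply/nbhs_ballP; exists e => //= w' ww'.
rewrite ler_norml; apply/andP; split.
  by have := depth_lip U e0 (ball_sym ww'); lra.
by have := depth_lip U e0 ww'; lra.
Qed.

End urysohn_distance.

Section continuous_functionals.
Context {R : realType} {X : topologicalType}.

Lemma continuous_fun_add (f g : X -> R) : continuous f -> continuous g ->
  continuous (fun w => f w + g w).
Proof. by move=> cf cg w; apply: cvgD; [exact: cf|exact: cg]. Qed.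

Lemma continuous_fun_scale (a : R) (f : X -> R) : continuous f -> continuous (fun w => a * f w).
Proof. by move=> cf w; apply: cvgM; [exact: cvg_cst|exact: cf]. Qed.

Lemma linear_on_sum (L : (X -> R) -> R) n (g : nat -> X -> R) :
  linear_on (fun f : X -> R => continuous f) L ->
  (forall i, continuous (g i)) ->
  continuous (fun w => \sum_(i < n) g i w) /\
  L (fun w => \sum_(i < n) g i w) = \sum_(i < n) L (g i).
Proof.
move=> Llin cg; elim: n => [|n [cn IH]].
  under eq_fun do rewrite big_ord0; rewrite big_ord0; split; first exact: cst_continuous.
  have := Llin.2 0 (fun=> 0) (@cst_continuous _ _ _); rewrite mul0r => {2}<-.
  by congr L; apply/funext => w; rewrite /= [RHS]mul0r.
under eq_fun do rewrite big_ord_recr /=.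
by rewrite big_ord_recr /= -IH -Llin.1//; split=> //; exact: continuous_fun_add.
Qed.

End continuous_functionals.

Section riesz.
Context {R : realType} {Om : pseudoPMetricType R}.
Hypothesis cOm : compact [set: Om].
Variable L : (Om -> R) -> R.
Hypothesis Llin : linear_on (fun f : Om -> R => continuous f) L.
Hypothesis Lmono : forall f g : Om -> R, continuous f -> continuous g ->
  (forall w, f w <= g w) -> L f <= L g.
Hypothesis L1 : L (fun=> 1) = 1.
Implicit Types (U W A B : set Om) (f g : Om -> R) (d e c : R).

Definition bump_in (U : set Om) (f : Om -> R) :=
  [/\ continuous f, forall w, 0 <= f w <= 1 & forall w, ~ U w -> f w = 0].

Definition open_content (U : set Om) : R := sup [set L f | f in bump_in U].

Definition outer_content (A : set Om) : R :=
  inf [set open_content U | U in [set U | open U /\ A `<=` U]].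

Let Lcst (c : R) : L (fun=> c) = c.
Proof.
have := Llin.2 c (fun=> 1) (@cst_continuous _ _ _).
by rewrite L1 mulr1 => {2}<-; congr L; apply/funext => w; rewrite /= [RHS]mulr1.
Qed.

Let LD (f g : Om -> R) : continuous f -> continuous g -> L (fun w => f w + g w) = L f + L g.
Proof. by move=> cf cg; rewrite -Llin.1. Qed.

Let bump0 U : bump_in U (fun=> 0).
Proof. by split=> //; [exact: cst_continuous|move=> _; rewrite lexx ler01]. Qed.

Let open_content_ub U : ubound [set L f | f in bump_in U] 1.
Proof.
move=> _ [f [cf f01 _] <-]; rewrite -[leRHS]L1; apply: Lmono => //.
  exact: cst_continuous.
by move=> w; have /andP[] := f01 w.
Qed.

Lemma bump_le U f : bump_in U f -> L f <= open_content U.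
Proof.
by move=> bf; apply: ub_le_sup; [exists 1; exact: open_content_ub|exists f].
Qed.

Lemma open_content_le U (c : R) : (forall f, bump_in U f -> L f <= c) -> open_content U <= c.
Proof.
move=> H; apply: ge_sup; first by exists (L (fun=> 0)), (fun=> 0).
by move=> _ [f bf <-]; exact: H.
Qed.

Lemma open_content_ge0 U : 0 <= open_content U.
Proof. by rewrite -[leLHS](Lcst 0); exact: bump_le. Qed.

Lemma open_content_le1 U : open_content U <= 1.
Proof. by apply: open_content_le => f bf; apply: (@open_content_ub U); exists f. Qed.

Lemma open_contentT : open_content setT = 1.
Proof.
apply/eqP; rewrite eq_le open_content_le1 -[leLHS]L1 bump_le//; split=> //.
- exact: cst_continuous.
- by move=> _; rewrite lexx ler01.
- by move=> w /(_ I).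
Qed.

Lemma open_contentS U W : U `<=` W -> open_content U <= open_content W.
Proof.
move=> UW; apply: open_content_le => f [cf f01 fU]; apply: bump_le; split=> // w Ww.
by apply: fU => Uw; apply: Ww; exact: UW.
Qed.

Let outer_lb A : lbound [set open_content U | U in [set U | open U /\ A `<=` U]] 0.
Proof. by move=> _ [U _ <-]; exact: open_content_ge0. Qed.

Lemma outer_content_le A U : open U -> A `<=` U -> outer_content A <= open_content U.
Proof. by move=> oU AU; apply: ge_inf; [exists 0; exact: outer_lb|exists U]. Qed.

Let outer_nonempty A : [set open_content U | U in [set U | open U /\ A `<=` U]] !=set0.
Proof. by exists (open_content setT), setT => //; split=> //; exact: openT. Qed.

Lemma outer_content_ge0 A : 0 <= outer_content A.
Proof. by apply: lb_le_inf; [exact: outer_nonempty|exact: outer_lb]. Qed.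

Lemma outer_content_adherent A (e : R) : 0 < e ->
  exists U, [/\ open U, A `<=` U & open_content U < outer_content A + e].
Proof.
move=> e0; have [|_ [U [oU AU] <-] H] := @inf_adherent R _ e e0 (conj (outer_nonempty A) _).
  by exists 0; exact: outer_lb.
by exists U.
Qed.

Lemma outer_contentE U : open U -> outer_content U = open_content U.
Proof.
move=> oU; apply/eqP; rewrite eq_le outer_content_le//=.
apply: lb_le_inf; first exact: outer_nonempty.
by move=> _ [W [oW UW] <-]; exact: open_contentS.
Qed.

Lemma outer_contentS A B : A `<=` B -> outer_content A <= outer_content B.
Proof.
move=> AB; apply: lb_le_inf; first exact: outer_nonempty.
by move=> _ [W [oW UW] <-]; apply: outer_content_le => //; exact: subset_trans UW.
Qed.

Definition cutoff (d : R) (f : Om -> R) (w : Om) : R := Num.max 0 (f w - d).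

Lemma cutoff_continuous d f : continuous f -> continuous (cutoff d f).
Proof.
move=> cf w; apply: (@continuous_max _ _ (fun=> 0) (fun w => f w - d)).
  exact: cst_continuous.
by apply: cvgB; [exact: cf|exact: cvg_cst].
Qed.

Let L_cutoff d f : continuous f -> 0 <= d -> L f <= L (cutoff d f) + d.
Proof.
move=> cf d0; rewrite -[X in _ + X](Lcst d) -LD; last 2 first.
- exact: cutoff_continuous.
- exact: cst_continuous.
apply: Lmono => //; first by apply: continuous_fun_add; [exact: cutoff_continuous|exact: cst_continuous].
by move=> w; rewrite /cutoff -lerBlDr le_max lexx orbT.
Qed.

Lemma open_content_cover (U : nat -> set Om) f (d : R) : (forall i, open (U i)) ->
  bump_in (\bigcup_i U i) f -> 0 < d ->
  exists n, L f <= \sum_(i < n) open_content (U i) + d.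
Proof.
move=> oU [cf f01 fU] d0; pose K := [set w | d <= f w].
have cK : compact K.
  apply: (subclosed_compact _ cOm) => //.
  by apply: (@closed_comp _ _ f [set x : R | d <= x]) => [w _|]; [exact: cf|exact: closed_ge].
have /(compact_near_coveringP K).1/(_ nat \oo (fun n w => exists2 i, (i < n)%N & U i w) _) := cK.
case=> [w Kw|n _ /(_ n (leqnn n)) Hn].
  have [i _ Uiw] : (\bigcup_i U i) w.
    apply: contrapT => /fU fw0; move: Kw; rewrite /K /= fw0; lra.
  exists (U i, [set n | (i < n)%N]) => /=.
    by split; [exact: open_nbhs_nbhs|exists i.+1].
  by move=> [w' n] /= [Uw' ni]; exists i.
exists n.
pose S w := \sum_(i < n) depth (U i) w.
have cS : continuous S := (linear_on_sum n Llin (fun i => @depth_continuous _ _ (U i))).1.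
have [|c c0 Hc] := @compact_lower_bound R Om S K cK cS.
  move=> w Kw; have [i ni Ui] := Hn w Kw.
  rewrite /S (bigD1 (Ordinal ni)) //= ltr_pwDl ?depth_in//.
  by apply: sumr_ge0 => j _; exact: depth_ge0.
pose g i w := cutoff d f w * (depth (U i) w / Num.max (S w) c).
have m0 w : 0 < Num.max (S w) c by rewrite lt_max c0 orbT.
have cg i : continuous (g i).
  move=> w; apply: cvgM; first exact: cutoff_continuous.
  apply: cvgM; first exact: depth_continuous.
  apply: cvgV; first by rewrite gt_eqF.
  by apply: (@continuous_max _ _ S (fun=> c)); [exact: cS|exact: cst_continuous].
have cut0 w : 0 <= cutoff d f w <= 1.
  by rewrite /cutoff le_max lexx/= ge_max ler01/=; have := f01 w; lra.
have bg (i : 'I_n) : bump_in (U i) (g i).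
  split=> [//|w|w Uw]; last by rewrite /g depth_out// mul0r mulr0.
  have /andP[c0' c1] := cut0 w.
  have q0 : 0 <= depth (U i) w / Num.max (S w) c by rewrite divr_ge0 ?depth_ge0// ltW.
  have q1 : depth (U i) w / Num.max (S w) c <= 1.
    rewrite ler_pdivrMr// mul1r le_max; apply/orP; left.
    rewrite /S (bigD1 i)//= lerDl; apply: sumr_ge0 => j _; exact: depth_ge0.
  by rewrite /g mulr_ge0//= mulr_ile1.
apply: le_trans (L_cutoff cf (ltW d0)) _; rewrite lerD2r.
have -> : cutoff d f = (fun w => \sum_(i < n) g i w).
  apply/funext => w; rewrite -mulr_sumr -mulr_suml -/(S w).
  have [Kw|Kw] := pselect (K w).
    have := Hc w Kw => Scw; rewrite max_l// divff ?mulr1// gt_eqF//; lra.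
  have -> : cutoff d f w = 0; last by rewrite mul0r.
  by rewrite /cutoff max_l// subr_le0 ltW// ltNge; exact/negP.
rewrite (linear_on_sum n Llin cg).2; apply: ler_sum => i _; apply: bump_le; exact: bg.
Qed.

Definition riesz_outer (A : set Om) : \bar R := (outer_content A)%:E.

Let riesz_outer0 : riesz_outer set0 = 0%E.
Proof.
rewrite /riesz_outer outer_contentE; last exact: open0.
congr EFin; apply/eqP; rewrite eq_le open_content_ge0 andbT.
apply: open_content_le => f [cf _ f0]; rewrite (_ : f = fun=> 0) ?Lcst//.
by apply/funext => w; exact: f0.
Qed.

Let riesz_outer_ge0 A : (0 <= riesz_outer A)%E.
Proof. by rewrite lee_fin outer_content_ge0. Qed.

Let riesz_outer_le : {homo riesz_outer : A B / A `<=` B >-> (A <= B)%E}.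
Proof. by move=> A B AB; rewrite lee_fin outer_contentS. Qed.

Let riesz_outer_sub : sigma_subadditive riesz_outer.
Proof.
move=> F; apply/lee_addgt0Pr => e e0.
have e20 : 0 < e / 2 by rewrite divr_gt0.
have en n : 0 < (e / 2) / (2 ^ n.+1)%:R by rewrite divr_gt0// ltr0n expn_gt0.
have /choice[U HU] : forall n, exists U, [/\ open U, F n `<=` U &
    open_content U < outer_content (F n) + (e / 2) / (2 ^ n.+1)%:R].
  by move=> n; exact: outer_content_adherent.
have oU n : open (U n) by have [] := HU n.
apply: (@le_trans _ _ (open_content (\bigcup_n U n))%:E).
  rewrite lee_fin; apply: outer_content_le; first exact: bigcup_open.
  by move=> w [n _ Fw]; exists n => //; have [_ + _] := HU n; exact.
have fin n : (\sum_(i < n) riesz_outer (F i) <= \sum_(i <oo) riesz_outer (F i))%E.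
  by rewrite -(big_mkord xpredT (fun i => riesz_outer (F i))); exact: nneseries_lim_ge.
have step n : ((\sum_(i < n) open_content (U i))%:E + (e / 2)%:E <=
    \sum_(i < n) riesz_outer (F i) + e%:E)%E.
  rewrite sumEFin -!EFinD lee_fin.
  have : \sum_(i < n) open_content (U i) <=
      \sum_(i < n) (outer_content (F i) + (e / 2) / (2 ^ i.+1)%:R).
    by apply: ler_sum => i _; have [_ _ /ltW] := HU i.
  have : \sum_(i < n) (e / 2) / (2 ^ i.+1)%:R <= e / 2.
    have : \sum_(i < n) (e / 2) / (2 ^ i.+1)%:R = e / 2 - (e / 2) / (2 ^ n)%:R.
      elim: n => [|n IH]; first by rewrite big_ord0 expn0 divr1 subrr.
      rewrite big_ord_recr /= IH expnS natrM; field.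
      by rewrite natrX expf_neq0.
    move=> ->; rewrite gerBl divr_ge0// ltW//.
  by rewrite big_split /=; lra.
case E : (\sum_(i <oo) riesz_outer (F i))%E => [r| |].
- rewrite -EFinD lee_fin; apply: open_content_le => f bf.
  have [n Hn] := open_content_cover oU bf e20.
  rewrite -lee_fin EFinD -E.
  apply: (@le_trans _ _ (\sum_(i < n) riesz_outer (F i) + e%:E)%E); last by rewrite leeD2r.
  by apply: le_trans (step n); rewrite -EFinD lee_fin.
- by rewrite addye// leey.
- have : (0 <= \sum_(i <oo) riesz_outer (F i))%E by exact: nneseries_ge0.
  by rewrite E.
Qed.

HB.instance Definition _ := isOuterMeasure.Build R Om riesz_outer
  riesz_outer0 riesz_outer_ge0 riesz_outer_le riesz_outer_sub.

Lemma open_caratheodory U : open U -> caratheodory_measurable riesz_outer U.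
Proof.
move=> oU; apply: le_caratheodory_measurable => X; rewrite -EFinD lee_fin.
apply/ler_addgt0Pr => e e0.
have d0 : 0 < e / 2 by rewrite divr_gt0.
have [W [oW XW HW]] := outer_content_adherent X d0.
have oWU : open (W `&` U) by exact: openI.
have h1 : outer_content (X `&` U) <= open_content (W `&` U).
  by apply: outer_content_le => //; exact: setSI.
suff h2 : open_content (W `&` U) + outer_content (X `&` ~` U) <= open_content W + e / 2.
  by lra.
rewrite -lerBrDr; apply: open_content_le => f [cf f01 fU].
pose d := e / 2.
pose K := [set w | d <= f w].
have clK : closed K.
  by apply: (@closed_comp _ _ f [set x : R | d <= x]) => [w _|]; [exact: cf|exact: closed_ge].
have KU : K `<=` W `&` U.
  by move=> w Kw; apply: contrapT => /fU fw0; move: Kw; rewrite /K /= fw0 /d; lra.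
have oWK : open (W `\` K) by rewrite setDE; apply: openI => //; exact: closed_openC.
have h3 : outer_content (X `&` ~` U) <= open_content (W `\` K).
  apply: outer_content_le => // w [Xw Uw]; split; first exact: XW.
  by move=> /KU[].
rewrite lerBrDr; apply: (@le_trans _ _ (L f + open_content (W `\` K))).
  by rewrite lerD2l.
rewrite -lerBrDl; apply: open_content_le => g [cg g01 gW].
have cc := @cutoff_continuous d f cf.
have : L (fun w => cutoff d f w + g w) <= open_content W.
  apply: bump_le; split=> [|w|w Ww]; first exact: continuous_fun_add.
    have := f01 w; have := g01 w; rewrite /cutoff.
    have [Kw|Kw] := pselect (K w).
      rewrite (gW w); last by move=> [].
      rewrite addr0 => _ /andP[_ fw1]; rewrite le_max lexx /= ge_max ler01 /=.
      by rewrite lerBlDr (le_trans fw1)// lerDl ltW.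
    have -> : Num.max 0 (f w - d) = 0; last by rewrite add0r.
    by rewrite max_l// subr_le0 ltW// ltNge; exact/negP.
  rewrite gW; last by move=> [].
  rewrite /cutoff fU; last by move=> [].
  by rewrite max_l ?addr0// sub0r oppr_le0 ltW.
rewrite LD//; have := L_cutoff cf (ltW d0); rewrite -/d; lra.
Qed.

Definition riesz_measure (A : set (@borelOm R Om)) : \bar R := riesz_outer A.

Let sub_cara (A : set (@borelOm R Om)) : measurable A -> caratheodory_measurable riesz_outer A.
Proof.
apply: smallest_sub; last by move=> U oU; exact: open_caratheodory.
exact: (@sigma_algebra_measurable _ (caratheodory_type riesz_outer)).
Qed.

Let riesz_measure0 : riesz_measure set0 = 0%E. Proof. exact: riesz_outer0. Qed.
Let riesz_measure_ge0 A : (0 <= riesz_measure A)%E. Proof. exact: riesz_outer_ge0. Qed.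
Let riesz_measure_sigma : semi_sigma_additive riesz_measure.
Proof.
move=> F mF tF mUF; apply: (@caratheodory_measure_sigma_additive R Om riesz_outer) => //.
- by move=> i; exact: sub_cara.
- exact: sub_cara.
Qed.

HB.instance Definition _ := isMeasure.Build _ _ _ riesz_measure
  riesz_measure0 riesz_measure_ge0 riesz_measure_sigma.

Let riesz_measureT : riesz_measure setT = 1%E.
Proof. by rewrite /riesz_measure /riesz_outer outer_contentE ?open_contentT//; exact: openT. Qed.

HB.instance Definition _ := Measure_isProbability.Build _ _ _ riesz_measure riesz_measureT.

Lemma riesz_representation : exists m : probability (@borelOm R Om) R,
  forall A, m A = (outer_content A)%:E.
Proof. by exists riesz_measure. Qed.

End riesz.

Section integral_functional.
Context {R : realType} {Om : pseudoPMetricType R}.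
Hypothesis cOm : compact [set: Om].
Variable m : probability (@borelOm R Om) R.
Implicit Types (f g : Om -> R) (A : set (@borelOm R Om)).

Lemma continuous_borel_measurable f : continuous f ->
  measurable_fun [set: @borelOm R Om] (f : @borelOm R Om -> R).
Proof.
move=> cf; apply: (measurability _ (RGenOpens.measurableE R)).
move=> _ [_ [a [b ->] <-]]; rewrite setTI; apply: sub_sigma_algebra.
by apply: open_comp => // x _; exact: cf.
Qed.

Lemma continuous_borel_measurable_map (h : Om -> Om) : continuous h ->
  measurable_fun [set: @borelOm R Om] (h : @borelOm R Om -> @borelOm R Om).
Proof.
move=> ch; apply: (@measurability _ _ (@borelOm R Om) (@borelOm R Om) setT h (@open Om)) => //.
move=> _ [U oU <-]; rewrite setTI; apply: sub_sigma_algebra.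
by apply: open_comp => // x _; exact: ch.
Qed.

Lemma continuous_integrable f A : measurable A -> continuous f ->
  m.-integrable A (EFin \o (f : @borelOm R Om -> R)).
Proof.
move=> mA cf; apply: measurable_bounded_integrable => //.
- by rewrite (le_lt_trans (probability_le1 m mA))// ltry.
- by apply: measurable_funTS; exact: continuous_borel_measurable.
- have [M M0 HM] := compact_norm_bound cOm cf.
  exists M; split; first exact: num_real.
  by move=> x Mx y _ /=; apply: (le_trans (HM y I)); exact: ltW.
Qed.

Definition int_on A f : R := (\int[m]_(x in A) f x)%R.

Lemma int_on_linear A : measurable A ->
  linear_on (fun f : Om -> R => continuous f) (int_on A).
Proof.
move=> mA; split=> [f g cf cg|a f cf].
  by rewrite /int_on RintegralD//; exact: continuous_integrable.
by rewrite /int_on RintegralZl//; exact: continuous_integrable.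
Qed.

Lemma int_on_mono A f g : measurable A -> continuous f -> continuous g ->
  (forall x, A x -> f x <= g x) -> int_on A f <= int_on A g.
Proof. by move=> mA cf cg fg; apply: le_Rintegral => //; exact: continuous_integrable. Qed.

Lemma int_on_cst A (c : R) : measurable A -> int_on A (fun=> c) = c * fine (m A).
Proof. by move=> mA; exact: Rintegral_cst. Qed.

Lemma int_on_split A f : measurable A -> continuous f ->
  int_on setT f = int_on A f + int_on (~` A) f.
Proof.
move=> mA cf; rewrite /int_on -Rintegral_setU//.
- by rewrite setUCr.
- exact: measurableC.
- by rewrite setUCr; exact: continuous_integrable.
- by apply/disj_setPCl.
Qed.

Lemma int_on_invariant (h : Om -> Om) A f : continuous h -> measurable A ->
  (forall B : set (@borelOm R Om), measurable B -> m (h @^-1` B) = m B) -> h @^-1` A = A ->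
  continuous f -> int_on A (f \o h) = int_on A f.
Proof.
move=> ch mA hm hA cf; have mh := continuous_borel_measurable_map ch.
have cfh : continuous (f \o h) by move=> x; apply: continuous_comp; [exact: ch|exact: cf].
have := @integral_pushforward _ _ _ _ R _ mh m A (EFin \o f) _ _ mA.
rewrite hA => H; rewrite /int_on /Rintegral -H.
- congr fine; apply: eq_measure_integral => B mB _; exact: hm.
- by apply/measurable_EFinP; exact: continuous_borel_measurable.
- exact: (@continuous_integrable (f \o h)).
Qed.

End integral_functional.

Section clamp01.
Context {R : realType}.

Definition clamp01 (y : R) : R := Num.min 1 (Num.max 0 y).

Lemma clamp01_bound (y : R) : 0 <= clamp01 y <= 1.
Proof. by rewrite /clamp01 le_min ler01 le_max lexx /= ge_min lexx. Qed.

Lemma clamp01_continuous {X : topologicalType} (f : X -> R) : continuous f -> continuous (fun w => clamp01 (f w)).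
Proof.
move=> cf w; apply: (@continuous_min _ _ (fun=> 1) (fun w => Num.max 0 (f w))).
  exact: cst_continuous.
by apply: (@continuous_max _ _ (fun=> 0) f); [exact: cst_continuous|exact: cf].
Qed.

Lemma sum_clamp01 n (y : R) : 0 <= y -> \sum_(k < n) clamp01 (y - k%:R) = Num.min n%:R y.
Proof.
move=> y0; elim: n => [|n IH]; first by rewrite big_ord0 min_l.
rewrite big_ord_recr /= IH /clamp01 -(natr1 n).
have [h1|h1] := leP n%:R y; have [h2|h2] := leP 0 (y - n%:R); try lra.
  by have [|] := leP 1 (y - n%:R); have [|] := leP (n%:R + 1) y; lra.
by rewrite (_ : Num.min 1 0 = 0) ?addr0; [have [|] := leP (n%:R + 1) y; lra|rewrite min_r// ler01].
Qed.

Lemma clamp01_onto (b1 b2 x : R) : b1 <= x <= b2 ->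
  exists2 tau : R, `[(0 : R), 1]%classic tau & b1 + clamp01 tau * (b2 - b1) = x.
Proof.
move=> /andP[x1 x2]; have b12 := le_trans x1 x2.
have [E|ne] := eqVneq b1 b2.
  exists 0; first by rewrite /= in_itv /= lexx ler01.
  by rewrite -E subrr mulr0 addr0; apply/eqP; rewrite eq_le x1 E x2.
have lt : 0 < b2 - b1 by rewrite subr_gt0 lt_neqAle ne b12.
have t0 : 0 <= (x - b1) / (b2 - b1) by rewrite divr_ge0 ?subr_ge0.
have t1 : (x - b1) / (b2 - b1) <= 1 by rewrite ler_pdivrMr// mul1r lerD2r.
exists ((x - b1) / (b2 - b1)); first by rewrite /= in_itv /= t0 t1.
by rewrite /clamp01 max_r// min_r// divfK ?gt_eqF// addrC subrK.
Qed.

End clamp01.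

Section riesz_integral.
Context {R : realType} {Om : pseudoPMetricType R}.
Hypothesis cOm : compact [set: Om].
Variable L : (Om -> R) -> R.
Hypothesis Llin : linear_on (fun f : Om -> R => continuous f) L.
Hypothesis Lmono : forall f g : Om -> R, continuous f -> continuous g ->
  (forall w, f w <= g w) -> L f <= L g.
Hypothesis L1 : L (fun=> 1) = 1.
Variable m : probability (@borelOm R Om) R.
Hypothesis mL : forall A, m A = (outer_content L A)%:E.

Let Lle (f : Om -> R) : continuous f -> (forall w, 0 <= f w <= 1) -> L f <= int_on m setT f.
Proof.
move=> cf f01; apply/ler_addgt0Pr => e e0.
pose n := (Num.truncn e^-1).+1.
have ne : e^-1 < n%:R by exact: truncnS_gt.
have n0 : 0 < n%:R :> R by rewrite ltr0n.
pose g (k : nat) w := clamp01 (n%:R * f w - k%:R).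
pose U (k : nat) := [set w | k%:R < n%:R * f w].
have cnf : continuous (fun w => n%:R * f w) by exact: continuous_fun_scale.
have cg k : continuous (g k).
  apply: clamp01_continuous => w; apply: cvgB; [exact: cnf|exact: cvg_cst].
have oU k : open (U k).
  apply: (@open_comp _ _ (fun w => n%:R * f w) [set x : R | k%:R < x]); last exact: open_gt.
  by move=> w _; exact: cnf.
have mU k : measurable (U k : set (@borelOm R Om)) by apply: sub_sigma_algebra; exact: oU.
pose mm k := fine (m (U k)).
have sumg : (fun w => \sum_(k < n) g k w) = (fun w => n%:R * f w).
  apply/funext => w; rewrite sum_clamp01; last by have /andP[? _] := f01 w; rewrite mulr_ge0.
  by rewrite min_r// ler_piMr//; have /andP[] := f01 w.
have Lg k : L (g k) <= mm k.
  rewrite /mm mL /= outer_contentE; [|exact: Llin|exact: Lmono|exact: L1|exact: oU].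
  apply: bump_le => //; split=> // [w|w]; first exact: clamp01_bound.
  move=> /negP; rewrite -leNgt => h; rewrite /g /clamp01 max_l ?subr_le0//.
  by rewrite min_r// ler01.
have Ig k : mm k.+1 <= int_on m setT (g k).
  rewrite (@int_on_split _ _ cOm m (U k.+1))//.
  have -> : mm k.+1 = int_on m (U k.+1) (fun=> 1) by rewrite int_on_cst// mul1r.
  rewrite -[leLHS]addr0 lerD//.
    apply: int_on_mono => //; first exact: cst_continuous.
    move=> x; rewrite /U /= -natr1 => h; rewrite /g /clamp01 min_l// le_max.
    by apply/orP; right; lra.
  by apply: Rintegral_ge0 => x _; have /andP[] := clamp01_bound (n%:R * f x - k%:R).
have E1 : n%:R * L f <= \sum_(k < n) mm k.
  rewrite -(Llin.2 n%:R f cf) (_ : n%:R *: f = fun w => n%:R * f w)// -sumg.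
  by rewrite (linear_on_sum n Llin cg).2; apply: ler_sum.
have E2 : \sum_(k < n) mm k.+1 <= n%:R * int_on m setT f.
  have lin := int_on_linear cOm m (@measurableT _ (@borelOm R Om)).
  rewrite -(lin.2 n%:R f cf) (_ : n%:R *: f = fun w => n%:R * f w)// -sumg.
  by rewrite (linear_on_sum n lin cg).2; apply: ler_sum.
have mm0 k : 0 <= mm k by rewrite fine_ge0.
have mm1 k : mm k <= 1.
  have := probability_le1 m (mU k); rewrite -[m _]fineK; first by rewrite lee_fin.
  exact: fin_num_measure.
have E3 : \sum_(k < n) mm k <= 1 + \sum_(k < n) mm k.+1.
  have -> : \sum_(k < n) mm k = mm 0%N + \sum_(k < n.-1) mm k.+1.
    by rewrite /n /= big_ord_recl.
  rewrite lerD// /n /= big_ord_recr /=; have := mm0 (Num.truncn e^-1).+1; lra.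
have : n%:R * L f <= n%:R * (int_on m setT f + e).
  rewrite mulrDr; have : 1 <= n%:R * e by rewrite -ler_pdivrMr// mul1r ltW.
  lra.
by rewrite ler_pM2l.
Qed.

Lemma riesz_integral (f : Om -> R) : continuous f -> L f = int_on m setT f.
Proof.
move=> cf; have lin := int_on_linear cOm m (@measurableT _ (@borelOm R Om)).
have m1 : fine (m setT) = 1 by rewrite probability_setT.
have Icst (c : R) : int_on m setT (fun=> c) = c by rewrite int_on_cst// m1 mulr1.
have LcstE (c : R) : L (fun=> c) = c.
  have := Llin.2 c (fun=> 1) (@cst_continuous _ _ _); rewrite L1 mulr1 => {2}<-.
  by congr L; apply/funext => w; rewrite /= [RHS]mulr1.
have [M M0 HM] := compact_norm_bound cOm cf.
pose g w := (2 * M)^-1 * (f w + M).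
have cfM : continuous (fun w => f w + M).
  by apply: continuous_fun_add => //; exact: cst_continuous.
have cg : continuous g by exact: continuous_fun_scale.
have M20 : 0 < 2 * M by rewrite mulr_gt0.
have g01 w : 0 <= g w <= 1.
  have := HM w I; rewrite ler_norml => /andP[? ?].
  have fM : 0 <= f w + M by lra.
  by rewrite /g mulr_ge0 ?invr_ge0 ?(ltW M20)//= ler_pdivrMl// mulr1; lra.
have c1g : continuous (fun w => 1 + -1 * g w).
  by apply: continuous_fun_add; [exact: cst_continuous|exact: continuous_fun_scale].
have h1 := Lle cg g01.
have h2 : L (fun w => 1 + -1 * g w) <= int_on m setT (fun w => 1 + -1 * g w).
  by apply: Lle => // w; have := g01 w; lra.
have aff (F : (Om -> R) -> R) : linear_on (fun f : Om -> R => continuous f) F ->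
    (forall c, F (fun=> c) = c) ->
    F (fun w => 1 + -1 * g w) = 1 - F g /\ F g = (2 * M)^-1 * (F f + M).
  move=> [FD FZ] Fc; split.
    rewrite (_ : (fun w => _) = (fun=> 1) + (-1) *: g)// FD ?FZ ?Fc ?mulN1r//.
      exact: cst_continuous.
    exact: continuous_fun_scale.
  rewrite (_ : g = (2 * M)^-1 *: (f + (fun=> M)))// FZ ?FD ?Fc//.
  exact: cst_continuous.
have [eL1 eL2] := aff L Llin LcstE; have [eI1 eI2] := aff _ lin Icst.
have : L g = int_on m setT g by apply/eqP; rewrite eq_le h1/=; lra.
rewrite eL2 eI2 => /(mulfI _); rewrite invr_eq0 gt_eqF// => /(_ isT).
by move/addIr.
Qed.

End riesz_integral.

(** * Ergodic measures and uniform averages *)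

Section ergodic_averages.
Context {R : realType} {Om : pseudoPMetricType R} (sig : R -> Om -> Om).
Hypothesis cOm : compact [set: Om].
Hypothesis flow : is_flow sig.
Implicit Types (f g : Om -> R) (ts : seq R) (c e : R).

Let C f := continuous f.

Lemma flow_continuous_space t : continuous (sig t).
Proof.
move=> w; have [cs _] := flow; apply: (@continuous_at2 _ _ _ _ (fun p : R * Om => sig p.1 p.2) (fun=> t) id).
- exact: cs.
- exact: cst_continuous.
- by [].
Qed.

Lemma flow_continuous_time w : continuous (fun t => sig t w).
Proof.
move=> t; have [cs _] := flow; apply: (@continuous_at2 _ _ _ _ (fun p : R * Om => sig p.1 p.2) id (fun=> w)).
- exact: cs.
- by [].
- exact: cst_continuous.
Qed.

Lemma continuous_flow_comp f t : C f -> C (f \o sig t).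
Proof.
by move=> cf w; apply: continuous_comp; [exact: flow_continuous_space|exact: cf].
Qed.

Let flow0 w : sig 0 w = w. Proof. by have [_ []] := flow. Qed.
Let flowD s t w : sig (s + t) w = sig t (sig s w). Proof. by have [_ []] := flow. Qed.

Definition avg_bound f c := exists2 ts, ts != [::] &
  forall w, \sum_(t <- ts) f (sig t w) <= c * (size ts)%:R.

(* The supremum of [int f dm] over the invariant probability measures [m]. *)
Definition max_avg f : R := inf [set c | avg_bound f c].

Lemma avg_bound_lb f (M c : R) : (forall w, - M <= f w) -> avg_bound f c -> - M <= c.
Proof.
move=> fM [ts ts0 H]; have n0 : 0 < (size ts)%:R :> R by rewrite ltr0n lt0n size_eq0.
rewrite -(ler_pM2r n0); apply: le_trans (H point).
have -> : - M * (size ts)%:R = \sum_(t <- ts) (- M).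
  by rewrite big_const_seq count_predT iter_addr_0 mulr_natr.
by apply: ler_sum => t _; exact: fM.
Qed.

Let has_lb f : C f -> has_lbound [set c | avg_bound f c].
Proof.
move=> cf; have [M _ HM] := compact_norm_bound cOm cf.
exists (- M) => c; apply: avg_bound_lb => w; have := HM w I.
by rewrite ler_norml => /andP[].
Qed.

Lemma max_avg_le f c : C f -> avg_bound f c -> max_avg f <= c.
Proof. by move=> cf H; apply: ge_inf => //; exact: has_lb. Qed.

Let avg1 f c : (forall w, f w <= c) -> avg_bound f c.
Proof. by move=> H; exists [:: 0] => // w; rewrite big_seq1 flow0 mulr1. Qed.

Lemma le_max_avg f c : C f -> (forall c', avg_bound f c' -> c <= c') -> c <= max_avg f.
Proof.
move=> cf H; apply: lb_le_inf; last by move=> c' /H.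
have [M _ HM] := compact_norm_bound cOm cf; exists M; apply: avg1 => w.
by have := HM w I; rewrite ler_norml => /andP[].
Qed.

Let sumc ts c : \sum_(t <- ts) c = c * (size ts)%:R.
Proof. by rewrite big_const_seq count_predT iter_addr_0 mulr_natr. Qed.

Lemma max_avg_sublinear : sublinear_on C max_avg.
Proof.
split=> [f g cf cg|a f].
  have cfg : C (f + g) by exact: continuous_fun_add.
  rewrite -lerBlDr; apply: le_max_avg => // c1 [t1 t10 H1].
  rewrite lerBlDr -lerBlDl; apply: le_max_avg => // c2 [t2 t20 H2].
  rewrite lerBlDl; apply: max_avg_le => //.
  exists [seq s + t | s <- t1, t <- t2].
    by rewrite -size_eq0 size_allpairs muln_eq0 !size_eq0 negb_or t10 t20.
  move=> w; rewrite size_allpairs natrM big_allpairs_dep /=.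
  rewrite mulrDl [_ + c2 * _]addrC.
  have -> : \sum_(s <- t1) \sum_(t <- t2) (f + g) (sig (s + t) w) =
     \sum_(s <- t1) \sum_(t <- t2) g (sig t (sig s w)) +
     \sum_(t <- t2) \sum_(s <- t1) f (sig s (sig t w)).
    rewrite [X in _ = _ + X]exchange_big -big_split /=; apply: eq_bigr => s _.
    rewrite -big_split /=; apply: eq_bigr => t _.
    by rewrite [LHS]addrC flowD -(flowD t s) [t + s]addrC flowD.
  apply: lerD.
    apply: (@le_trans _ _ (\sum_(s <- t1) c2 * (size t2)%:R)); first exact: ler_sum.
    by rewrite sumc mulrAC -mulrA.
  apply: (@le_trans _ _ (\sum_(t <- t2) c1 * (size t1)%:R)); first exact: ler_sum.
  by rewrite sumc -mulrA.
rewrite le_eqVlt => /predU1P[<- cf|a0 cf].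
  rewrite mul0r scale0r; apply/eqP; rewrite eq_le; apply/andP; split.
    by apply: max_avg_le; [exact: cst_continuous|exact: avg1].
  apply: le_max_avg; first exact: cst_continuous.
  by move=> c; rewrite -[X in X <= _]oppr0; apply: avg_bound_lb => w; rewrite oppr0.
have caf : C (a *: f) by exact: continuous_fun_scale.
apply/eqP; rewrite eq_le; apply/andP; split.
  rewrite -ler_pdivrMl//; apply: le_max_avg => // c [ts ts0 H]; rewrite ler_pdivrMl//.
  apply: max_avg_le => //; exists ts => // w.
  by rewrite -mulr_sumr -mulrA ler_pM2l.
apply: le_max_avg => // c [ts ts0 H]; rewrite -ler_pdivlMl//.
apply: max_avg_le => //; exists ts => // w; rewrite -mulrA ler_pdivlMl// mulr_sumr.
exact: H.
Qed.

Lemma positive_invariant_le (L : (Om -> R) -> R) : linear_on C L ->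
  (forall f c, C f -> (forall w, f w <= c) -> L f <= c) ->
  (forall f t, C f -> L (f \o sig t) = L f) -> le_on C L max_avg.
Proof.
move=> Llin Lc Linv f cf; apply: le_max_avg => // c [ts ts0 H].
have n0 : 0 < (size ts)%:R :> R by rewrite ltr0n lt0n size_eq0.
have [csum Lsum] := linear_on_sum (size ts) Llin
  (fun i => @continuous_flow_comp f (nth 0 ts i) cf).
have E w : \sum_(t <- ts) f (sig t w) = \sum_(i < size ts) (f \o sig (nth 0 ts i)) w.
  by rewrite (big_nth 0) big_mkord.
have : L (fun w => \sum_(i < size ts) (f \o sig (nth 0 ts i)) w) <= c * (size ts)%:R.
  by apply: Lc => // w; rewrite -E.
rewrite Lsum (eq_bigr (fun=> L f)); last by move=> i _; exact: Linv.
by rewrite big_const_ord iter_addr_0 -(mulr_natr (L f)) ler_pM2r.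
Qed.

Lemma max_avg_coboundary f t : C f -> max_avg (fun w => f (sig t w) + -1 * f w) <= 0.
Proof.
move=> cf; have [M M0 HM] := compact_norm_bound cOm cf.
have cg : C (fun w => f (sig t w) + -1 * f w).
  by apply: continuous_fun_add; [exact: continuous_flow_comp|exact: continuous_fun_scale].
apply/ler_addgt0Pr => e e0; rewrite add0r; apply: max_avg_le => //.
pose n := (Num.truncn (2 * M / e)).+1.
have ne : 2 * M / e < n%:R by exact: truncnS_gt.
exists [seq i%:R * t | i <- iota 0 n] => // w; rewrite size_map size_iota big_map.
have -> : \sum_(i <- iota 0 n) (f (sig t (sig (i%:R * t) w)) + -1 * f (sig (i%:R * t) w))
    = f (sig (n%:R * t) w) - f w.
  elim: n {ne} => [|k IH]; first by rewrite big_nil mul0r flow0 subrr.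
  rewrite -addn1 iotaD big_cat IH /= big_seq1 -flowD add0n natrD mulrDl mul1r.
  by ring.
have := HM (sig (n%:R * t) w) I; have := HM w I; rewrite !ler_norml => /andP[? ?] /andP[? ?].
have : 2 * M <= e * n%:R by rewrite [e * _]mulrC -ler_pdivrMr// ltW.
lra.
Qed.

Lemma ergodic_average_lt f e : C f -> 0 < e ->
  (forall m : probability (@borelOm R Om) R, ergodic_meas sig m ->
     full_meas m [set w | f w <= 0]) ->
  exists2 ts, ts != [::] & forall w, \sum_(t <- ts) f (sig t w) <= e * (size ts)%:R.
Proof.
move=> cf e0 Hm; apply: contrapT => Hn.
pose fp w := Num.max 0 (f w).
have cfp : C fp.
  move=> w; apply: (@continuous_max _ _ (fun=> 0) f); [exact: cst_continuous|exact: cf].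
have pfp : e <= max_avg fp.
  apply: le_max_avg => // c [ts ts0 H]; rewrite leNgt; apply/negP => ce; apply: Hn.
  exists ts => // w; apply: (@le_trans _ _ (\sum_(t <- ts) fp (sig t w))).
    by apply: ler_sum => t _; rewrite le_max lexx orbT.
  by apply: le_trans (H w) _; rewrite ler_wpM2r// ltW.
have DD (g h : Om -> R) : C g -> C h -> C (g + h) := @continuous_fun_add _ _ g h.
have DZ (a : R) g : C g -> C (a *: g) := @continuous_fun_scale _ _ a g.
have [L [Llin Lp Lf Lext]] := extremal_linear_functional DD DZ max_avg_sublinear cfp.
have Lc g c : C g -> (forall w, g w <= c) -> L g <= c.
  by move=> cg H; apply: le_trans (Lp g cg) _; apply: max_avg_le => //; exact: avg1.
have L1 : L (fun=> 1) = 1.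
  apply/eqP; rewrite eq_le Lc//=; last exact: cst_continuous.
  have := Lc (-1 *: (fun=> 1)) (-1) (DZ _ _ (@cst_continuous _ _ _)).
  rewrite Llin.2; last exact: cst_continuous.
  by rewrite mulN1r lerN2; apply => w; rewrite /= [leLHS]mulr1.
have Lmono g h : C g -> C h -> (forall w, g w <= h w) -> L g <= L h.
  move=> cg ch gh; have := Lc (g + (-1) *: h) 0 (DD _ _ cg (DZ _ _ ch)).
  rewrite Llin.1// ?Llin.2// ?mulN1r ?subr_le0; last exact: DZ.
  by apply => w; rewrite /= [leLHS](_ : _ = g w - h w) ?subr_le0// -[X in g w + X]mulN1r.
have Linv g t : C g -> L (g \o sig t) = L g.
  have le1 h s : C h -> L (h \o sig s) <= L h.
    move=> ch; have := le_trans (Lp _ _) (max_avg_coboundary s ch).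
    rewrite (_ : (fun w => _) = h \o sig s + (-1) *: h)//.
    have chs := continuous_flow_comp (t := s) ch.
    rewrite Llin.1//; last exact: DZ.
    by rewrite Llin.2// mulN1r subr_le0; apply; exact: DD (DZ _ _ ch).
  move=> cg; apply/eqP; rewrite eq_le le1//=.
  have := le1 (g \o sig t) (- t) (continuous_flow_comp cg).
  congr (_ <= _); congr L; apply/funext => w /=.
  by rewrite -flowD addNr flow0.
have [m mL] := riesz_representation cOm Llin Lmono L1.
have LI g : C g -> L g = int_on m setT g by exact: riesz_integral.
have inv : invariant_meas sig m.
  have bumpt t U g : bump_in U g -> bump_in (sig t @^-1` U) (g \o sig t).
    move=> [cg g01 gU]; split=> [|w|w Uw]; [exact: continuous_flow_comp|exact: g01|exact: gU].
  have le1 t U : open_content L U <= open_content L (sig t @^-1` U).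
    apply: open_content_le => // g bg; have [cg _ _] := bg.
    by rewrite -(Linv g t cg); apply: bump_le => //; exact: bumpt.
  have pre t A : sig (- t) @^-1` (sig t @^-1` A) = A.
    by apply/funext => w /=; rewrite -flowD addNr flow0.
  have ope t U : open U -> open (sig t @^-1` U).
    by move=> oU; apply: open_comp => // w _; exact: flow_continuous_space.
  have le2 t A : outer_content L (sig t @^-1` A) <= outer_content L A.
    apply/ler_addgt0Pr => d d0.
    have [U [oU AU HU]] := outer_content_adherent Llin Lmono L1 A d0.
    apply: le_trans (ltW HU); apply: (@le_trans _ _ (open_content L (sig t @^-1` U))).
      by apply: outer_content_le => //; [exact: ope|move=> w; exact: AU].
    by have := le1 (- t) (sig t @^-1` U); rewrite pre.
  move=> t A mA; rewrite !mL; congr EFin; apply/eqP; rewrite eq_le le2/=.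
  by have := le2 (- t) (sig t @^-1` A); rewrite pre.
have erg : ergodic_meas sig m.
  split=> // A mA Ainv; apply: contrapT => /not_orP[A0 A1].
  pose al := fine (m A).
  have mAE : m A = al%:E by rewrite /al fineK//; exact: fin_num_measure.
  have al0 : 0 < al.
    rewrite lt_neqAle fine_ge0// andbT; apply/eqP => E; apply: A0; by rewrite mAE -E.
  have al1 : al < 1.
    rewrite lt_neqAle; apply/andP; split; first by apply/eqP => E; apply: A1; rewrite mAE E.
    by rewrite -lee_fin -mAE; exact: probability_le1.
  have mCA : measurable (~` A) by exact: measurableC.
  have mCE : fine (m (~` A)) = 1 - al by rewrite probability_setC// mAE.
  have CAinv t : sig t @^-1` (~` A) = ~` A by exact: (congr1 setC (Ainv t)).
  have nl (B : set (@borelOm R Om)) (k : R) : measurable B -> fine (m B) = k -> 0 < k ->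
      (forall t, sig t @^-1` B = B) ->
      linear_on C (fun g => int_on m B g / k) /\ le_on C (fun g => int_on m B g / k) max_avg.
    move=> mB Bk k0 Binv; have lin := int_on_linear cOm m mB.
    have lk : linear_on C (fun g => int_on m B g / k).
      split=> [g h cg ch|a g cg]; first by rewrite lin.1// mulrDl.
      by rewrite lin.2// mulrA.
    split=> //; apply: positive_invariant_le => //.
      move=> g c cg gc; rewrite ler_pdivrMr// -Bk -int_on_cst//.
      by apply: int_on_mono => //; exact: cst_continuous.
    move=> g t cg; congr (_ / k); apply: int_on_invariant => //.
      exact: flow_continuous_space.
    exact: inv.
  have [l1 p1] := nl A al mA erefl al0 Ainv.
  have [l2 p2] := nl (~` A) (1 - al) mCA mCE (ltac:(lra)) CAinv.
  have al01 : 0 < al < 1 by rewrite al0 al1.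
  have Ext := Lext _ _ al al01 l1 l2 p1 p2.
  have {}Ext g : C g -> int_on m A g = al * L g.
    move=> cg; rewrite -(Ext _ g cg).
      by field; rewrite gt_eqF.
    move=> h ch; rewrite LI// (int_on_split cOm m mA ch); field.
    by apply/andP; split; rewrite ?subr_eq0 gt_eqF.
  have small d : 0 < d -> al * (1 - al - d) <= d.
    move=> d0; have d20 : 0 < d / 2 by rewrite divr_gt0.
    have [U [oU AU HU]] := outer_content_adherent Llin Lmono L1 (~` A) d20.
    have CE : outer_content L (~` A) = 1 - al by rewrite -mCE mL.
    have mU : measurable (U : set (@borelOm R Om)) by exact: sub_sigma_algebra.
    have mUE : m U = (open_content L U)%:E.
      by rewrite mL outer_contentE.
    have [_ [g bg <-] Hg] : exists2 x, [set L g | g in bump_in U] x & open_content L U - d / 2 < x.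
      apply: sup_adherent => //; split; first by exists (L (fun=> 0)), (fun=> 0) => //; split=> //;
        [exact: cst_continuous|move=> _; rewrite lexx ler01].
      by exists 1 => _ [g [cg g01 _] <-]; apply: Lc => // w; have /andP[] := g01 w.
    have [cg g01 gU] := bg.
    have UCA : 1 - al <= open_content L U by rewrite -CE; apply: outer_content_le.
    have : al * L g <= d / 2.
      rewrite -Ext//; apply: (@le_trans _ _ (int_on m (A `&` U) (fun=> 1))).
        have -> : int_on m A g = int_on m (A `&` U) g.
          rewrite /int_on Rintegral_mkcondr; apply: eq_Rintegral => w _.
          rewrite patchE; case: ifPn => //; rewrite notin_setE => /gU ->//.
        apply: int_on_mono => //; [exact: measurableI|exact: cst_continuous|].
        by move=> w _; have /andP[] := g01 w.
      rewrite int_on_cst; last exact: measurableI.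
      have mAU : measurable (A `&` U) by exact: measurableI.
      have : m U = (m (A `&` U) + m (U `\` A))%E.
        by rewrite setIC (measureDI m mU mA) addeC.
      have : m (U `\` A) = (1 - al)%:E.
        rewrite setDE (_ : U `&` ~` A = ~` A) ?mL ?CE//.
        by apply/seteqP; split=> w; [case|move=> Aw; split=> //; exact: AU].
      move=> ->; rewrite mUE -[m (A `&` U)]fineK; last exact: fin_num_measure.
      rewrite -EFinD => -[E]; move: HU; rewrite CE E; lra.
    have : al * (1 - al - d) <= al * L g by rewrite ler_pM2l//; lra.
    lra.
  have k0 : 0 < al * (1 - al) by rewrite mulr_gt0// subr_gt0.
  have := small (al * (1 - al) / 4); rewrite divr_gt0// => /(_ isT); nra.
have [A [mA Af mA1]] := Hm m erg.
pose U := [set w | 0 < f w].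
have oU : open U.
  by apply: (@open_comp _ _ f [set x : R | 0 < x]); [move=> w _; exact: cf|exact: open_gt].
have mU : measurable (U : set (@borelOm R Om)) by exact: sub_sigma_algebra.
have AU0 : A `&` U = set0.
  by apply/seteqP; split=> // w [/Af /= fw]; rewrite /U /= ltNge fw.
have mU0 : m U = 0%E.
  have : (m (A `|` U) <= 1)%E by apply: probability_le1; exact: measurableU.
  have -> : m (A `|` U) = (m A + m U)%E by exact: measureU.
  rewrite mA1 -[m U]fineK; last exact: fin_num_measure.
  rewrite -EFinD lee_fin => h; congr EFin; apply/eqP; rewrite eq_le fine_ge0// andbT; lra.
have [M M0 HM] := compact_norm_bound cOm cf.
have bU : bump_in U (fun w => M^-1 * fp w).
  split=> [|w|w Uw]; first exact: continuous_fun_scale.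
    have := HM w I; rewrite ler_norml => /andP[_ fM].
    rewrite mulr_ge0 ?invr_ge0 ?(ltW M0)//=; last by rewrite le_max lexx.
    by rewrite ler_pdivrMl// mulr1 ge_max (ltW M0).
  rewrite /fp max_l ?mulr0// leNgt; exact/negP.
have := bump_le Lmono L1 bU.
have -> : open_content L U = 0 by move: mU0; rewrite mL outer_contentE// => -[].
rewrite (Llin.2 M^-1 fp cfp) pmulr_rle0 ?invr_gt0// Lf; lra.
Qed.

End ergodic_averages.

Lemma expR_small {R : realType} (k M e : R) : 0 <= k -> 0 < M -> 0 < e ->
  exists2 T, 0 < T & k * expR (- (M * T)) <= e.
Proof.
move=> k0 M0 e0; exists ((k / e + 1) / M).
  by rewrite divr_gt0// ltr_wpDl// divr_ge0// ltW.
have -> : M * ((k / e + 1) / M) = k / e + 1 by field; rewrite !gt_eqF.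
rewrite expRN ler_pdivrMr ?expR_gt0//.
have h : k / e <= expR (k / e + 1).
  apply: le_trans (expR_ge1Dx _); lra.
by rewrite mulrC -ler_pdivrMr.
Qed.

Lemma isD_shift {R : realType} (f : R -> R) (a c t : R) : is_derive (t + c) 1 f a ->
  is_derive t 1 (fun t => f (t + c)) a.
Proof.
move=> H; apply: (isD_eq (@isD_comp R f (fun t => t + c) a (1 + 0) t H _)); by rewrite addr0 mulr1.
Qed.

(** * Calculus along orbits *)

Section flow_calculus.
Context {R : realType} {Om : pseudoPMetricType R} (sig : R -> Om -> Om).
Hypothesis cOm : compact [set: Om].
Hypothesis flow : is_flow sig.
Implicit Types (b phi psi : Om -> R) (w : Om) (s t e : R).

Definition orbit_der (b b' : Om -> R) :=
  forall w t, is_derive t 1 (fun t => b (sig t w)) (b' (sig t w)).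

Let flow0 w : sig 0 w = w. Proof. by have [_ []] := flow. Qed.
Let flowD s t w : sig (s + t) w = sig t (sig s w). Proof. by have [_ []] := flow. Qed.

Lemma continuous_along_orbit b w : continuous b -> continuous (fun t => b (sig t w)).
Proof.
move=> cb t; apply: (@continuous_comp _ _ _ (fun t => sig t w) b); last exact: cb.
exact: flow_continuous_time.
Qed.

Lemma flow_tube_space b (A B : R) w e : continuous b -> 0 < e ->
  \forall w' \near w, forall t, A <= t <= B -> `|b (sig t w') - b (sig t w)| < e.
Proof.
move=> cb e0.
have := @compact_tube R Om R (fun p : Om * R => b (sig p.2 p.1)) `[A, B] w e
  (@segment_compact _ _ _) _ e0.
apply=> t _; apply: (@continuous_comp _ _ _ (fun p : Om * R => sig p.2 p.1) b); last exact: cb.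
have [cs _] := flow.
apply: (@continuous_at2 _ _ _ _ (fun p : R * Om => sig p.1 p.2) snd fst).
- exact: cs.
- exact: cvg_snd.
- exact: cvg_fst.
Qed.

Lemma flow_tube_time b e : continuous b -> 0 < e ->
  exists2 dl : R, 0 < dl & forall w t, `|t| < dl -> `|b (sig t w) - b w| < e.
Proof.
move=> cb e0.
have := @compact_tube R R Om (fun p : R * Om => b (sig p.1 p.2)) setT 0 e cOm _ e0.
case=> [w _|/= dl dl0 H].
  apply: (@continuous_comp _ _ _ (fun p : R * Om => sig p.1 p.2) b); last exact: cb.
  by have [cs _] := flow; exact: cs.
exists dl => // w t tdl; have := H t; rewrite /= sub0r normrN => /(_ tdl w I).
by rewrite flow0.
Qed.

Lemma primitive_along_orbits phi (M : R) : continuous phi -> exists Th : Om -> R -> R,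
  forall w t, is_derive t 1 (Th w) (expR (M * t) * phi (sig t w)).
Proof.
move=> cphi; suff /choice[Th HTh] : forall w, exists F : R -> R,
    forall t, is_derive t 1 F (expR (M * t) * phi (sig t w)) by exists Th.
move=> w; apply: antiderivative => t; apply: cvgM; last exact: continuous_along_orbit.
have D := isD_exp (isD_scale M (isD_id t)); exact: is_derive_cont D.
Qed.

Section primitive.
Variables (phi : Om -> R) (M : R) (Th : Om -> R -> R).
Hypothesis cphi : continuous phi.
Hypothesis HTh : forall w t, is_derive t 1 (Th w) (expR (M * t) * phi (sig t w)).

Lemma primitive_cocycle w t r r' : Th (sig t w) r - Th (sig t w) r' =
  expR (- (M * t)) * (Th w (r + t) - Th w (r' + t)).
Proof.
pose F r := Th (sig t w) r - expR (- (M * t)) * Th w (r + t).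
have D (r0 : R) : is_derive r0 1 F (0 : R).
  apply: (isD_eq (isD_sub (HTh _ r0) (isD_scale _ (isD_shift (HTh w (r0 + t)))))).
  rewrite [r0 + t]addrC flowD mulrDr expRD expRN.
  by field; rewrite gt_eqF ?expR_gt0.
have := is_derive_0_is_cst r r' D; rewrite /F; lra.
Qed.

Lemma primitive_increment_continuous r r' : continuous (fun w => Th w r - Th w r').
Proof.
wlog rr : r r' / r' <= r.
  move=> W; have [|rr'] := leP r' r; first exact: W.
  have := W _ _ (ltW rr'); move=> c w.
  rewrite (_ : (fun w => _) = (fun w => - (Th w r' - Th w r))).
    apply: cvgN; exact: c.
  by apply/funext => v; rewrite opprB.
move=> w; apply/cvgrPdist_le => /= e e0.
pose K := expR (M * r') + expR (M * r).
have K0 : 0 < K by rewrite addr_gt0 ?expR_gt0.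
pose d := e / (K * (r - r' + 1)).
have d0 : 0 < d by rewrite divr_gt0// mulr_gt0//; lra.
have := @flow_tube_space phi r' r w d cphi d0.
apply: filterS => w' Hw'.
have [->|rr'] := eqVneq r r'; first by rewrite !subrr normr0 ltW.
have lt : r' < r by rewrite lt_neqAle eq_sym rr' rr.
have [c /andP[rc cr] E] := @mvt R (fun t => Th w t - Th w' t)
   (fun t => expR (M * t) * phi (sig t w) - expR (M * t) * phi (sig t w')) r' r lt
   (fun t _ => isD_sub (HTh w t) (HTh w' t)).
have -> : Th w r - Th w r' - (Th w' r - Th w' r') =
  Th w r - Th w' r - (Th w r' - Th w' r') by ring.
rewrite E -mulrBr !normrM (ger0_norm (expR_ge0 _)) (gtr0_norm (_ : 0 < r - r')) ?subr_gt0//.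
have eK : expR (M * c) <= K.
  rewrite /K; have [M0|M0] := leP 0 M.
    by rewrite (@le_trans _ _ (expR (M * r)))// ?lerDr ?expR_ge0// ler_expR ler_wpM2l// ltW.
  by rewrite (@le_trans _ _ (expR (M * r')))// ?lerDl ?expR_ge0// ler_expR ler_wnM2l// ltW.
have hd : `|phi (sig c w) - phi (sig c w')| <= d.
  by rewrite distrC ltW// Hw'// !ltW.
have -> : e = K * d * (r - r' + 1).
  by rewrite /d; field; apply/andP; split; rewrite gt_eqF//; lra.
have rr0 : 0 <= r - r' by lra.
have rr1 : r - r' <= r - r' + 1 by lra.
apply: ler_pM; [by apply: mulr_ge0 => //; exact: expR_ge0|exact: rr0| |exact: rr1].
by apply: ler_pM => //; exact: expR_ge0.
Qed.

End primitive.

Lemma orbit_der_at0 b b' : (forall w, is_derive (0 : R) 1 (fun t => b (sig t w)) (b' w)) ->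
  orbit_der b b'.
Proof.
move=> H w t.
have Ht := H (sig t w); rewrite -(subrr t) in Ht.
have := isD_shift Ht; by apply: is_derive_ext => // r; rewrite -flowD addrC subrK.
Qed.

Lemma orbit_resolvent phi (M : R) : 0 < M -> continuous phi -> exists be : Om -> R,
  continuous be /\ orbit_der be (fun w => phi w - M * be w).
Proof.
move=> M0 cphi; have [Th HTh] := primitive_along_orbits M cphi.
have [B B0 HB] := compact_norm_bound cOm cphi.
pose k := B / M; have k0 : 0 < k by rewrite divr_gt0.
have Dk t : is_derive t 1 (fun t => k * expR (M * t)) (B * expR (M * t)).
  apply: (isD_eq (isD_scale k (isD_exp (isD_scale M (isD_id t))))).
  by rewrite /k; field; rewrite gt_eqF.
have bnd w t : - (B * expR (M * t)) <= expR (M * t) * phi (sig t w) <= B * expR (M * t).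
  have := HB (sig t w) I; rewrite ler_norml => /andP[h1 h2].
  by rewrite -mulNr ![_ * expR _]mulrC !ler_pM2l ?expR_gt0// h1 h2.
have up w s t : s <= t -> Th w s + k * expR (M * s) <= Th w t + k * expR (M * t).
  move=> st; apply: (@derive_ge0_le R _ _ s t st (fun x _ => isD_add (HTh w x) (Dk x))).
  by move=> x _; have := bnd w x; lra.
have dn w s t : s <= t -> Th w t - k * expR (M * t) <= Th w s - k * expR (M * s).
  move=> st; apply: (@derive_le0_le R _ _ s t st (fun x _ => isD_sub (HTh w x) (Dk x))).
  by move=> x _; have := bnd w x; lra.
pose E w := [set Th w t + k * expR (M * t) | t in [set: R]].
pose ell w := inf (E w).
have ke t : 0 < k * expR (M * t) by rewrite mulr_gt0 ?expR_gt0.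
have lbE w t : lbound (E w) (Th w t - k * expR (M * t)).
  move=> _ [s _ <-]; have [st|ts] := leP s t.
    by have := dn w s t st; have := ke s; lra.
  by have := up w t s (ltW ts); have := ke t; lra.
have ellP w t : `|Th w t - ell w| <= k * expR (M * t).
  have h1 : ell w <= Th w t + k * expR (M * t).
    by apply: ge_inf; [exists (Th w 0 - k * expR (M * 0)); exact: lbE|exists t].
  have h2 : Th w t - k * expR (M * t) <= ell w.
    by apply: lb_le_inf; [exists (Th w 0 + k * expR (M * 0)), 0|exact: lbE].
  by rewrite ler_norml; apply/andP; split; lra.
pose be w := Th w 0 - ell w.
have beE w t : be (sig t w) = expR (- (M * t)) * (Th w t - ell w).
  apply/eqP; rewrite -subr_eq0 -normr_le0; apply/ler_addgt0Pr => e e0; rewrite add0r.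
  have [T T0 HT] := expR_small (ltW (mulr_gt0 (ltr0Sn R 1) k0)) M0 e0.
  apply: le_trans HT.
  have := primitive_cocycle HTh w t 0 (- T); rewrite add0r => coc.
  have -> : be (sig t w) - expR (- (M * t)) * (Th w t - ell w) =
     (Th (sig t w) (- T) - ell (sig t w)) - expR (- (M * t)) * (Th w (- T + t) - ell w).
    by rewrite /be; lra.
  apply: le_trans (ler_normB _ _) _; rewrite normrM (ger0_norm (expR_ge0 _)).
  have h1 := ellP (sig t w) (- T).
  have h2 : expR (- (M * t)) * `|Th w (- T + t) - ell w| <= k * expR (- (M * T)).
    have := ellP w (- T + t); rewrite -(ler_pM2l (expR_gt0 (- (M * t)))).
    move/le_trans; apply; rewrite mulrCA -expRD le_eqVlt; apply/orP; left; apply/eqP.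
    by congr (_ * expR _); ring.
  rewrite mulrN in h1; lra.
exists be; split.
  move=> w; apply/cvgrPdist_le => /= e e0.
  have e20 : 0 < e / 2 by rewrite divr_gt0.
  have [T T0 HT] := expR_small (ltW (mulr_gt0 (ltr0Sn R 1) k0)) M0 e20.
  have /cvgrPdist_le/(_ _ e20) := @primitive_increment_continuous phi M Th cphi HTh 0 (- T) w.
  apply: filterS => w' /= Hw'.
  have -> : be w - be w' = (Th w 0 - Th w (- T) - (Th w' 0 - Th w' (- T))) +
    ((Th w (- T) - ell w) - (Th w' (- T) - ell w')) by rewrite /be; ring.
  apply: le_trans (ler_normD _ _) _.
  have := ler_normB (Th w (- T) - ell w) (Th w' (- T) - ell w').
  have := ellP w (- T); have := ellP w' (- T); rewrite mulrN; lra.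
apply: orbit_der_at0 => w.
apply: (is_derive_ext (fun t => esym (beE w t)) erefl).
have ne := isD_exp (isD_opp (isD_scale M (isD_id 0))).
apply: (isD_eq (isD_mul ne (isD_sub (HTh w 0) (isD_cst (ell w) 0)))).
by rewrite /be !mulr0 oppr0 expR0 flow0; ring.
Qed.

Definition cohomologous_below psi (V V' : Om -> R) e :=
  [/\ continuous V, continuous V', orbit_der V V', 0 < e & forall w, psi w + e <= V' w].

Lemma avg_cohomologous psi (ts : seq R) e : continuous psi -> 0 < e -> ts != [::] ->
  (forall w, \sum_(t <- ts) psi (sig t w) <= - e * (size ts)%:R) ->
  exists V V', cohomologous_below psi V V' e.
Proof.
move=> cpsi e0 ts0 Hts.
have [Th HTh0] := primitive_along_orbits 0 cpsi.
have HTh w t : is_derive t 1 (Th w) (psi (sig t w)).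
  by apply: (isD_eq (HTh0 w t)); rewrite mul0r expR0 mul1r.
have n0 : 0 < (size ts)%:R :> R by rewrite ltr0n lt0n size_eq0.
pose n : R := (size ts)%:R.
pose V w := - (n^-1 * \sum_(i < size ts) (Th w (nth 0 ts i) - Th w 0)).
pose V' w := psi w + -1 * (n^-1 * \sum_(i < size ts) psi (sig (nth 0 ts i) w)).
have contsum (F : nat -> Om -> R) m : (forall i, continuous (F i)) ->
    continuous (fun w => \sum_(i < m) F i w).
  move=> cF; elim: m => [|m IH].
    by under eq_fun do rewrite big_ord0; exact: cst_continuous.
  by under eq_fun do rewrite big_ord_recr /=; exact: continuous_fun_add.
have cV : continuous V.
  move=> w; apply: cvgN; apply: cvgM; first exact: cvg_cst.
  apply: (contsum (fun i w => Th w (nth 0 ts i) - Th w 0)) => i.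
  exact: (primitive_increment_continuous cpsi HTh0).
have cV' : continuous V'.
  apply: continuous_fun_add => //; apply: continuous_fun_scale; apply: continuous_fun_scale.
  apply: (contsum (fun i w => psi (sig (nth 0 ts i) w))) => i.
  exact: (@continuous_flow_comp _ _ _ flow psi).
exists V, V'; split=> // [|w]; last first.
  rewrite /V' lerD2l mulN1r lerNr -/n ler_pdivrMl// mulrC.
  by have := Hts w; rewrite (big_nth 0) big_mkord.
apply: orbit_der_at0 => w.
have Dsum m : is_derive (0 : R) 1 (fun t => \sum_(i < m) (Th (sig t w) (nth 0 ts i) - Th (sig t w) 0))
   (\sum_(i < m) (psi (sig (nth 0 ts i) w) - psi w)).
  elim: m => [|m IH].
    apply: (is_derive_ext _ _ (isD_cst 0 0)) => [t|]; by rewrite big_ord0.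
  rewrite big_ord_recr /=.
  apply: (is_derive_ext _ erefl (isD_add IH _)) => [t|]; first by rewrite big_ord_recr.
  have := fun t => primitive_cocycle HTh0 w t (nth 0 ts m) 0.
  move=> coc; apply: (is_derive_ext (fun t => esym (coc t)) erefl).
  apply: (is_derive_ext (f := fun t => Th w (t + nth 0 ts m) - Th w (t + 0)) _ erefl) => [t|].
    by rewrite mul0r oppr0 expR0 mul1r (addrC t) (addrC t).
  apply: (isD_eq (isD_sub (isD_shift (HTh w (0 + nth 0 ts m))) (isD_shift (HTh w (0 + 0))))).
  by rewrite addr0 add0r flow0.
apply: (isD_eq (isD_opp (isD_scale n^-1 (Dsum (size ts))))).
rewrite /V' -/n sumrB sumr_const card_ord -mulr_natr -/n.
by field; rewrite gt_eqF.
Qed.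

Lemma ergodic_cohomologous psi e : continuous psi -> 0 < e ->
  (forall m : probability (@borelOm R Om) R, ergodic_meas sig m ->
     full_meas m [set w | psi w <= - e]) ->
  exists V V', cohomologous_below psi V V' (e / 2).
Proof.
move=> cpsi e0 Hm.
have e20 : 0 < e / 2 by rewrite divr_gt0.
have cp : continuous (fun w => psi w + e).
  by apply: continuous_fun_add => //; exact: cst_continuous.
have [|ts ts0 H] := @ergodic_average_lt R Om sig cOm flow (fun w => psi w + e) (e / 2) cp e20.
  move=> m /Hm[A [mA Ap mA1]]; exists A; split=> // w /Ap /=; lra.
apply: (avg_cohomologous (ts := ts)) => // w; have := H w.
rewrite big_split /= big_const_seq count_predT iter_addr_0 -[e *+ _]mulr_natr.
lra.
Qed.

End flow_calculus.

(** * Scalar equations over a flow *)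

Section scalar_fields.
Context {R : realType} {Om : pseudoPMetricType R} (sig : R -> Om -> Om).
Hypothesis cOm : compact [set: Om].
Hypothesis flow : is_flow sig.
Implicit Types (b e : Om -> R) (w : Om) (s t : R).

Let flow0 w : sig 0 w = w. Proof. by have [_ []] := flow. Qed.
Let flowD s t w : sig (s + t) w = sig t (sig s w). Proof. by have [_ []] := flow. Qed.

Lemma derive_add_decay_ge0 (u du : R -> R) (M B : R) : 0 < M ->
  (forall t, is_derive t 1 u (du t)) -> (forall t, 0 <= du t + M * u t) ->
  (forall t, - B <= u t) -> forall t, 0 <= u t.
Proof.
move=> M0 D H HB t; apply/ler_addgt0Pr => d d0; rewrite -lerBlDr sub0r ltW//.
apply: (@barrier_rev R u du (- d) (M * d) (- B) (mulr_gt0 M0 d0) D) => // s us.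
by have := H s; have : M * u s <= M * - d by [rewrite ler_pM2l]; lra.
Qed.

Lemma box_compact (N : R) : compact ([set: Om] `*` `[- N, N]).
Proof. by apply: compact_setX => //; exact: segment_compact. Qed.

Lemma box_bound (q : Om -> R -> R) (N : R) : continuous (fun p : Om * R => q p.1 p.2) ->
  exists2 M : R, 0 < M & forall w x, `|x| <= N -> `|q w x| <= M.
Proof.
move=> cq; have [M M0 HM] := compact_norm_bound (@box_compact N) cq.
exists M => // w x xN; apply: (HM (w, x)); split=> //=.
by rewrite in_itv /= -ler_norml.
Qed.

Lemma box_unif_continuous (q : Om -> R -> R) (N d : R) :
  continuous (fun p : Om * R => q p.1 p.2) -> 0 < d ->
  exists2 dl : R, 0 < dl & forall w x y, `|x| <= N -> `|y - x| < dl -> `|q w y - q w x| < d.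
Proof.
move=> cq d0.
have := @compact_tube R R (Om * R)%type (fun p : R * (Om * R) => q p.2.1 (p.2.2 + p.1))
  ([set: Om] `*` `[- N, N]) 0 d (@box_compact N) _ d0.
case=> [[w x] _|/= dl dl0 H].
  apply: (@continuous_at2 _ _ _ _ (fun p : Om * R => q p.1 p.2)
    (fun p : R * (Om * R) => p.2.1) (fun p : R * (Om * R) => p.2.2 + p.1)).
  - exact: cq.
  - by apply: (@cvg_comp _ _ _ snd fst); [exact: cvg_snd|exact: cvg_fst].
  - apply: cvgD; last exact: cvg_fst.
    by apply: (@cvg_comp _ _ _ snd snd); [exact: cvg_snd|exact: cvg_snd].
exists dl => // w x y xN yx; have := H (y - x); rewrite /= sub0r normrN => /(_ yx (w, x)).
by rewrite /= addr0 [x + _]addrC subrK; apply; split=> //=; rewrite in_itv /= -ler_norml.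
Qed.

Section field.
Variables f fx : Om -> R -> R.
Hypothesis cf : continuous (fun p : Om * R => f p.1 p.2).
Hypothesis cfx : continuous (fun p : Om * R => fx p.1 p.2).
Hypothesis dfx : forall w (x : R), is_derive x 1 (f w) (fx w x).

Definition solution w (x : R -> R) := forall t, is_derive t 1 x (f (sig t w) (x t)).

Lemma field_lipschitz (N : R) : exists2 M : R, 0 < M &
  forall w x y, `|x| <= N -> `|y| <= N -> `|f w y - f w x| <= M * `|y - x|.
Proof.
have [M M0 HM] := box_bound N cfx; exists M => // w x y.
wlog xy : x y / x <= y.
  move=> W xN yN; have [|yx] := leP x y; first by move=> ?; exact: W.
  by rewrite distrC (distrC y); apply: W => //; exact: ltW.
move=> xN yN; move: xy; rewrite le_eqVlt => /predU1P[->|xy].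
  by rewrite !subrr !normr0 mulr0.
have [c /andP[xc cy] ->] := mvt xy (fun z _ => dfx w z).
rewrite normrM ler_wpM2r// HM//; move: xN yN; rewrite !ler_norml; lra.
Qed.

Lemma field_equicontinuous w t0 (N K d : R) : 0 <= K -> 0 < d -> exists2 dl : R, 0 < dl &
  forall t x y, `|t - t0| < dl -> `|x| <= N -> `|y| <= N -> `|x - y| <= K * `|t - t0| ->
    `|f (sig t w) x - f (sig t0 w) y| <= d.
Proof.
move=> K0 d0; have [M M0 HM] := field_lipschitz N.
have d20 : 0 < d / 2 by rewrite divr_gt0.
have := @compact_tube R R R (fun p : R * R => f (sig p.1 w) p.2) `[- N, N] t0 (d / 2)
  (@segment_compact _ _ _) _ d20.
case=> [x _|/= dl1 dl10 H1].
  apply: (@continuous_at2 _ _ _ _ (fun p : Om * R => f p.1 p.2)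
    (fun p : R * R => sig p.1 w) (fun p : R * R => p.2)).
  - exact: cf.
  - by apply: (@cvg_comp _ _ _ fst (fun t => sig t w)); [exact: cvg_fst|exact: (flow_continuous_time flow)].
  - exact: cvg_snd.
pose dl := Num.min dl1 (d / (2 * M * (K + 1))).
have MK : 0 < 2 * M * (K + 1) by rewrite !mulr_gt0//; lra.
exists dl; first by rewrite lt_min dl10 divr_gt0.
move=> t x y; rewrite lt_min => /andP[t1 t2] xN yN xy.
have := H1 t; rewrite /= distrC => /(_ t1 x); rewrite in_itv /= -ler_norml => /(_ xN) h1.
have h2 := HM (sig t0 w) y x yN xN.
have h3 : M * `|x - y| <= d / 2.
  apply: (@le_trans _ _ (M * (K * `|t - t0|))); first by rewrite ler_pM2l.
  move: t2; rewrite ltr_pdivlMr// => t2.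
  have : M * (K * `|t - t0|) <= M * ((K + 1) * `|t - t0|).
    by rewrite ler_pM2l// ler_wpM2r//; lra.
  lra.
have := ler_distD (f (sig t0 w) x) (f (sig t w) x) (f (sig t0 w) y); lra.
Qed.

Lemma solution_ordered w x y (N : R) : solution w x -> solution w y ->
  (forall t, `|x t| <= N) -> (forall t, `|y t| <= N) -> (exists t, x t < y t) ->
  forall t, x t < y t.
Proof.
move=> sx sy xN yN [t0 xy0] t; have [M M0 HM] := field_lipschitz N.
rewrite -subr_gt0.
apply: (@derive_pos R (fun t => y t - x t) _ M t0 (fun t => isD_sub (sy t) (sx t))).
  by move=> s; apply: HM.
by rewrite subr_gt0.
Qed.

Section iteration.
Variables b1 b1' b2 b2' : Om -> R.
Hypotheses (cb1 : continuous b1) (cb2 : continuous b2).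
Hypotheses (D1 : orbit_der sig b1 b1') (D2 : orbit_der sig b2 b2').
Hypothesis lower1 : forall w, b1' w <= f w (b1 w).
Hypothesis upper2 : forall w, f w (b2 w) <= b2' w.
Hypothesis b12 : forall w, b1 w <= b2 w.

(* Iterating the monotone resolvent of [b' + M b = f(b) + M b] from the lower
   solution produces an increasing sequence of continuous functions. *)
Lemma monotone_iteration : exists e, [/\ forall w, b1 w <= e w <= b2 w,
  orbit_der sig e (fun w => f w (e w)) &
  forall w (c : R), c < e w -> \forall w' \near w, c < e w'].
Proof.
have [N1 _ HN1] := compact_norm_bound cOm cb1.
have [N2 _ HN2] := compact_norm_bound cOm cb2.
pose N := Num.max N1 N2.
have inN w x : b1 w <= x <= b2 w -> `|x| <= N.
  move=> /andP[h1 h2]; have := HN1 w I; have := HN2 w I.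
  rewrite !ler_norml => /andP[_ h3] /andP[h4 _].
  have : N1 <= N by rewrite le_max lexx.
  have : N2 <= N by rewrite le_max lexx orbT.
  by move=> ? ?; apply/andP; split; lra.
have [M M0 HM] := field_lipschitz N.
have [Bf Bf0 HBf] := box_bound N cf.
pose Phi w x := f w x + M * x.
have Phimono w x y : `|x| <= N -> `|y| <= N -> x <= y -> Phi w x <= Phi w y.
  move=> xN yN xy; have := HM w x y xN yN.
  rewrite (ger0_norm (_ : 0 <= y - x)) ?subr_ge0// ler_norml => /andP[h _].
  by rewrite /Phi; lra.
have /choice[T HT] : forall phi : Om -> R, exists be : Om -> R, continuous phi ->
    continuous be /\ orbit_der sig be (fun w => phi w - M * be w).
  move=> phi; have [cphi|nc] := pselect (continuous phi); last by exists phi.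
  by have [be Hbe] := orbit_resolvent cOm flow M0 cphi; exists be.
have cPhi b : continuous b -> continuous (fun w => Phi w (b w)).
  move=> cb w; apply: cvgD.
    by apply: (@continuous_at2 _ _ _ _ (fun p : Om * R => f p.1 p.2) id b); [exact: cf| |exact: cb].
  by apply: cvgM; [exact: cvg_cst|exact: cb].
have cmp b c b' c' : continuous b -> continuous c -> orbit_der sig b b' -> orbit_der sig c c' ->
    (forall w, b' w + M * b w <= c' w + M * c w) -> forall w, b w <= c w.
  move=> cb cc db dc H w.
  have [B1 _ HB1] := compact_norm_bound cOm cb.
  have [B2 _ HB2] := compact_norm_bound cOm cc.
  have := @derive_add_decay_ge0 (fun t => c (sig t w) - b (sig t w)) _ M (B1 + B2) M0
    (fun t => isD_sub (dc w t) (db w t)).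
  move=> /(_ _ _ 0); rewrite flow0 subr_ge0; apply=> t.
    by have := H (sig t w); lra.
  have := HB1 (sig t w) I; have := HB2 (sig t w) I; rewrite !ler_norml.
  move=> /andP[? ?] /andP[? ?]; lra.
pose S b := T (fun w => Phi w (b w)).
have HS b : continuous b -> continuous (S b) /\
    orbit_der sig (S b) (fun w => Phi w (b w) - M * S b w) by move=> cb; exact/HT/cPhi.
have S1 : forall w, b1 w <= S b1 w.
  have [cS dS] := HS b1 cb1; apply: cmp D1 dS _ => // w; have := lower1 w; rewrite /Phi; lra.
have S2 : forall w, S b2 w <= b2 w.
  have [cS dS] := HS b2 cb2; apply: cmp dS D2 _ => // w; have := upper2 w; rewrite /Phi; lra.
have Smono b c : continuous b -> continuous c -> (forall w, `|b w| <= N) ->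
    (forall w, `|c w| <= N) -> (forall w, b w <= c w) -> forall w, S b w <= S c w.
  move=> cb cc bN cN bc; have [cSb dSb] := HS b cb; have [cSc dSc] := HS c cc.
  by apply: cmp dSb dSc _ => // w; have := Phimono w _ _ (bN w) (cN w) (bc w); lra.
pose it n := iter n S b1.
have b1N w : `|b1 w| <= N by apply: (inN w); rewrite lexx b12.
have b2N w : `|b2 w| <= N by apply: (inN w); rewrite lexx b12.
have itP n : [/\ continuous (it n), forall w, b1 w <= it n w <= b2 w & forall w, it n w <= it n.+1 w].
  elim: n => [|n [cn bn mn]].
    by split=> // w; rewrite lexx b12.
  have nN w : `|it n w| <= N by exact: (inN w).
  have [cS _] := HS _ cn.
  have bn1 w : b1 w <= it n.+1 w <= b2 w.
    have /andP[h1 h2] := bn w; rewrite (le_trans h1 (mn w)) /=.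
    by apply: le_trans (S2 w); apply: Smono => // v; have /andP[] := bn v.
  split=> //; apply: Smono => // w; exact: (inN w).
have cit n := let: And3 c _ _ := itP n in c.
have bit n w : b1 w <= it n w <= b2 w by have [_ + _] := itP n; exact.
have itN n w : `|it n w| <= N by exact: (inN w).
have mit w : nondecreasing_seq (fun n => it n w).
  by apply/nondecreasing_seqP => n; have [_ _ +] := itP n; exact.
have cvg_it w : cvgn (fun n => it n w).
  apply: nondecreasing_is_cvgn => //; exists (b2 w) => _ [n _ <-].
  by have /andP[] := bit n w.
pose e w := limn (fun n => it n w).
have ite w n : it n w <= e w by exact: nondecreasing_cvgn_le.
have eb w : b1 w <= e w <= b2 w.
  apply/andP; split; first by apply: le_trans (ite w 0%N); have /andP[] := bit 0%N w.
  by apply: limr_le => //; near=> n; have /andP[] := bit n w.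
exists e; split=> //; last first.
  move=> w c ce; have := cvgr_gt _ (cvg_it w) _ ce; case=> n _ /(_ n (leqnn n)) /= cn.
  have cw : it n w' @[w' --> w] --> it n w by exact: cit.
  near=> w'; apply: lt_le_trans (ite w' n); near: w'.
  exact: cvgr_gt cw _ cn.
move=> w t0.
pose d n w := Phi w (it n w) - M * it n.+1 w.
have dit n : orbit_der sig (it n.+1) (d n) by have [_] := HS _ (cit n).
have MN : 0 <= M * N by rewrite mulr_ge0 ?(ltW M0)//; apply: le_trans (b1N point).
have dB n v : `|d n v| <= Bf + 2 * (M * N).
  rewrite /d /Phi; have h1 := HBf v _ (itN n v).
  have h2 : `|M * it n v| <= M * N by rewrite normrM (gtr0_norm M0) ler_pM2l.
  have h3 : `|M * it n.+1 v| <= M * N by rewrite normrM (gtr0_norm M0) ler_pM2l.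
  move: h1 h2 h3; rewrite !ler_norml => /andP[? ?] /andP[? ?] /andP[? ?]; apply/andP; split; lra.
pose K := Bf + 2 * (M * N); have K0 : 0 <= K by rewrite /K; lra.
have lip n t : `|it n.+1 (sig t w) - it n.+1 (sig t0 w)| <= K * `|t - t0|.
  by apply: (@derive_bound R (fun t => it n.+1 (sig t w)) (fun t => d n (sig t w)) _ _ _ (dit n w)) => s; exact: dB.
have cve v : it n v @[n --> \oo] --> e v by exact: cvg_it.
have cvS v k : it (n + k)%N v @[n --> \oo] --> e v.
  by have := cve v; rewrite -(cvg_shiftn k).
have cfe v : continuous (f v).
  by move=> x; exact: is_derive_cont (dfx v x).
apply: (@derive_limit R nat \oo _ (fun n t => it n.+2 (sig t w)) (fun n t => d n.+1 (sig t w))).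
- by move=> t; have := cvS (sig t w) 2%N; under eq_fun do rewrite addn2.
- have c1 : it n.+1 (sig t0 w) @[n --> \oo] --> e (sig t0 w).
    by have := cvS (sig t0 w) 1%N; under eq_fun do rewrite addn1.
  have c2 : it n.+2 (sig t0 w) @[n --> \oo] --> e (sig t0 w).
    by have := cvS (sig t0 w) 2%N; under eq_fun do rewrite addn2.
  rewrite (_ : f _ _ = f (sig t0 w) (e (sig t0 w)) + M * e (sig t0 w) - M * e (sig t0 w)); last by ring.
  apply: cvgB; last by apply: cvgM => //; exact: cvg_cst.
  apply: cvgD; last by apply: cvgM => //; exact: cvg_cst.
  by apply: (@cvg_comp _ _ _ (fun n => it n.+1 (sig t0 w)) (f (sig t0 w))); [exact: c1|exact: cfe].
- by near=> n => t; exact: dit.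
move=> r r0; have r20 : 0 < r / 2 by rewrite divr_gt0.
have [dl dl0 Hdl] := @field_equicontinuous w t0 N K (r / 2) K0 r20.
pose dl' := Num.min dl (r / (4 * M * (K + 1))).
have MK : 0 < 4 * M * (K + 1) by rewrite !mulr_gt0//; lra.
exists dl'; first by rewrite lt_min dl0 divr_gt0.
near=> n => t; rewrite lt_min => /andP[t1 t2].
have h1 := Hdl t (it n.+1 (sig t w)) (it n.+1 (sig t0 w)) t1 (itN _ _) (itN _ _) (lip n t).
have l1 := lip n t; have l2 := lip n.+1 t.
have sm : M * (K * `|t - t0|) <= r / 4.
  move: t2; rewrite ltr_pdivlMr// => t2.
  have : M * (K * `|t - t0|) <= M * ((K + 1) * `|t - t0|).
    by rewrite ler_pM2l// ler_wpM2r//; lra.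
  lra.
have m1 : `|M * (it n.+1 (sig t w) - it n.+1 (sig t0 w))| <= r / 4.
  by rewrite normrM (gtr0_norm M0); apply: le_trans sm; rewrite ler_pM2l.
have m2 : `|M * (it n.+2 (sig t w) - it n.+2 (sig t0 w))| <= r / 4.
  by rewrite normrM (gtr0_norm M0); apply: le_trans sm; rewrite ler_pM2l.
rewrite /d /Phi; move: h1 m1 m2; rewrite !ler_norml => /andP[? ?] /andP[? ?] /andP[? ?].
by apply/andP; split; lra.
Unshelve. all: end_near. Qed.

End iteration.
End field.

Section unique_equilibrium.
Variables f fx : Om -> R -> R.
Hypothesis cf : continuous (fun p : Om * R => f p.1 p.2).
Hypothesis cfx : continuous (fun p : Om * R => fx p.1 p.2).
Hypothesis dfx : forall w (x : R), is_derive x 1 (f w) (fx w x).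
Variables b1 b1' b2 b2' : Om -> R.
Hypotheses (cb1 : continuous b1) (cb2 : continuous b2).
Hypotheses (D1 : orbit_der sig b1 b1') (D2 : orbit_der sig b2 b2').
Hypothesis lower1 : forall w, b1' w <= f w (b1 w).
Hypothesis upper2 : forall w, f w (b2 w) <= b2' w.
Hypothesis b12 : forall w, b1 w <= b2 w.
Hypothesis uniq : forall w x y, solution f w x -> solution f w y ->
  (forall t, b1 (sig t w) <= x t <= b2 (sig t w)) ->
  (forall t, b1 (sig t w) <= y t <= b2 (sig t w)) -> (forall t, x t <= y t) -> x 0 = y 0.

Lemma unique_equilibrium : exists e, [/\ continuous e, forall w, b1 w <= e w <= b2 w &
  orbit_der sig e (fun w => f w (e w))].
Proof.
have [e1 [r1 s1 lsc]] := monotone_iteration cf cfx dfx cb1 cb2 D1 D2 lower1 upper2 b12.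
pose g w x := - f w (- x); pose gx w x := fx w (- x).
have cneg : continuous (fun p : Om * R => - p.2).
  by move=> p; apply: (@continuous_comp _ _ _ snd (fun x : R => - x)); [exact: cvg_snd|exact: oppr_continuous].
have cg : continuous (fun p : Om * R => g p.1 p.2).
  move=> p; apply: cvgN; apply: (@continuous_at2 _ _ _ _ (fun p : Om * R => f p.1 p.2) fst (fun p : Om * R => - p.2)).
  - exact: cf.
  - exact: cvg_fst.
  - exact: cneg.
have cgx : continuous (fun p : Om * R => gx p.1 p.2).
  move=> p; apply: (@continuous_at2 _ _ _ _ (fun p : Om * R => fx p.1 p.2) fst (fun p : Om * R => - p.2)).
  - exact: cfx.
  - exact: cvg_fst.
  - exact: cneg.
have dgx w (x : R) : is_derive x 1 (g w) (gx w x).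
  by apply: (isD_eq (isD_opp (is_derive_rev (df := fx w) (dfx w (- x))))); rewrite opprK.
have cN b : continuous b -> continuous (fun w => - b w).
  by move=> cb w; apply: cvgN; exact: cb.
have DN b b' : orbit_der sig b b' -> orbit_der sig (fun w => - b w) (fun w => - b' w).
  by move=> H w t; exact: isD_opp.
have [||| e2 [r2 s2 usc]] := monotone_iteration cg cgx dgx (cN _ cb2) (cN _ cb1) (DN _ _ D2) (DN _ _ D1).
- by move=> w; rewrite /g opprK lerN2.
- by move=> w; rewrite /g opprK lerN2.
- by move=> w; rewrite lerN2.
have s2' : orbit_der sig (fun w => - e2 w) (fun w => f w (- e2 w)).
  by move=> w t; apply: (isD_eq (isD_opp (s2 w t))); rewrite /g opprK.
have r2' w : b1 w <= - e2 w <= b2 w by have := r2 w; rewrite lerNl lerNr andbC.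
have [N1 _ HN1] := compact_norm_bound cOm cb1.
have [N2 _ HN2] := compact_norm_bound cOm cb2.
pose N := Num.max N1 N2.
have inN w x : b1 w <= x <= b2 w -> `|x| <= N.
  move=> /andP[h1 h2]; have := HN1 w I; have := HN2 w I.
  rewrite !ler_norml => /andP[_ h3] /andP[h4 _].
  have : N1 <= N by rewrite le_max lexx.
  have : N2 <= N by rewrite le_max lexx orbT.
  by move=> ? ?; apply/andP; split; lra.
have ord b c w : orbit_der sig b (fun w => f w (b w)) -> orbit_der sig c (fun w => f w (c w)) ->
   (forall w, b1 w <= b w <= b2 w) -> (forall w, b1 w <= c w <= b2 w) -> c w <= b w.
  move=> db dc rb rc; rewrite leNgt; apply/negP => bc.
  have lt : forall t, b (sig t w) < c (sig t w).
    apply: (@solution_ordered f fx cfx dfx w (fun t => b (sig t w)) (fun t => c (sig t w)) N (db w) (dc w)).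
    - by move=> t; exact: (inN (sig t w)).
    - by move=> t; exact: (inN (sig t w)).
    - by exists 0; rewrite flow0.
  have := uniq (db w) (dc w) (fun t => rb _) (fun t => rc _) (fun t => ltW (lt t)).
  by rewrite flow0 => E; move: bc; rewrite E ltxx.
have E w : e1 w = - e2 w.
  by apply/eqP; rewrite eq_le (ord _ _ w s2' s1)// (ord _ _ w s1 s2').
exists e1; split=> // w; apply/cvgrPdist_lt => /= d d0.
have h1 := lsc w (e1 w - d) (ltac:(lra)).
have h2 := usc w (e2 w - d) (ltac:(lra)).
near=> w'.
have k1 : e1 w - d < e1 w' by near: w'.
have k2 : e2 w - d < e2 w' by near: w'.
have := E w; have := E w' => E1 E2.
rewrite ltr_norml; apply/andP; split; lra.
Unshelve. all: end_near. Qed.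

End unique_equilibrium.

Section contraction.
Variables (psi V V' : Om -> R) (e D : R).
Hypothesis coh : cohomologous_below sig psi V V' e.
Hypothesis VD : forall w, `|V w| <= D.

Lemma contraction_bound w (U dU : R -> R) (B C : R) : 0 <= C ->
  (forall t, is_derive t 1 U (dU t)) -> (forall t, 0 <= U t <= B) ->
  (forall t, dU t <= psi (sig t w) * U t + C) -> forall t, U t <= C * expR (2 * D) / e.
Proof.
move=> C0 HU UB HdU t; have [cV cV' dV e0 Hpsi] := coh.
have Vb (s : Om) : - D <= V s <= D by rewrite -ler_norml.
pose W s := U s * expR (- V (sig s w)).
pose dW s := dU s * expR (- V (sig s w)) + U s * (expR (- V (sig s w)) * - V' (sig s w)).
have HW s : is_derive s 1 W (dW s) by apply: isD_mul (HU s) (isD_exp (isD_opp (dV w s))).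
have dWle s : dW s <= - e * W s + C * expR D.
  have /andP[U0 _] := UB s.
  have E0 := expR_gt0 (- V (sig s w)).
  have -> : dW s = (dU s - U s * V' (sig s w)) * expR (- V (sig s w)) by rewrite /dW; ring.
  have h1 : dU s - U s * V' (sig s w) <= - e * U s + C.
    have := HdU s; have : U s * (psi (sig s w) + e) <= U s * V' (sig s w) by rewrite ler_wpM2l.
    lra.
  apply: (@le_trans _ _ ((- e * U s + C) * expR (- V (sig s w)))); first by rewrite ler_pM2r.
  rewrite mulrDl /W mulrA lerD2l ler_wpM2l// ler_expR; have := Vb (sig s w); lra.
have WB s : W s <= B * expR D.
  have /andP[U0 UB'] := UB s; apply: ler_pM; [exact: U0|exact: expR_ge0|exact: UB'|].
  by rewrite ler_expR; have := Vb (sig s w); lra.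
have Wle : W t <= C * expR D / e.
  apply/ler_addgt0Pr => d d0; rewrite -lerN2 ltW//.
  apply: (@barrier_rev R (fun t => - W t) _ _ (e * d) (- (B * expR D)) _ (fun t => isD_opp (HW t))).
  - exact: mulr_gt0.
  - move=> s; rewrite lerN2 => h; have := dWle s.
    have : e * (C * expR D / e + d) <= e * W s by rewrite ler_pM2l.
    rewrite mulrDr [e * (_ / e)]mulrC divfK ?gt_eqF//; lra.
  - by move=> s; rewrite lerN2.
have -> : U t = W t * expR (V (sig t w)).
  by rewrite /W -mulrA -expRD addNr expR0 mulr1.
have -> : C * expR (2 * D) / e = C * expR D / e * expR D.
  by rewrite (_ : 2 * D = D + D) ?expRD; ring.
apply: ler_pM; last 1 first.
- by rewrite ler_expR; have := Vb (sig t w); lra.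
- by have /andP[U0 _] := UB t; rewrite mulr_ge0 ?expR_ge0.
- exact: expR_ge0.
- exact: Wle.
Qed.

Lemma contraction_decay w (U ka : R -> R) : (forall t, is_derive t 1 U (ka t * U t)) ->
  (forall t, ka t <= psi (sig t w)) -> forall t, 0 <= t ->
  `|U t| <= expR (2 * D) * expR (- (e * t)) * `|U 0|.
Proof.
move=> HU Hka t t0; have [cV cV' dV e0 Hpsi] := coh.
have Vb (s : Om) : - D <= V s <= D by rewrite -ler_norml.
pose Z s := U s * expR (e * s - V (sig s w)).
have HZ s : is_derive s 1 Z ((ka s + e - V' (sig s w)) * Z s).
  apply: (isD_eq (isD_mul (HU s) (isD_exp (isD_sub (isD_scale e (isD_id s)) (dV w s))))).
  by rewrite /Z; ring.
have sq : Z t * Z t <= Z 0 * Z 0.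
  apply: (@derive_le0_le R (fun s => Z s * Z s) _ 0 t t0 (fun s _ => isD_mul (HZ s) (HZ s))).
  move=> s _; have := Hpsi (sig s w); have := Hka s => h1 h2.
  have -> : (ka s + e - V' (sig s w)) * Z s * Z s + Z s * ((ka s + e - V' (sig s w)) * Z s) =
    2 * (ka s + e - V' (sig s w)) * (Z s ^+ 2) by ring.
  by rewrite mulr_le0_ge0 ?sqr_ge0//; lra.
have absZ : `|Z t| <= `|Z 0|.
  by rewrite -ler_sqr ?nnegrE// !real_normK ?num_real// !expr2.
move: absZ; rewrite /Z !normrM !(ger0_norm (expR_ge0 _)) mulr0 sub0r flow0 => h.
have -> : `|U t| = `|U t| * expR (e * t - V (sig t w)) * expR (V (sig t w) - e * t).
  by rewrite -mulrA -expRD (_ : _ + _ = 0) ?expR0 ?mulr1//; ring.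
apply: (@le_trans _ _ (`|U 0| * expR (- V w) * expR (V (sig t w) - e * t))).
  by rewrite ler_pM2r ?expR_gt0.
rewrite -mulrA -expRD [leRHS]mulrC -expRD ler_wpM2l// ler_expR.
by have := Vb w; have := Vb (sig t w); lra.
Qed.

End contraction.

End scalar_fields.

(** * Contraction in the coordinate of an upper and a lower solution *)

Section moebius_coordinate.
Context {R : realType} {Om : pseudoPMetricType R} (T : R -> Om -> Om).
Hypothesis flow : is_flow T.
Variables (f fx : Om -> R -> R).
Implicit Types (t u : R).
Hypothesis dfx : forall w (x : R), is_derive x 1 (f w) (fx w x).
Variables (sg : R) (p p' s s' b1 b2 : Om -> R) (dl Dm : R).
Hypothesis sg2 : sg * sg = 1.
Hypothesis dp : orbit_der T p (fun w => - sg * p' w).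
Hypothesis ds : orbit_der T s (fun w => - sg * s' w).
Hypothesis dl0 : 0 < dl.
Hypothesis margin : forall w x, b1 w <= x <= b2 w ->
  [/\ dl <= sg * (x - p w) <= Dm, dl <= s w - x <= Dm & dl <= s w - p w].

Definition cross_rate w x : R := fx w x + (s' w - p' w) / (s w - p w)
  - (f w x - p' w) / (x - p w) - (s' w - f w x) / (s w - x).

Definition cross_density w x : R := (x - p w)^-1 + (s w - x)^-1.

Definition cross_field w x : R := (f w x - p' w) / (x - p w) - (s' w - f w x) / (s w - x).

Let coord w x : R := ln (sg * (x - p w)) - ln (s w - x).

Let nz w x : b1 w <= x <= b2 w -> [/\ x - p w != 0, s w - x != 0 & s w - p w != 0].
Proof.
move=> /margin[/andP[h1 _] /andP[h2 _] h3]; split; last 2 first.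
- by rewrite gt_eqF// (lt_le_trans dl0).
- by rewrite gt_eqF// (lt_le_trans dl0).
by apply/eqP => E; move: h1; rewrite E mulr0 leNgt dl0.
Qed.

Lemma cross_densityE w x : b1 w <= x <= b2 w ->
  sg * cross_density w x = (s w - p w) / (sg * (x - p w) * (s w - x)).
Proof.
move=> H; have [n1 n2 n3] := nz H.
have sg0 : sg != 0 by apply/eqP => E; move: sg2; rewrite E mulr0 => /esym/eqP; rewrite oner_eq0.
have -> : (s w - p w) / (sg * (x - p w) * (s w - x)) =
    (sg * sg) * ((s w - p w) / (sg * (x - p w) * (s w - x))) by rewrite sg2 mul1r.
rewrite /cross_density; field; by rewrite n2 n1 sg0.
Qed.

Lemma cross_density_bounds w x : b1 w <= x <= b2 w ->
  dl / (Dm * Dm) <= sg * cross_density w x <= 2 / dl.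
Proof.
move=> H; have [/andP[h1 h2] /andP[h3 h4] h5] := margin H; rewrite cross_densityE//.
set y := sg * (x - p w) in h1 h2 *; set z := s w - x in h3 h4 *.
have y0 : 0 < y by exact: lt_le_trans h1. have z0 : 0 < z by exact: lt_le_trans h3.
have D0 : 0 < Dm by exact: lt_le_trans h2.
apply/andP; split.
  apply: ler_pM; [exact: ltW|by rewrite invr_ge0 mulr_ge0 ?ltW|exact: h5|].
  rewrite lef_pV2 ?posrE ?(mulr_gt0 y0 z0) ?(mulr_gt0 D0 D0)//.
  by apply: ler_pM => //; exact: ltW.
have [n1 n2 n3] := nz H.
have -> : (s w - p w) / (y * z) = sg * cross_density w x by rewrite cross_densityE.
rewrite /cross_density mulrDr (_ : 2 / dl = dl^-1 + dl^-1); last by ring.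
apply: lerD.
  have -> : sg / (x - p w) = y^-1.
    have sg0 : sg != 0 by apply/eqP => E; move: sg2; rewrite E mulr0 => /esym/eqP; rewrite oner_eq0.
    have sgV : sg^-1 = sg by apply: (mulfI sg0); rewrite divff.
    by rewrite /y invfM sgV.
  by rewrite lef_pV2 ?posrE.
have : z^-1 <= dl^-1 by rewrite lef_pV2 ?posrE.
have zi : 0 < z^-1 by rewrite invr_gt0.
have sg1 : sg <= 1.
  have <- : `|sg| = 1; last exact: ler_norm.
  have : `|sg| * `|sg| = 1 by rewrite -normrM sg2 normr1.
  by have := normr_ge0 sg; nra.
by apply: le_trans; rewrite ler_piMl// ltW.
Qed.

Let coord_derive w x : b1 w <= x <= b2 w ->
  is_derive x 1 (coord w) (cross_density w x).
Proof.
move=> H; have [/andP[h1 h2] /andP[h3 h4] h5] := margin H; have [n1 n2 n3] := nz H.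
have y0 : 0 < sg * (x - p w) by exact: lt_le_trans h1.
have z0 : 0 < s w - x by exact: lt_le_trans h3.
have d1 := isD_ln (f := fun x => sg * (x - p w)) y0
  (isD_scale sg (isD_sub (isD_id x) (isD_cst (p w) x))).
have d2 := isD_ln (f := fun x => s w - x) z0 (isD_sub (isD_cst (s w) x) (isD_id x)).
have sg0 : sg != 0 by apply/eqP => E; move: sg2; rewrite E mulr0 => /esym/eqP; rewrite oner_eq0.
apply: (isD_eq (isD_sub d1 d2)); rewrite /cross_density; field.
by rewrite n1 n2 sg0.
Qed.

Let field_derive w x : b1 w <= x <= b2 w ->
  is_derive x 1 (cross_field w) (cross_rate w x * cross_density w x).
Proof.
move=> H; have [n1 n2 n3] := nz H.
have d1 := isD_div (g := fun x => x - p w) n1 (isD_sub (dfx w x) (isD_cst (p' w) x))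
  (isD_sub (isD_id x) (isD_cst (p w) x)).
have d2 := isD_div (g := fun x => s w - x) n2 (isD_sub (isD_cst (s' w) x) (dfx w x))
  (isD_sub (isD_cst (s w) x) (isD_id x)).
apply: (isD_eq (isD_sub d1 d2)); rewrite /cross_rate /cross_density; field.
by rewrite n1 n2 n3.
Qed.

Variables (psi V V' : Om -> R) (e D : R).
Hypothesis coh : cohomologous_below T psi V V' e.
Hypothesis VD : forall w, `|V w| <= D.
Hypothesis rate : forall w x, b1 w <= x <= b2 w -> - sg * cross_rate w x <= psi w.

Lemma moebius_pair w (x y : R -> R) (k1 k2 B : R) :
  (forall t : R, is_derive t 1 x (- sg * f (T t w) (x t) + k1)) ->
  (forall t : R, is_derive t 1 y (- sg * f (T t w) (y t) + k2)) ->
  (forall t, b1 (T t w) <= x t <= b2 (T t w)) ->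
  (forall t, b1 (T t w) <= y t <= b2 (T t w)) ->
  (forall t, x t <= y t) -> (forall t, y t - x t <= B) ->
  forall t, y t - x t <= (2 / dl) * expR (2 * D) / e / (dl / (Dm * Dm)) * (`|k1| + `|k2|).
Proof.
move=> dx dy rx ry xy yxB t.
have e0 : 0 < e by have [] := coh.
have [/andP[h1 hD] _ _] := margin (rx 0).
have Dm0 : 0 < Dm by apply: lt_le_trans hD; exact: lt_le_trans h1.
have c0 : 0 < dl / (Dm * Dm) by rewrite divr_gt0// mulr_gt0.
have seg u z : x u <= z <= y u -> b1 (T u w) <= z <= b2 (T u w).
  move=> /andP[h2 h3]; have /andP[h4 _] := rx u; have /andP[_ h5] := ry u.
  by rewrite (le_trans h4 h2) (le_trans h3 h5).
pose U u := sg * (coord (T u w) (y u) - coord (T u w) (x u)).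
have dcoord (z : R -> R) (kz : R) : (forall t : R, is_derive t 1 z (- sg * f (T t w) (z t) + kz)) ->
    (forall t, b1 (T t w) <= z t <= b2 (T t w)) -> forall u : R,
    is_derive u 1 (fun u => coord (T u w) (z u))
     (- sg * cross_field (T u w) (z u) + kz * cross_density (T u w) (z u)).
  move=> dz rz u; have H := rz u.
  have [/andP[m1 m2] /andP[m3 m4] m5] := margin H; have [n1 n2 n3] := nz H.
  have y0 : 0 < sg * (z u - p (T u w)) by exact: lt_le_trans m1.
  have z0 : 0 < s (T u w) - z u by exact: lt_le_trans m3.
  have d1 := isD_ln (f := fun u => sg * (z u - p (T u w))) y0 (isD_scale sg (isD_sub (dz u) (dp w u))).
  have d2 := isD_ln (f := fun u => s (T u w) - z u) z0 (isD_sub (ds w u) (dz u)).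
  have sg0 : sg != 0 by apply/eqP => E; move: sg2; rewrite E mulr0 => /esym/eqP; rewrite oner_eq0.
  apply: (isD_eq (isD_sub d1 d2)); rewrite /cross_density /cross_field; field.
  by rewrite n1 n2 sg0.
have dU u := isD_scale sg (isD_sub (dcoord y k2 dy ry u) (dcoord x k1 dx rx u)).
have Ulow u : dl / (Dm * Dm) * (y u - x u) <= U u.
  have := @derive_ge0_le R (fun z => sg * coord (T u w) z - dl / (Dm * Dm) * z) _ (x u) (y u) (xy u)
    (fun z hz => isD_sub (isD_scale sg (coord_derive (seg u z hz))) (isD_scale _ (isD_id z))).
  rewrite /U => H; have : forall z, x u <= z <= y u -> 0 <= sg * cross_density (T u w) z - dl / (Dm * Dm) * 1.
    by move=> z /seg/cross_density_bounds/andP[h _]; rewrite mulr1 subr_ge0.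
  by move/H; lra.
have Uup u : U u <= 2 / dl * (y u - x u).
  have := @derive_le0_le R (fun z => sg * coord (T u w) z - 2 / dl * z) _ (x u) (y u) (xy u)
    (fun z hz => isD_sub (isD_scale sg (coord_derive (seg u z hz))) (isD_scale _ (isD_id z))).
  rewrite /U => H; have : forall z, x u <= z <= y u -> sg * cross_density (T u w) z - 2 / dl * 1 <= 0.
    by move=> z /seg/cross_density_bounds/andP[_ h]; rewrite mulr1 subr_le0.
  by move/H; lra.
have UB u : 0 <= U u <= 2 / dl * B.
  have yx0 : 0 <= y u - x u by rewrite subr_ge0.
  rewrite (le_trans (mulr_ge0 (ltW c0) yx0) (Ulow u)) /=.
  by apply: le_trans (Uup u) _; rewrite ler_pM2l ?divr_gt0.
have grow u : - (cross_field (T u w) (y u) - cross_field (T u w) (x u)) <= psi (T u w) * U u.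
  have := @derive_ge0_le R (fun z => cross_field (T u w) z + sg * psi (T u w) * coord (T u w) z) _
    (x u) (y u) (xy u)
    (fun z hz => isD_add (field_derive (seg u z hz)) (isD_scale _ (coord_derive (seg u z hz)))).
  rewrite /U => H.
  have : forall z, x u <= z <= y u -> 0 <= cross_rate (T u w) z * cross_density (T u w) z +
      sg * psi (T u w) * cross_density (T u w) z.
    move=> z /seg hz; have /andP[hd _] := cross_density_bounds hz.
    have hr := rate hz.
    have -> : cross_rate (T u w) z * cross_density (T u w) z +
      sg * psi (T u w) * cross_density (T u w) z =
      (sg * sg) * cross_rate (T u w) z * cross_density (T u w) z +
      sg * psi (T u w) * cross_density (T u w) z by rewrite sg2 mul1r.
    have -> : (sg * sg) * cross_rate (T u w) z * cross_density (T u w) z +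
      sg * psi (T u w) * cross_density (T u w) z =
      (psi (T u w) - - sg * cross_rate (T u w) z) * (sg * cross_density (T u w) z) by ring.
    by rewrite mulr_ge0 ?subr_ge0// (le_trans (ltW c0)).
  by move/H; lra.
have rb u z : b1 (T u w) <= z <= b2 (T u w) -> `|cross_density (T u w) z| <= 2 / dl.
  move=> hz; have /andP[hd1 hd2] := cross_density_bounds hz.
  have nsg : `|sg| = 1.
    have : `|sg| * `|sg| = 1 by rewrite -normrM sg2 normr1.
    by have := normr_ge0 sg; nra.
  have -> : `|cross_density (T u w) z| = `|sg * cross_density (T u w) z| by rewrite normrM nsg mul1r.
  by rewrite (ger0_norm (le_trans (ltW c0) hd1)).
have kpos : 0 <= 2 / dl * (`|k1| + `|k2|) by rewrite mulr_ge0 ?addr_ge0// divr_ge0// ltW.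
have := contraction_bound coh VD kpos dU UB.
move=> /(_ w)/(_ _ t)/wrap[u|].
  have := grow u; rewrite /U.
  have n1 : `|k2 * cross_density (T u w) (y u)| <= `|k2| * (2 / dl) by rewrite normrM ler_wpM2l// rb.
  have n2 : `|k1 * cross_density (T u w) (x u)| <= `|k1| * (2 / dl) by rewrite normrM ler_wpM2l// rb.
  have sgle : sg * (k2 * cross_density (T u w) (y u) - k1 * cross_density (T u w) (x u)) <=
     2 / dl * (`|k1| + `|k2|).
    apply: le_trans (ler_norm _) _; rewrite normrM.
    have -> : `|sg| = 1.
      have : `|sg| * `|sg| = 1 by rewrite -normrM sg2 normr1.
      by have := normr_ge0 sg; nra.
    rewrite mul1r; apply: le_trans (ler_normB _ _) _; lra.
  set Gy := cross_field _ (y u); set Gx := cross_field _ (x u).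
  have -> : sg * (- sg * Gy + k2 * cross_density (T u w) (y u) -
     (- sg * Gx + k1 * cross_density (T u w) (x u))) = - (sg * sg) * (Gy - Gx) +
     sg * (k2 * cross_density (T u w) (y u) - k1 * cross_density (T u w) (x u)) by ring.
  rewrite sg2; lra.
move=> Ut; have := le_trans (Ulow t) Ut.
rewrite -ler_pdivlMl// => /le_trans; apply; rewrite le_eqVlt; apply/orP; left; apply/eqP.
by field; rewrite !gt_eqF.
Qed.

Lemma moebius_decay w (x z : R -> R) :
  (forall t : R, is_derive t 1 x (- sg * f (T t w) (x t))) ->
  (forall t, b1 (T t w) <= x t <= b2 (T t w)) ->
  (forall t : R, is_derive t 1 z (- sg * fx (T t w) (x t) * z t)) ->
  forall t, 0 <= t ->
  `|z t| <= (2 / dl) / (dl / (Dm * Dm)) * expR (2 * D) * expR (- (e * t)) * `|z 0|.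
Proof.
move=> dx rx dz t t0.
have [/andP[_ hD] _ _] := margin (rx 0).
have [/andP[h1 _] _ _] := margin (rx 0).
have Dm0 : 0 < Dm by apply: lt_le_trans hD; exact: lt_le_trans h1.
have c0 : 0 < dl / (Dm * Dm) by rewrite divr_gt0// mulr_gt0.
pose U u := sg * cross_density (T u w) (x u) * z u.
have dU (u : R) : is_derive u 1 U (- sg * cross_rate (T u w) (x u) * U u).
  have [n1 n2 n3] := nz (rx u).
  have d1 := isD_inv (f := fun u => x u - p (T u w)) n1 (isD_sub (dx u) (dp w u)).
  have d2 := isD_inv (f := fun u => s (T u w) - x u) n2 (isD_sub (ds w u) (dx u)).
  apply: (isD_eq (isD_mul (isD_scale sg (isD_add d1 d2)) (dz u))).
  rewrite /U /cross_rate /cross_density; field.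
  by rewrite n1 n2 n3.
have := contraction_decay flow coh VD dU (fun u => rate (rx u)) t0.
have /andP[l1 _] := cross_density_bounds (rx t).
have /andP[l2 u2] := cross_density_bounds (rx 0).
rewrite /U !normrM.
have -> : `|sg| * `|cross_density (T t w) (x t)| = sg * cross_density (T t w) (x t).
  by rewrite -normrM ger0_norm// (le_trans (ltW c0)).
have -> : `|sg| * `|cross_density (T 0 w) (x 0)| = sg * cross_density (T 0 w) (x 0).
  by rewrite -normrM ger0_norm// (le_trans (ltW c0)).
set A := expR (2 * D) * _ => H.
have A0 : 0 <= A by rewrite mulr_ge0 ?expR_ge0.
have : dl / (Dm * Dm) * `|z t| <= A * (2 / dl * `|z 0|).
  apply: le_trans (_ : _ <= sg * cross_density (T t w) (x t) * `|z t|) _.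
    by rewrite ler_wpM2r.
  apply: le_trans H _; rewrite ler_wpM2l// ler_wpM2r//.
rewrite -ler_pdivlMl// => /le_trans; apply; rewrite le_eqVlt; apply/orP; left; apply/eqP.
by rewrite /A; field; rewrite !gt_eqF.
Qed.

End moebius_coordinate.

Lemma cross_rate_bound {R : realType} (F dF : R -> R) (lo p x s p' s' sg e0 dl Dm : R) :
  sg = 1 \/ sg = -1 -> 0 < dl -> 0 <= e0 ->
  lo <= p -> lo <= x -> dl <= sg * (x - p) -> dl <= s - x <= Dm -> dl <= s - p <= Dm ->
  (forall z : R, is_derive z 1 F (dF z)) -> concave_on dF [set z | lo <= z <= s] ->
  F p <= p' -> s' + e0 <= F s ->
  e0 * dl / (Dm * Dm) <=
    sg * (dF x + (s' - p') / (s - p) - (F x - p') / (x - p) - (s' - F x) / (s - x)).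
Proof.
move=> hsg dl0 e00 lop lox hy /andP[hz hzD] /andP[hq hqD] HF conc pp ss.
have z0 : 0 < s - x by exact: lt_le_trans hz.
have q0 : 0 < s - p by exact: lt_le_trans hq.
have D0 : 0 < Dm by exact: lt_le_trans hzD.
pose y := sg * (x - p); have y0 : 0 < y by exact: lt_le_trans hy.
have pNx : p != x by apply/eqP => E; move: y0; rewrite /y E subrr mulr0 ltxx.
have xp0 : x - p != 0 by rewrite subr_eq0 eq_sym.
have ps : p < s by rewrite -subr_gt0.
have xs : x < s by rewrite -subr_gt0.
have G := concave_derive_four_points lop lox ps xs pNx HF conc.
set G0 := dF x + _ - _ - _ in G.
have sG : 0 <= sg * G0.
  rewrite -(pmulr_rge0 _ y0) /y.
  have -> : sg * (x - p) * (sg * G0) = (sg * sg) * ((x - p) * G0) by ring.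
  by case: hsg => ->; rewrite ?mulrNN mul1r mul1r.
have key : sg * (dF x + (s' - p') / (s - p) - (F x - p') / (x - p) - (s' - F x) / (s - x)) =
   sg * G0 + ((p' - F p) * (s - x) / (y * (s - p)) + (F s - s') * y / ((s - x) * (s - p))).
  have n1 : s - x != 0 by rewrite gt_eqF.
  have n2 : s - p != 0 by rewrite gt_eqF.
  have n3 : p - x != 0 by rewrite subr_eq0.
  by rewrite /y /G0; case: hsg => ->; field; rewrite ?n1 ?n2 ?n3 ?xp0 ?oppr_eq0 ?mulN1r ?oppr_eq0 ?xp0.
rewrite key.
have t1 : 0 <= (p' - F p) * (s - x) / (y * (s - p)).
  by apply: divr_ge0; apply: mulr_ge0; rewrite ?subr_ge0 ?(ltW y0) ?(ltW ps) ?(ltW xs).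
have t2 : e0 * dl / (Dm * Dm) <= (F s - s') * y / ((s - x) * (s - p)).
  apply: ler_pM.
  - by rewrite mulr_ge0// ltW.
  - by rewrite invr_ge0 mulr_ge0// ltW.
  - by apply: ler_pM => //; [exact: ltW|lra].
  - rewrite lef_pV2 ?posrE ?(mulr_gt0 D0 D0) ?(mulr_gt0 z0 q0)//.
    by apply: ler_pM => //; exact: ltW.
lra.
Qed.

Section directed_flow.
Context {R : realType} {Om : pseudoPMetricType R} (sig : R -> Om -> Om).
Hypothesis flow : is_flow sig.
Variable sg : R.
Hypothesis hsg : sg = 1 \/ sg = -1.

(* Time runs backwards for [sg = 1] and forwards for [sg = -1]. *)
Definition dir_flow t w := sig (- sg * t) w.

Lemma dir_flow_flow : is_flow dir_flow.
Proof.
have [cs [f0 fD]] := flow; split; last split.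
- move=> q; apply: (@continuous_at2 _ _ _ _ (fun p : R * Om => sig p.1 p.2)
    (fun p : R * Om => - sg * p.1) snd).
  + exact: cs.
  + by apply: cvgM; [exact: cvg_cst|exact: cvg_fst].
  + exact: cvg_snd.
- by move=> w; rewrite /dir_flow mulr0 f0.
- by move=> s t w; rewrite /dir_flow mulrDr fD.
Qed.

Lemma dir_flow_der (x : R -> R) (d : R -> R) (t : R) : is_derive (- sg * t) 1 x (d (- sg * t)) ->
  is_derive t 1 (fun t => x (- sg * t)) (- sg * d (- sg * t)).
Proof.
move=> H; apply: (isD_eq (@isD_comp R x (fun t => - sg * t) _ _ t H (isD_scale (- sg) (isD_id t)))).
by ring.
Qed.

Lemma dir_flow_orbit_der (b b' : Om -> R) : orbit_der sig b b' ->
  orbit_der dir_flow b (fun w => - sg * b' w).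
Proof.
move=> H w t; apply: (@dir_flow_der (fun t => b (sig t w)) (fun t => b' (sig t w))); exact: H.
Qed.

Lemma dir_flow_cohomologous psi V V' e : cohomologous_below sig psi V V' e ->
  cohomologous_below dir_flow psi (fun w => - sg * V w) V' e.
Proof.
move=> [cV cV' dV e0 H]; split=> //; first by apply: continuous_fun_scale.
move=> w t; apply: (isD_eq (isD_scale (- sg) (dir_flow_orbit_der dV w t))).
by case: hsg => ->; ring.
Qed.

End directed_flow.

Section band.
Context {R : realType} {Om : pseudoPMetricType R} (sig : R -> Om -> Om).
Hypothesis cOm : compact [set: Om].
Hypothesis flow : is_flow sig.
Implicit Types (b : Om -> R) (w : Om) (t : R).
Variables (h hx : Om -> R -> R).
Hypothesis ch : continuous (fun p : Om * R => h p.1 p.2).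
Hypothesis chx : continuous (fun p : Om * R => hx p.1 p.2).
Hypothesis dhx : forall w (x : R), is_derive x 1 (h w) (hx w x).

Definition ae_concave (lo s : Om -> R) :=
  forall m : probability (@borelOm R Om) R, ergodic_meas sig m ->
  full_meas m [set w | concave_on (hx w) [set z | lo w <= z <= s w]].

Definition lev (l : R) w x : R := h w x + l.

Lemma lev_continuous l : continuous (fun p : Om * R => lev l p.1 p.2).
Proof. by move=> p; apply: cvgD; [exact: ch|exact: cvg_cst]. Qed.

Lemma lev_derive l w (x : R) : is_derive x 1 (lev l w) (hx w x).
Proof. by apply: (isD_eq (isD_add (dhx w x) (isD_cst l x))); rewrite addr0. Qed.

Definition strict_upper l (u u' : Om -> R) := [/\ continuous u, continuous u',
  orbit_der sig u u' & forall w, lev l w (u w) < u' w].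

Definition strict_lower l (s s' : Om -> R) := [/\ continuous s, continuous s',
  orbit_der sig s s' & forall w, s' w < lev l w (s w)].

Section directed.
Variables (sg l : R) (p p' s s' lo b1 b2 : Om -> R).
Hypothesis hsg : sg = 1 \/ sg = -1.
Hypotheses (cp : continuous p) (cp' : continuous p') (dp : orbit_der sig p p').
Hypothesis up : forall w, lev l w (p w) <= p' w.
Hypothesis ls : strict_lower l s s'.
Hypothesis conc : ae_concave lo s.
Hypotheses (cb1 : continuous b1) (cb2 : continuous b2) (b12 : forall w, b1 w <= b2 w).
Hypothesis off_p : forall w x, b1 w <= x <= b2 w -> 0 < sg * (x - p w).
Hypotheses (b2s : forall w, b2 w < s w) (ps : forall w, p w < s w).
Hypotheses (lop : forall w, lo w <= p w) (lob : forall w, lo w <= b1 w).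

Let T := dir_flow sig sg.

Lemma band_contraction : exists C0 k be : R, [/\ 0 < C0, 0 < k, 0 < be,
  forall w (x y : R -> R) (k1 k2 : R),
    (forall t, is_derive t 1 x (- sg * lev l (T t w) (x t) + k1)) ->
    (forall t, is_derive t 1 y (- sg * lev l (T t w) (y t) + k2)) ->
    (forall t, b1 (T t w) <= x t <= b2 (T t w)) ->
    (forall t, b1 (T t w) <= y t <= b2 (T t w)) ->
    (forall t, x t <= y t) -> forall t, y t - x t <= C0 * (`|k1| + `|k2|) &
  forall w (x z : R -> R),
    (forall t, is_derive t 1 x (- sg * lev l (T t w) (x t))) ->
    (forall t, b1 (T t w) <= x t <= b2 (T t w)) ->
    (forall t, is_derive t 1 z (- sg * hx (T t w) (x t) * z t)) ->
    forall t, 0 <= t -> `|z t| <= k * expR (- (be * t)) * `|z 0|].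
Proof.
have [cs cs' ds slow] := ls.
have cB (u v : Om -> R) : continuous u -> continuous v -> continuous (fun w => u w - v w).
  by move=> cu cv w; apply: cvgB; [exact: cu|exact: cv].
have [||m1 m10 H1] := @compact_lower_bound R Om (fun w => sg * (b1 w - p w)) setT cOm.
- by apply: continuous_fun_scale; exact: cB.
- by move=> w _; apply: off_p; rewrite lexx b12.
have [||m2 m20 H2] := @compact_lower_bound R Om (fun w => sg * (b2 w - p w)) setT cOm.
- by apply: continuous_fun_scale; exact: cB.
- by move=> w _; apply: off_p; rewrite lexx b12.
have [|m3 m30 H3] := @compact_lower_bound R Om (fun w => s w - b2 w) setT cOm (cB _ _ cs cb2).
  by move=> w _; rewrite subr_gt0.
have [|m4 m40 H4] := @compact_lower_bound R Om (fun w => s w - p w) setT cOm (cB _ _ cs cp).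
  by move=> w _; rewrite subr_gt0.
have [||e0 e00 He] := @compact_lower_bound R Om (fun w => lev l w (s w) - s' w) setT cOm.
- apply: cB => // w; apply: (@continuous_at2 _ _ _ _ (fun p : Om * R => lev l p.1 p.2) id s).
  + exact: lev_continuous.
  + by [].
  + exact: cs.
- by move=> w _; rewrite subr_gt0.
pose dl := Num.min (Num.min m1 m2) (Num.min m3 m4).
have dl0 : 0 < dl by rewrite !lt_min m10 m20 m30 m40.
have dl1 : dl <= m1 by rewrite !ge_min lexx.
have dl2 : dl <= m2 by rewrite !ge_min lexx orbT.
have dl3 : dl <= m3 by rewrite !ge_min lexx !orbT.
have dl4 : dl <= m4 by rewrite !ge_min lexx !orbT.
have [M1 M10 HM1] := compact_norm_bound cOm cb1.
have [M2 M20 HM2] := compact_norm_bound cOm cb2.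
have [M3 M30 HM3] := compact_norm_bound cOm cs.
have [M4 M40 HM4] := compact_norm_bound cOm cp.
pose Dm := M1 + M2 + M3 + M4.
have margin w x : b1 w <= x <= b2 w ->
  [/\ dl <= sg * (x - p w) <= Dm, dl <= s w - x <= Dm & dl <= s w - p w <= Dm].
  move=> /andP[x1 x2].
  have := H1 w I; have := H2 w I; have := H3 w I; have := H4 w I => k4 k3 k2 k1.
  have := HM1 w I; have := HM2 w I; have := HM3 w I; have := HM4 w I.
  rewrite !ler_norml => /andP[? ?] /andP[? ?] /andP[? ?] /andP[? ?].
  rewrite /Dm; split; apply/andP; split; try lra.
    by case: hsg k1 k2 => ->; lra.
  by case: hsg k1 k2 => ->; lra.
have Dm0 : 0 < Dm by rewrite /Dm !addr_gt0.
have margin' w x : b1 w <= x <= b2 w ->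
  [/\ dl <= sg * (x - p w) <= Dm, dl <= s w - x <= Dm & dl <= s w - p w].
  by move=> /margin[? ? /andP[? _]].
pose X (q : Om * R) := b1 q.1 + clamp01 q.2 * (b2 q.1 - b1 q.1).
have XP q : b1 q.1 <= X q <= b2 q.1.
  have /andP[c0 c1] := clamp01_bound q.2; have := b12 q.1.
  rewrite /X lerDl mulr_ge0 ?subr_ge0//= -lerBrDl => ?.
  by rewrite ler_piMl// subr_ge0.
pose Q (q : Om * R) := - sg * cross_rate (lev l) hx p p' s s' q.1 (X q).
have cfst b : continuous b -> continuous (fun q : Om * R => b q.1).
  by move=> cb q; apply: (@continuous_comp _ _ _ fst b); [exact: cvg_fst|exact: cb].
have cX : continuous X.
  move=> q; apply: cvgD; first exact: cfst.
  apply: cvgM; last by apply: cvgB; exact: cfst.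
  apply: (@continuous_comp _ _ _ snd (@clamp01 R)); first exact: cvg_snd.
  by apply: (@clamp01_continuous R R id) => x; exact: cvg_id.
have cH2 (H : Om -> R -> R) : continuous (fun q : Om * R => H q.1 q.2) ->
    continuous (fun q : Om * R => H q.1 (X q)).
  move=> cH q; apply: (@continuous_at2 _ _ _ _ (fun p : Om * R => H p.1 p.2) fst X).
  - exact: cH.
  - exact: cvg_fst.
  - exact: cX.
have cQ : continuous Q.
  move=> q; have [/andP[n1 _] /andP[n2 _] /andP[n3 _]] := margin _ _ (XP q).
  apply: cvgM; first exact: cvg_cst.
  apply: cvgB; first apply: cvgB; first apply: cvgD; first exact: cH2.
  - apply: cvgM; first by apply: cvgB; exact: cfst.
    apply: cvgV; first by rewrite gt_eqF// (lt_le_trans dl0).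
    by apply: cvgB; exact: cfst.
  - apply: cvgM; first by apply: cvgB; [apply: (cH2 _ (@lev_continuous l))|exact: cfst].
    apply: cvgV; last by apply: cvgB; [exact: cX|exact: cfst].
    by apply/eqP => E; move: n1; rewrite E mulr0 leNgt dl0.
  - apply: cvgM; first by apply: cvgB; [exact: cfst|apply: (cH2 _ (@lev_continuous l))].
    apply: cvgV; first by rewrite gt_eqF// (lt_le_trans dl0).
    by apply: cvgB; [exact: cfst|exact: cX].
pose K := `[(0 : R), 1]%classic.
have cK : compact K by exact: segment_compact.
have K0 : K !=set0 by exists 0; rewrite /K /= in_itv /= lexx ler01.
pose psi := sup_over Q K.
have cpsi : continuous psi by exact: sup_over_continuous.
pose e1 := e0 * dl / (Dm * Dm).
have e10 : 0 < e1 by rewrite divr_gt0// mulr_gt0.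
have rate w x : b1 w <= x <= b2 w -> - sg * cross_rate (lev l) hx p p' s s' w x <= psi w.
  move=> /clamp01_onto[tau Kt Et].
  by have := sup_over_ub cK K0 cQ w Kt; rewrite /Q /X /= Et.
have [|V [V' coh]] := @ergodic_cohomologous R Om sig cOm flow psi e1 cpsi e10.
  move=> m /conc[A [mA Ac mA1]]; exists A; split=> // w /Ac cw /=.
  have [tau Kt [E _]] := sup_over_attained cK K0 cQ w; rewrite /psi E.
  rewrite /Q /= mulNr lerN2; have [/andP[g1 _] g2 g3] := margin _ _ (XP (w, tau)).
  apply: (@cross_rate_bound R (lev l w) (hx w) (lo w)) => //; first exact: ltW.
  - by apply: le_trans (lob w) _; have /andP[] := XP (w, tau).
  - exact: lev_derive.
  - by have := He w I; lra.
have [cV _ _ e20 _] := coh.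
have [D D0 HD] := compact_norm_bound cOm cV.
have HD' w : `|- sg * V w| <= D.
  by have := HD w I; case: hsg => ->; rewrite ?opprK ?mul1r ?mulN1r ?normrN.
have coh' := dir_flow_cohomologous hsg coh.
have sg2 : sg * sg = 1 by case: hsg => ->; ring.
have fT := dir_flow_flow flow sg.
have dpT := @dir_flow_orbit_der R Om sig sg _ _ dp.
have dsT := @dir_flow_orbit_der R Om sig sg _ _ ds.
exists ((2 / dl) * expR (2 * D) / (e1 / 2) / (dl / (Dm * Dm))),
  ((2 / dl) / (dl / (Dm * Dm)) * expR (2 * D)), (e1 / 2).
have Dd0 : 0 < dl / (Dm * Dm) by rewrite divr_gt0// mulr_gt0.
have tw0 : 0 < 2 / dl by rewrite divr_gt0.
have ex0 := expR_gt0 (2 * D).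
split=> //.
- by apply: divr_gt0 => //; apply: divr_gt0 => //; exact: mulr_gt0.
- by apply: mulr_gt0 => //; exact: divr_gt0.
- move=> w x y k1 k2 dx dy rx ry xy t.
  apply: (@moebius_pair R Om T (lev l) hx (@lev_derive l) sg p p' s s' b1 b2 dl Dm sg2 dpT dsT dl0 margin'
    psi _ V' (e1 / 2) D coh' HD' rate w x y k1 k2 (M1 + M2)) => // u.
  have /andP[a1 _] := rx u; have /andP[_ a2] := ry u.
  have := HM1 (T u w) I; have := HM2 (T u w) I; rewrite !ler_norml => /andP[? ?] /andP[? ?]; lra.
- move=> w x z dx rx dz t t0.
  exact: (@moebius_decay R Om T fT (lev l) hx sg p p' s s' b1 b2 dl Dm sg2 dpT dsT dl0 margin'
    psi _ V' (e1 / 2) D coh' HD' rate w x z).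
Qed.

Variables (b1' b2' : Om -> R).
Hypotheses (db1 : orbit_der sig b1 b1') (db2 : orbit_der sig b2 b2').
Hypothesis enter1 : forall w, - sg * b1' w <= - sg * lev l w (b1 w).
Hypothesis enter2 : forall w, - sg * lev l w (b2 w) <= - sg * b2' w.

Lemma directed_equilibrium : exists e : Om -> R, [/\ continuous e, forall w, b1 w <= e w <= b2 w,
  orbit_der sig e (fun w => lev l w (e w)),
  forall w (x : R -> R), solution sig (lev l) w x ->
    (forall t, b1 (sig t w) <= x t <= b2 (sig t w)) -> forall t, x t = e (sig t w) &
  exists k be : R, [/\ 0 < k, 0 < be & forall w (z : R -> R),
    (forall t, is_derive t 1 z (hx (sig t w) (e (sig t w)) * z t)) ->
    forall t, 0 <= t -> `|z (- sg * t)| <= k * expR (- (be * t)) * `|z 0|]].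
Proof.
have [C0 [k [be [C00 k0 be0 pair decay]]]] := band_contraction.
have sg2 : - sg * - sg = 1 by case: hsg => ->; ring.
have fT : is_flow T := dir_flow_flow flow sg.
have TK t w : T (- sg * t) w = sig t w by rewrite /T /dir_flow mulrA sg2 mul1r.
pose g w x := - sg * lev l w x.
have cg : continuous (fun q : Om * R => g q.1 q.2).
  by move=> q; apply: cvgM; [exact: cvg_cst|exact: lev_continuous].
have cgx : continuous (fun q : Om * R => (fun w x => - sg * hx w x) q.1 q.2).
  by move=> q; apply: cvgM; [exact: cvg_cst|exact: chx].
have dgx w (x : R) : is_derive x 1 (g w) (- sg * hx w x).
  by apply: isD_scale; exact: lev_derive.
have pair0 w (x y : R -> R) : solution T g w x -> solution T g w y ->
    (forall t, b1 (T t w) <= x t <= b2 (T t w)) ->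
    (forall t, b1 (T t w) <= y t <= b2 (T t w)) ->
    (forall t, x t <= y t) -> forall t, y t <= x t.
  move=> sx sy rx ry xy t.
  have := pair w x y 0 0 _ _ rx ry xy t; rewrite normr0 addr0 mulr0 subr_le0.
  by apply => u; rewrite addr0; [exact: sx|exact: sy].
have [|e [ce re de]] := @unique_equilibrium R Om T cOm fT g _ cg cgx dgx b1 _ b2 _ cb1 cb2
    (@dir_flow_orbit_der R Om sig sg _ _ db1) (@dir_flow_orbit_der R Om sig sg _ _ db2) enter1 enter2 b12.
  move=> w x y sx sy rx ry xy; apply/eqP; rewrite eq_le xy/=; exact: (pair0 w).
have de' : orbit_der sig e (fun w => lev l w (e w)).
  move=> w t.
  have := @dir_flow_orbit_der R Om T sg e (fun w => g w (e w)) de w t.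
  apply: is_derive_ext => [u|]; first by rewrite /dir_flow TK.
  by rewrite /dir_flow TK /g mulrA sg2 mul1r.
have toT w x : solution sig (lev l) w x -> solution T g w (fun t => x (- sg * t)).
  move=> sx t; exact: (@dir_flow_der R sg x (fun t => lev l (sig t w) (x t))).
exists e; split=> //.
  move=> w x sx rx.
  have [N1 _ HN1] := compact_norm_bound cOm cb1.
  have [N2 _ HN2] := compact_norm_bound cOm cb2.
  pose N := N1 + N2.
  have inN v z : b1 v <= z <= b2 v -> `|z| <= N.
    move=> /andP[h1 h2]; have := HN1 v I; have := HN2 v I.
    rewrite !ler_norml => /andP[h5 h3] /andP[h4 h6].
    by rewrite /N; apply/andP; split; lra.
  have ord := @solution_ordered R Om sig cOm (lev l) hx chx (@lev_derive l) w.
  have rT (z : R -> R) : (forall t, b1 (sig t w) <= z t <= b2 (sig t w)) ->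
      forall t, b1 (T t w) <= z (- sg * t) <= b2 (T t w) by move=> H t; exact: H.
  have re' t : b1 (sig t w) <= e (sig t w) <= b2 (sig t w) by exact: re.
  have uu t : - sg * (- sg * t) = t by rewrite mulrA sg2 mul1r.
  move=> t; have [lt|gt|//] := ltgtP (x t) (e (sig t w)).
    have := ord x _ N sx (de' w) (fun u => inN _ _ (rx u)) (fun u => inN _ _ (re' u)).
    move=> /(_ (ex_intro _ t lt)) H.
    have := pair0 w _ _ (toT w _ sx) (toT w _ (de' w)) (rT _ rx) (rT _ re') (fun u => ltW (H _)) (- sg * t).
    by rewrite !uu leNgt lt.
  have := ord _ x N (de' w) sx (fun u => inN _ _ (re' u)) (fun u => inN _ _ (rx u)).
  move=> /(_ (ex_intro _ t gt)) H.
  have := pair0 w _ _ (toT w _ (de' w)) (toT w _ sx) (rT _ re') (rT _ rx) (fun u => ltW (H _)) (- sg * t).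
  by rewrite !uu leNgt gt.
exists k, be; split=> // w z dz t t0.
have := decay w (fun t => e (sig (- sg * t) w)) (fun t => z (- sg * t)) _ _ _ t t0.
rewrite mulr0; apply.
- exact: (toT w _ (de' w)).
- by move=> u; exact: re.
- move=> u; have := @dir_flow_der R sg z (fun t => hx (sig t w) (e (sig t w)) * z t) u (dz _).
  by rewrite mulrA.
Qed.

End directed.

Lemma strict_upper_margin l u u' : strict_upper l u u' ->
  exists dl eta : R, [/\ 0 < dl, 0 < eta &
    forall w x, `|x - u w| <= dl -> lev l w x <= u' w - eta].
Proof.
move=> [cu cu' du H].
have [||e e0 He] := @compact_lower_bound R Om (fun w => u' w - lev l w (u w)) setT cOm.
- move=> w; apply: cvgB; first exact: cu'.
  apply: (@continuous_at2 _ _ _ _ (fun p : Om * R => lev l p.1 p.2) id u).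
  + exact: lev_continuous.
  + by [].
  + exact: cu.
- by move=> w _; rewrite subr_gt0.
have [N N0 HN] := compact_norm_bound cOm cu.
have [M M0 HM] := field_lipschitz cOm chx (@lev_derive l) (N + 1).
have e20 : 0 < e / 2 by rewrite divr_gt0.
exists (Num.min 1 (e / 2 / M)), (e / 2); split=> //.
  by rewrite lt_min ltr01 divr_gt0.
move=> w x; rewrite le_min => /andP[x1 x2].
have uN := HN w I.
have xN : `|x| <= N + 1.
  have := ler_normD (u w) (x - u w); rewrite addrC subrK; lra.
have := HM w (u w) x; rewrite (le_trans uN) ?lerDl// => /(_ isT xN).
move: x2; rewrite ler_pdivlMr// [_ * M]mulrC => x2 /le_trans/(_ x2).
rewrite ler_norml => /andP[_ h2]; have := He w I; lra.
Qed.

Lemma strict_lower_margin l s s' : strict_lower l s s' ->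
  exists dl eta : R, [/\ 0 < dl, 0 < eta &
    forall w x, `|x - s w| <= dl -> s' w + eta <= lev l w x].
Proof.
move=> [cu cu' du H].
have [||e e0 He] := @compact_lower_bound R Om (fun w => lev l w (s w) - s' w) setT cOm.
- move=> w; apply: cvgB; last exact: cu'.
  apply: (@continuous_at2 _ _ _ _ (fun p : Om * R => lev l p.1 p.2) id s).
  + exact: lev_continuous.
  + by [].
  + exact: cu.
- by move=> w _; rewrite subr_gt0.
have [N N0 HN] := compact_norm_bound cOm cu.
have [M M0 HM] := field_lipschitz cOm chx (@lev_derive l) (N + 1).
have e20 : 0 < e / 2 by rewrite divr_gt0.
exists (Num.min 1 (e / 2 / M)), (e / 2); split=> //.
  by rewrite lt_min ltr01 divr_gt0.
move=> w x; rewrite le_min => /andP[x1 x2].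
have uN := HN w I.
have xN : `|x| <= N + 1.
  have := ler_normD (s w) (x - s w); rewrite addrC subrK; lra.
have := HM w (s w) x; rewrite (le_trans uN) ?lerDl// => /(_ isT xN).
move: x2; rewrite ler_pdivlMr// [_ * M]mulrC => x2 /le_trans/(_ x2).
rewrite ler_norml => /andP[h2 _]; have := He w I; lra.
Qed.

Lemma attracting_equilibrium l (lo lo' u u' s s' : Om -> R) :
  continuous lo -> orbit_der sig lo lo' -> (forall w, lo' w <= lev l w (lo w)) ->
  strict_upper l u u' -> strict_lower l s s' -> ae_concave lo s ->
  (forall w, lo w < u w) -> (forall w, u w < s w) ->
  exists a : Om -> R, [/\ continuous a, forall w, lo w <= a w < u w,
    orbit_der sig a (fun w => lev l w (a w)),
    forall w (x : R -> R), solution sig (lev l) w x ->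
      (forall t, lo (sig t w) <= x t <= u (sig t w)) -> forall t, x t = a (sig t w) &
    exists k be : R, [/\ 0 < k, 0 < be & forall w (z : R -> R),
      (forall t, is_derive t 1 z (hx (sig t w) (a (sig t w)) * z t)) ->
      forall t, 0 <= t -> `|z t| <= k * expR (- (be * t)) * `|z 0|]].
Proof.
move=> clo dlo lolow su sl conc lou us.
have [dl1 [eta [dl10 eta0 Hm]]] := strict_upper_margin su.
have [cu cu' du Hu] := su.
have [||m m0 Hmm] := @compact_lower_bound R Om (fun w => u w - lo w) setT cOm.
- by move=> w; apply: cvgB; [exact: cu|exact: clo].
- by move=> w _; rewrite subr_gt0.
pose dl := Num.min dl1 m.
have dl0 : 0 < dl by rewrite lt_min dl10 m0.
have dle1 : dl <= dl1 by rewrite ge_min lexx.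
have dle2 : dl <= m by rewrite ge_min lexx orbT.
pose b2 w := u w - dl.
have cb2 : continuous b2 by move=> w; apply: cvgB; [exact: cu|exact: cvg_cst].
have db2 : orbit_der sig b2 u'.
  by move=> w t; apply: (isD_eq (isD_sub (du w t) (isD_cst dl t))); rewrite subr0.
have b12 w : lo w <= b2 w by have := Hmm w I; rewrite /b2; lra.
have hsg : (-1 : R) = 1 \/ (-1 : R) = -1 by right.
have [||||a [ca ra da ua [k [be [k0 be0 dec]]]]] := @directed_equilibrium (-1) l u u' s s' lo lo b2 hsg
  cu cu' du (fun w => ltW (Hu w)) sl conc clo cb2 b12 _ _ us (fun w => ltW (lou w)) (fun w => lexx _)
  lo' u' dlo db2.
- by move=> w x /andP[_ xb]; rewrite mulN1r opprB; move: xb; rewrite /b2; lra.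
- by move=> w; rewrite /b2; have := us w; lra.
- by move=> w; rewrite opprK !mul1r.
- move=> w; rewrite opprK !mul1r; apply: le_trans (Hm w _ _) _; last by rewrite lerBlDr lerDl ltW.
  by rewrite /b2 addrAC subrr sub0r normrN gtr0_norm.
exists a; split=> //.
- by move=> w; have := ra w; rewrite /b2 => /andP[-> ?] /=; lra.
- move=> w x sx rx; apply: ua => // t; have /andP[-> xu] := rx t; rewrite /b2 /=.
  have : dl < u (sig t w) - x t.
    apply: (@barrier_rev R (fun t => u (sig t w) - x t) _ dl eta 0 eta0
      (fun t => isD_sub (du w t) (sx t))) => r.
      move=> hr; have /andP[_ xr] := rx r.
      have := Hm (sig r w) (x r); rewrite distrC ger0_norm ?subr_ge0// => /(_ (le_trans hr dle1)); lra.
    by rewrite subr_ge0; have /andP[] := rx r.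
  by lra.
- exists k, be; split=> // w z dz t t0; have := dec w z dz t t0.
  by rewrite opprK mul1r.
Qed.

Lemma repelling_equilibrium l (lo u u' s s' : Om -> R) :
  strict_upper l u u' -> strict_lower l s s' -> ae_concave lo s ->
  (forall w, lo w <= u w) -> (forall w, u w < s w) ->
  exists r : Om -> R, [/\ continuous r, forall w, u w < r w < s w,
    orbit_der sig r (fun w => lev l w (r w)),
    forall w (x : R -> R), solution sig (lev l) w x ->
      (forall t, u (sig t w) <= x t <= s (sig t w)) -> forall t, x t = r (sig t w) &
    exists k be : R, [/\ 0 < k, 0 < be & forall w (z : R -> R),
      (forall t, is_derive t 1 z (hx (sig t w) (r (sig t w)) * z t)) ->
      forall t, t <= 0 -> `|z t| <= k * expR (be * t) * `|z 0|]].
Proof.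
move=> su sl conc lou us.
have [dl1 [eta1 [dl10 eta10 Hm1]]] := strict_upper_margin su.
have [dl2 [eta2 [dl20 eta20 Hm2]]] := strict_lower_margin sl.
have [cu cu' du Hu] := su; have [cs cs' ds Hs] := sl.
have [||m m0 Hmm] := @compact_lower_bound R Om (fun w => s w - u w) setT cOm.
- by move=> w; apply: cvgB; [exact: cs|exact: cu].
- by move=> w _; rewrite subr_gt0.
pose dl := Num.min (Num.min dl1 dl2) (m / 2).
have dl0 : 0 < dl by rewrite !lt_min dl10 dl20 divr_gt0.
have dle1 : dl <= dl1 by rewrite !ge_min lexx.
have dle2 : dl <= dl2 by rewrite !ge_min lexx orbT.
have dle3 : dl <= m / 2 by rewrite !ge_min lexx !orbT.
pose b1 w := u w + dl; pose b2 w := s w - dl.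
have cb1 : continuous b1 by move=> w; apply: cvgD; [exact: cu|exact: cvg_cst].
have cb2 : continuous b2 by move=> w; apply: cvgB; [exact: cs|exact: cvg_cst].
have db1 : orbit_der sig b1 u'.
  by move=> w t; apply: (isD_eq (isD_add (du w t) (isD_cst dl t))); rewrite addr0.
have db2 : orbit_der sig b2 s'.
  by move=> w t; apply: (isD_eq (isD_sub (ds w t) (isD_cst dl t))); rewrite subr0.
have b12 w : b1 w <= b2 w by have := Hmm w I; rewrite /b1 /b2; lra.
have hsg : (1 : R) = 1 \/ (1 : R) = -1 by left.
have [|||||r [cr rr dr ur [k [be [k0 be0 dec]]]]] := @directed_equilibrium 1 l u u' s s' lo b1 b2 hsg
  cu cu' du (fun w => ltW (Hu w)) sl conc cb1 cb2 b12 _ _ us lou _ u' s' db1 db2.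
- by move=> w x /andP[xb _]; rewrite mul1r; move: xb; rewrite /b1; lra.
- by move=> w; rewrite /b2; lra.
- by move=> w; rewrite /b1; have := lou w; lra.
- move=> w; rewrite !mulN1r lerN2; apply: le_trans (Hm1 w _ _) _; last by rewrite lerBlDr lerDl ltW.
  by rewrite /b1 addrAC subrr add0r gtr0_norm.
- move=> w; rewrite !mulN1r lerN2; apply: le_trans (Hm2 w _ _); first by rewrite lerDl ltW.
  by rewrite /b2 addrAC subrr sub0r normrN gtr0_norm.
exists r; split=> //.
- by move=> w; have := rr w; rewrite /b1 /b2 => /andP[? ?]; apply/andP; split; lra.
- move=> w x sx rx; apply: ur => // t; rewrite /b1 /b2.
  have h1 : dl < x t - u (sig t w).
    apply: (@barrier R (fun t => x t - u (sig t w)) _ dl eta1 0 eta10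
      (fun t => isD_sub (sx t) (du w t))) => v.
      move=> hr; have /andP[xr _] := rx v.
      have := Hm1 (sig v w) (x v); rewrite ger0_norm ?subr_ge0// => /(_ (le_trans hr dle1)); lra.
    by rewrite subr_ge0; have /andP[] := rx v.
  have h2 : dl < s (sig t w) - x t.
    apply: (@barrier R (fun t => s (sig t w) - x t) _ dl eta2 0 eta20
      (fun t => isD_sub (ds w t) (sx t))) => v.
      move=> hr; have /andP[_ xr] := rx v.
      have := Hm2 (sig v w) (x v); rewrite distrC ger0_norm ?subr_ge0// => /(_ (le_trans hr dle2)); lra.
    by rewrite subr_ge0; have /andP[] := rx v.
  by apply/andP; split; lra.
- exists k, be; split=> // w z dz t t0; have := dec w z dz (- t); rewrite oppr_ge0 => /(_ t0).
  by rewrite mulN1r opprK mulrN opprK.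
Qed.

End band.

Lemma nondecreasing_left_limit {R : realType} (g : R -> R) (a b B : R) : a < b ->
  (forall x y, a < x -> x <= y -> y < b -> g x <= g y) ->
  (forall x, a < x < b -> g x <= B) ->
  exists L : R, [/\ g @ b^'- --> L, forall x, a < x < b -> g x <= L &
    forall B', (forall x, a < x < b -> g x <= B') -> L <= B'].
Proof.
move=> ab mono gB; pose E := [set g x | x in [set x | a < x < b]].
have mid : a < (a + b) / 2 < b by apply/andP; split; lra.
have E0 : E !=set0 by exists (g ((a + b) / 2)), ((a + b) / 2).
have ubE : ubound E B by move=> _ [x xab <-]; exact: gB.
have gL x : a < x < b -> g x <= sup E by move=> xab; apply: ub_le_sup; [exists B|exists x].
exists (sup E); split=> //; last first.
  by move=> B' gB'; apply: ge_sup => // _ [x xab <-]; exact: gB'.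
apply/cvgrPdist_lt => /= e e0.
have [_ [x1 /andP[ax1 x1b] <-] Hx1] := sup_adherent e0 (conj E0 (ex_intro _ B ubE)).
near=> x.
have x1x : x1 < x by near: x; exact: nbhs_left_gt.
have xb : x < b by near: x; exact: nbhs_left_lt.
have h1 := mono x1 x ax1 (ltW x1x) xb.
have h2 : g x <= sup E by apply: gL; rewrite xb (lt_trans ax1 x1x).
rewrite ltr_norml; apply/andP; split; lra.
Unshelve. all: end_near. Qed.

(** * The family of attractor-repeller pairs *)

Section bifurcation.
Context {R : realType} {Om : pseudoPMetricType R} (sig : R -> Om -> Om).
Hypothesis cOm : compact [set: Om].
Hypothesis flow : is_flow sig.
Implicit Types (b : Om -> R) (w v : Om) (t l : R).
Variables (h hx : Om -> R -> R).
Hypothesis ch : continuous (fun p : Om * R => h p.1 p.2).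
Hypothesis chx : continuous (fun p : Om * R => hx p.1 p.2).
Hypothesis dhx : forall w (x : R), is_derive x 1 (h w) (hx w x).

Let flow0 w : sig 0 w = w. Proof. by have [_ []] := flow. Qed.

Lemma lev_comp_continuous l b : continuous b -> continuous (fun w => lev h l w (b w)).
Proof.
move=> cb w; apply: (@continuous_at2 _ _ _ _ (fun p : Om * R => lev h l p.1 p.2) id b).
- exact: lev_continuous.
- by [].
- exact: cb.
Qed.

Lemma push_upper (N c W e dmax : R) : 0 < c -> 0 < e -> 0 < dmax -> 0 < W ->
  exists d eta : R, [/\ 0 < d, d <= dmax, 0 < eta &
  forall l (x z z' : Om -> R), continuous x -> orbit_der sig x (fun w => lev h l w (x w)) ->
    (forall w, `|x w| <= N) -> continuous z -> continuous z' -> orbit_der sig z z' ->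
    (forall w, c <= z w <= W) -> (forall w, (hx w (x w) + e) * z w <= z' w) ->
    strict_upper sig h (l + eta) (fun w => x w + d * z w) (fun w => lev h l w (x w) + d * z' w)].
Proof.
move=> c0 e0 dmax0 W0; have e20 : 0 < e / 2 by rewrite divr_gt0.
have [dl dl0 Hdl] := box_unif_continuous cOm N chx e20.
pose d := Num.min dmax (dl / (2 * W)).
have d0 : 0 < d by rewrite lt_min dmax0 divr_gt0// mulr_gt0.
have dW : d * W < dl.
  have : d * W <= dl / (2 * W) * W by rewrite ler_pM2r// ge_min lexx orbT.
  have -> : dl / (2 * W) * W = dl / 2 by field; rewrite gt_eqF.
  lra.
pose eta := d * c * e / 4.
have eta0 : 0 < eta by rewrite divr_gt0// !mulr_gt0.
exists d, eta; split=> //; first by rewrite ge_min lexx.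
move=> l x z z' cx dx xN cz cz' dz zb Hz; split.
- by apply: continuous_fun_add => //; exact: continuous_fun_scale.
- apply: continuous_fun_add; first exact: lev_comp_continuous.
  exact: continuous_fun_scale.
- by move=> w t; apply: isD_add (dx w t) (isD_scale d (dz w t)).
move=> w; have /andP[z1 z2] := zb w.
have z0 : 0 < z w by exact: lt_le_trans z1.
have dz0 : 0 < d * z w by rewrite mulr_gt0.
have lt : x w < x w + d * z w by rewrite ltrDl.
have [y /andP[y1 y2] E] := mvt lt (fun y _ => dhx w y).
have dzl : d * z w <= d * W by rewrite ler_pM2l.
have hy : `|hx w y - hx w (x w)| < e / 2.
  by apply: Hdl => //; rewrite gtr0_norm ?subr_gt0//; lra.
have hyle : hx w y <= hx w (x w) + e / 2 by move: hy; rewrite ltr_norml => /andP[_ ?]; lra.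
have Ez : h w (x w + d * z w) = h w (x w) + hx w y * (d * z w).
  by move: E; rewrite [x w + _]addrC addrK; lra.
rewrite /lev Ez.
have k1 : hx w y * (d * z w) <= (hx w (x w) + e / 2) * (d * z w) by rewrite ler_pM2r.
have k2 : d * ((hx w (x w) + e) * z w) <= d * z' w by rewrite ler_pM2l.
have k3 : d * c * e <= d * z w * e by rewrite ler_pM2r// ler_pM2l.
rewrite /eta; nra.
Qed.

Lemma limit_equilibrium (l2 xi N : R) (q : R -> Om -> R) (qX : Om -> R) : l2 < xi ->
  (forall l, l2 < l < xi -> orbit_der sig (q l) (fun w => lev h l w (q l w))) ->
  (forall l w, l2 < l < xi -> `|q l w| <= N) ->
  (forall w, (fun l => q l w) @ xi^'- --> qX w) ->
  orbit_der sig qX (fun w => lev h xi w (qX w)).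
Proof.
move=> l2xi dq qN cq w t0.
have [B B0 HB] := box_bound cOm N ch.
pose K := B + (`|l2| + `|xi|).
have K0 : 0 <= K by rewrite /K !addr_ge0// ltW.
have inI : \forall l \near xi^'-, l2 < l < xi.
  near=> l; apply/andP; split; near: l; [exact: nbhs_left_gt|exact: nbhs_left_lt].
have lK l : l2 < l < xi -> `|l| <= `|l2| + `|xi|.
  move=> /andP[? ?]; have := ler_norm xi; have := ler_norm (- l2); rewrite normrN => ? ?.
  have := normr_ge0 xi; have := normr_ge0 l2 => ? ?.
  by rewrite ler_norml; apply/andP; split; lra.
apply: (@derive_limit R R xi^'- _ (fun l t => q l (sig t w)) (fun l t => lev h l (sig t w) (q l (sig t w)))).
- by move=> t; exact: cq.
- apply: cvgD; last exact: cvg_at_left_filter cvg_id.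
  apply: (@cvg_comp _ _ _ (fun l => q l (sig t0 w)) (h (sig t0 w))); first exact: cq.
  exact: is_derive_cont (dhx (sig t0 w) _).
- by near=> l => t; apply: dq; near: l.
move=> e e0; have [dl dl0 Hdl] := field_equicontinuous cOm flow ch chx dhx w t0 N K0 e0.
exists dl => //; near=> l => t tdl.
have Il : l2 < l < xi by near: l.
have -> : lev h l (sig t w) (q l (sig t w)) - lev h l (sig t0 w) (q l (sig t0 w)) =
  h (sig t w) (q l (sig t w)) - h (sig t0 w) (q l (sig t0 w)) by rewrite /lev; ring.
apply: Hdl => //; [exact: qN|exact: qN|].
apply: (@derive_bound R (fun t => q l (sig t w)) _ _ _ _ (dq l Il w)) => r.
rewrite /lev /K; apply: le_trans (ler_normD _ _) _; apply: lerD; last exact: lK.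
by apply: HB; exact: qN.
Unshelve. all: end_near. Qed.

Section family.
Variables (l2 : R) (lo s s' u2 u2' : Om -> R).
Hypotheses (clo : continuous lo) (dlo : orbit_der sig lo (fun w => lev h l2 w (lo w))).
Hypothesis sl2 : strict_lower sig h l2 s s'.
Hypothesis conc : ae_concave sig hx lo s.
Hypothesis su2 : strict_upper sig h l2 u2 u2'.
Hypothesis lou2 : forall w, lo w < u2 w < s w.

Definition upper_at l := exists u u', strict_upper sig h l u u' /\ forall w, lo w < u w < s w.

Let sl l : l2 <= l -> strict_lower sig h l s s'.
Proof.
move=> l2l; have [cs cs' ds H] := sl2; split=> // w.
by apply: lt_le_trans (H w) _; rewrite /lev lerD2l.
Qed.

Let cs : continuous s. Proof. by have [] := sl2. Qed.

Lemma upper_at_down l l' : l' <= l -> upper_at l -> upper_at l'.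
Proof.
move=> ll' [u [u' [[cu cu' du H] b]]]; exists u, u'; split=> //; split=> // w.
by apply: le_lt_trans (H w); rewrite /lev lerD2l.
Qed.

Lemma upper_at_open l : upper_at l -> exists2 eta, 0 < eta & upper_at (l + eta).
Proof.
move=> [u [u' [su b]]]; have [dl [eta [dl0 eta0 Hm]]] := strict_upper_margin cOm ch chx dhx su.
exists (eta / 2); first by rewrite divr_gt0.
have [cu cu' du H] := su; exists u, u'; split=> //; split=> // w.
have := Hm w (u w); rewrite subrr normr0 => /(_ (ltW dl0)); rewrite /lev; lra.
Qed.

Let bnd : exists2 N : R, 0 < N & forall w x, lo w <= x <= s w -> `|x| <= N.
Proof.
have [N1 N10 HN1] := compact_norm_bound cOm clo.
have [N2 N20 HN2] := compact_norm_bound cOm cs.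
exists (N1 + N2); first exact: addr_gt0.
move=> w x /andP[h1 h2]; have := HN1 w I; have := HN2 w I.
by rewrite !ler_norml => /andP[? ?] /andP[? ?]; apply/andP; split; lra.
Qed.

Lemma upper_at_bounded : exists B : R, forall l, upper_at l -> l <= B.
Proof.
have [N N0 HN] := bnd; have [B B0 HB] := box_bound cOm N ch.
exists B => l [u [u' [[cu cu' du H] b]]]; rewrite leNgt; apply/negP => Bl.
have uN w : `|u w| <= N by apply: (HN w); have /andP[? ?] := b w; rewrite !ltW.
have c0 : 0 < l - B by rewrite subr_gt0.
have u'c w : l - B <= u' w.
  apply: le_trans (ltW (H w)); have := HB w _ (uN w); rewrite ler_norml /lev => /andP[? _]; lra.
pose T := (2 * N + 1) / (l - B).
have T0 : 0 < T by rewrite divr_gt0//; lra.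
have [r _ E] := @mvt R (fun t => u (sig t point)) _ 0 T T0 (fun t _ => du point t).
have : (l - B) * T <= u' (sig r point) * T by rewrite ler_pM2r.
have -> : (l - B) * T = 2 * N + 1 by rewrite /T; field; rewrite gt_eqF.
move: E; rewrite subr0 => <-.
have := uN (sig T point); have := uN (sig 0 point).
by rewrite !ler_norml => /andP[? ?] /andP[? ?]; lra.
Qed.

Definition ar_pair l (a r : Om -> R) :=
  [/\ [/\ continuous a, continuous r, orbit_der sig a (fun w => lev h l w (a w)) &
        orbit_der sig r (fun w => lev h l w (r w))],
      forall w, [/\ lo w <= a w, a w < r w & r w < s w],
      forall w (x : R -> R), solution sig (lev h l) w x ->
        (forall t, lo (sig t w) <= x t <= s (sig t w)) ->
        forall t, a (sig t w) <= x t <= r (sig t w),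
      exists k be : R, [/\ 0 < k, 0 < be & forall w (z : R -> R),
        (forall t, is_derive t 1 z (hx (sig t w) (a (sig t w)) * z t)) ->
        forall t, 0 <= t -> `|z t| <= k * expR (- (be * t)) * `|z 0|] &
      exists k be : R, [/\ 0 < k, 0 < be & forall w (z : R -> R),
        (forall t, is_derive t 1 z (hx (sig t w) (r (sig t w)) * z t)) ->
        forall t, t <= 0 -> `|z t| <= k * expR (be * t) * `|z 0|]].

Lemma upper_at_pair l : l2 <= l -> upper_at l -> exists a r, ar_pair l a r /\
  forall u u', strict_upper sig h l u u' -> (forall w, lo w < u w < s w) ->
    forall w, a w < u w < r w.
Proof.
move=> l2l [u [u' [su b]]].
have lolow w : lev h l2 w (lo w) <= lev h l w (lo w) by rewrite /lev lerD2l.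
have b1 w : lo w < u w by have /andP[] := b w.
have b2 w : u w < s w by have /andP[] := b w.
have [N N0 HN] := bnd.
have [a [ca ra da ua ha]] := attracting_equilibrium cOm flow ch chx dhx clo dlo lolow su (sl l2l) conc b1 b2.
have [r [cr rr dr ur hr]] := repelling_equilibrium cOm flow ch chx dhx su (sl l2l) conc (fun w => ltW (b1 w)) b2.
have ab w : lo w <= a w <= s w.
  by have /andP[-> h1] := ra w; rewrite (le_trans (ltW h1) (ltW (b2 w))).
have rb w : lo w <= r w <= s w.
  by have /andP[h1 /ltW ->] := rr w; rewrite (le_trans (ltW (b1 w)) (ltW h1)).
have ext w x : solution sig (lev h l) w x -> (forall t, lo (sig t w) <= x t <= s (sig t w)) ->
    forall t, a (sig t w) <= x t <= r (sig t w).
  move=> sx rx t.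
  have ord := @solution_ordered R Om sig cOm (lev h l) hx chx (lev_derive dhx l) w.
  apply/andP; split; rewrite leNgt; apply/negP => lt.
    have H := ord x _ N sx (da w) (fun u => HN _ _ (rx u)) (fun u => HN _ _ (ab _)) (ex_intro _ t lt).
    have := ua w x sx _ t; move=> E; move: lt; rewrite E ?ltxx// => v.
    have /andP[-> _] := rx v; rewrite (le_trans (ltW (H v)))//.
    by have /andP[_ /ltW] := ra (sig v w).
  have H := ord _ x N (dr w) sx (fun u => HN _ _ (rb _)) (fun u => HN _ _ (rx u)) (ex_intro _ t lt).
  have := ur w x sx _ t; move=> E; move: lt; rewrite E ?ltxx// => v.
  have /andP[_ ->] := rx v; rewrite (le_trans _ (ltW (H v)))//.
  by have /andP[/ltW] := rr (sig v w).
exists a, r; split.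
  split=> // w; split; first by have /andP[] := ra w.
    by have /andP[_ h1] := ra w; have /andP[h2 _] := rr w; exact: lt_trans h1 h2.
  by have /andP[] := rr w.
move=> v v' sv vb.
have v1 w : lo w < v w by have /andP[] := vb w.
have v2 w : v w < s w by have /andP[] := vb w.
have [a1 [ca1 ra1 da1 ua1 ha1]] := attracting_equilibrium cOm flow ch chx dhx clo dlo lolow sv (sl l2l) conc v1 v2.
have [r1 [cr1 rr1 dr1 ur1 hr1]] := repelling_equilibrium cOm flow ch chx dhx sv (sl l2l) conc (fun w => ltW (v1 w)) v2.
move=> w; have := ext w _ (da1 w) _ 0; have := ext w _ (dr1 w) _ 0.
rewrite flow0 => /(_ _)/wrap[t|/andP[_ h1]].
  have /andP[h1 /ltW ->] := rr1 (sig t w); rewrite andbT.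
  by rewrite (le_trans (ltW (v1 _)) (ltW h1)).
move=> /(_ _)/wrap[t|/andP[h2 _]].
  have /andP[-> h2] := ra1 (sig t w); exact: le_trans (ltW h2) (ltW (v2 _)).
have /andP[_ h3] := ra1 w; have /andP[h4 _] := rr1 w.
by rewrite (le_lt_trans h2 h3) (lt_le_trans h4 h1).
Qed.

End family.
End bifurcation.

Section saddle_node.
Context {R : realType} {Om : pseudoPMetricType R} (sig : R -> Om -> Om).
Hypothesis cOm : compact [set: Om].
Hypothesis flow : is_flow sig.
Implicit Types (b : Om -> R) (w v : Om) (t l : R).
Variables (h hx : Om -> R -> R).
Hypothesis ch : continuous (fun p : Om * R => h p.1 p.2).
Hypothesis chx : continuous (fun p : Om * R => hx p.1 p.2).
Hypothesis dhx : forall w (x : R), is_derive x 1 (h w) (hx w x).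
Variables (l2 : R) (lo s s' : Om -> R).
Hypothesis clo : continuous lo.
Hypothesis sl2 : strict_lower sig h l2 s s'.
Hypothesis conc : ae_concave sig hx lo s.

Let flow0 w : sig 0 w = w. Proof. by have [_ []] := flow. Qed.
Let cs : continuous s. Proof. by have [] := sl2. Qed.
Let cs' : continuous s'. Proof. by have [] := sl2. Qed.
Let ds : orbit_der sig s s'. Proof. by have [] := sl2. Qed.

(* The new upper solution is [a + d * z] with [z = exp V * (r - a) * (s - a) / (s - r)]: the
   four-point inequality at [(r, a, s)] makes [z] grow faster than the linearization at [a]. *)
Lemma separated_push (e m : R) : 0 < e -> 0 < m -> (forall w, lo w + e + m <= s w) ->
  exists2 eta : R, 0 < eta & forall l (a r : Om -> R), l2 <= l -> continuous a -> continuous r ->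
    orbit_der sig a (fun w => lev h l w (a w)) -> orbit_der sig r (fun w => lev h l w (r w)) ->
    (forall w, [/\ lo w <= a w, a w + e <= r w & r w + m <= s w]) ->
    upper_at sig h lo s (l + eta).
Proof.
move=> e0 m0 los.
have [N1 N10 HN1] := compact_norm_bound cOm clo.
have [N2 N20 HN2] := compact_norm_bound cOm cs.
pose N := N1 + N2; pose Dm := N1 + N2.
have Dm0 : 0 < Dm by exact: addr_gt0.
have sD w : s w - lo w <= Dm.
  by have := HN1 w I; have := HN2 w I; rewrite !ler_norml /Dm => /andP[? ?] /andP[? ?]; lra.
have [||e2 e20 He2] := @compact_lower_bound R Om (fun w => lev h l2 w (s w) - s' w) setT cOm.
- by move=> w; apply: cvgB; [exact: lev_comp_continuous|exact: cs'].
- by move=> w _; rewrite subr_gt0; have [_ _ _] := sl2; exact.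
pose dl := Num.min e m.
have dl0 : 0 < dl by rewrite lt_min e0 m0.
have dle : dl <= e by rewrite ge_min lexx.
have dlm : dl <= m by rewrite ge_min lexx orbT.
pose X (q : Om * (R * R)) := lo q.1 + clamp01 q.2.1 * (s q.1 - m - e - lo q.1).
pose P (q : Om * (R * R)) := X q + e + clamp01 q.2.2 * (s q.1 - m - (X q + e)).
have XP q : lo q.1 <= X q <= s q.1 - m - e.
  have /andP[c0 c1] := clamp01_bound q.2.1; have := los q.1 => ?; rewrite /X.
  have k : 0 <= s q.1 - m - e - lo q.1 by lra.
  have := ler_piMl k c1; have := mulr_ge0 c0 k => ? ?; apply/andP; split; lra.
have PP q : X q + e <= P q <= s q.1 - m.
  have /andP[c0 c1] := clamp01_bound q.2.2; have /andP[_ xx] := XP q; rewrite /P.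
  have k : 0 <= s q.1 - m - (X q + e) by lra.
  have := ler_piMl k c1; have := mulr_ge0 c0 k => ? ?; apply/andP; split; lra.
pose rate w (x p : R) := hx w x + (s' w - lev h l2 w p) / (s w - p)
   - (lev h l2 w x - lev h l2 w p) / (x - p) - (s' w - lev h l2 w x) / (s w - x).
pose Q (q : Om * (R * R)) := rate q.1 (X q) (P q).
have cfst b : continuous b -> continuous (fun q : Om * (R * R) => b q.1).
  by move=> cb q; apply: (@continuous_comp _ _ _ fst b); [exact: cvg_fst|exact: cb].
have cB (u v : Om * (R * R) -> R) : continuous u -> continuous v -> continuous (fun q => u q - v q).
  by move=> cu cv q; apply: cvgB; [exact: cu|exact: cv].
have cD (u v : Om * (R * R) -> R) : continuous u -> continuous v -> continuous (fun q => u q + v q).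
  by move=> cu cv q; apply: cvgD; [exact: cu|exact: cv].
have cM (u v : Om * (R * R) -> R) : continuous u -> continuous v -> continuous (fun q => u q * v q).
  by move=> cu cv q; apply: cvgM; [exact: cu|exact: cv].
have cV (u v : Om * (R * R) -> R) : continuous u -> continuous v -> (forall q, v q != 0) ->
    continuous (fun q => u q / v q).
  by move=> cu cv v0 q; apply: cvgM; [exact: cu|apply: cvgV; [exact: v0|exact: cv]].
have ccst (k : R) : continuous (fun _ : Om * (R * R) => k) by move=> q; exact: cvg_cst.
have cc1 : continuous (fun q : Om * (R * R) => clamp01 q.2.1).
  apply: (@clamp01_continuous R _ (fun q : Om * (R * R) => q.2.1)) => q.
  by apply: (@continuous_comp _ _ _ snd fst); [exact: cvg_snd|exact: cvg_fst].
have cc2 : continuous (fun q : Om * (R * R) => clamp01 q.2.2).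
  apply: (@clamp01_continuous R _ (fun q : Om * (R * R) => q.2.2)) => q.
  by apply: (@continuous_comp _ _ _ snd snd); [exact: cvg_snd|exact: cvg_snd].
have cX : continuous X.
  apply: (cD); first exact: cfst.
  apply: (cM) => //; apply: (cB _ _ _ (cfst _ clo)); apply: (cB _ _ _ (ccst e)).
  by apply: (cB _ _ _ (ccst m)); exact: cfst.
have cP : continuous P.
  apply: (cD); first by apply: (cD).
  apply: (cM) => //; apply: (cB); first by apply: (cB) => //; exact: cfst.
  by apply: (cD).
have cH2 (H : Om -> R -> R) (Y : Om * (R * R) -> R) : continuous (fun q : Om * R => H q.1 q.2) ->
    continuous Y -> continuous (fun q : Om * (R * R) => H q.1 (Y q)).
  move=> cH cY q; apply: (@continuous_at2 _ _ _ _ (fun p : Om * R => H p.1 p.2) fst Y).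
  - exact: cH.
  - exact: cvg_fst.
  - exact: cY.
have cL := @lev_continuous R Om h ch l2.
have cQ : continuous Q.
  apply: (cB); first apply: (cB); first apply: (cD).
  - exact: (cH2).
  - apply: (cV) => [||q]; [by apply: (cB); [exact: cfst|exact: (cH2)]|by apply: (cB) => //; exact: cfst|].
    by have /andP[_ ?] := PP q; rewrite gt_eqF//; lra.
  - apply: (cV) => [||q]; [by apply: (cB); exact: (cH2)|exact: (cB)|].
    by have /andP[? _] := PP q; rewrite lt_eqF//; lra.
  - apply: (cV) => [||q]; [by apply: (cB); [exact: cfst|exact: (cH2)]|by apply: (cB) => //; exact: cfst|].
    by have /andP[_ ?] := XP q; rewrite gt_eqF//; lra.
pose J := `[(0 : R), 1]%classic; pose K := J `*` J.
have cK : compact K by apply: compact_setX; exact: segment_compact.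
have K0 : K !=set0 by exists (0, 0); split; rewrite /J /= in_itv /= lexx ler01.
pose psi := sup_over Q K.
have cpsi : continuous psi by exact: sup_over_continuous.
pose e1 := e2 * dl / (Dm * Dm).
have e10 : 0 < e1 by rewrite divr_gt0// mulr_gt0.
have ratele w x p : lo w <= x -> x + e <= p -> p <= s w - m -> rate w x p <= psi w.
  move=> k1 k2 k3.
  have [|tx Kx Ex] := @clamp01_onto R (lo w) (s w - m - e) x; first by rewrite k1/=; lra.
  have [|tp Kp Ep] := @clamp01_onto R (x + e) (s w - m) p; first by rewrite k2.
  have : Q (w, (tx, tp)) <= psi w by apply: (sup_over_ub cK K0 cQ w); split.
  by rewrite /Q /P /X /= Ex Ep.
have [|V [V' coh]] := @ergodic_cohomologous R Om sig cOm flow psi e1 cpsi e10.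
  move=> mu /conc[A [mA Ac mA1]]; exists A; split=> // w /Ac cw /=.
  have [tau Kt [E _]] := sup_over_attained cK K0 cQ w; rewrite /psi E -lerN2 opprK.
  have /andP[x1 x2] := XP (w, tau); have /andP[p1 p2] := PP (w, tau); have := sD w.
  move: x1 x2 p1 p2; rewrite /Q /=; set x := X _; set p := P _ => x1 x2 p1 p2 sDw.
  rewrite /rate -mulN1r; apply: (@cross_rate_bound R (lev h l2 w) (hx w) (lo w)) => //.
  - by right.
  - exact: ltW.
  - by lra.
  - by lra.
  - by apply/andP; split; lra.
  - by apply/andP; split; lra.
  - exact: lev_derive.
  - by have := He2 w I; lra.
have [cVV cV' dV e30 HV] := coh.
have [D D0 HD] := compact_norm_bound cOm cVV.
pose c := expR (- D) * e; pose W := expR D * (Dm * Dm / m).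
have c0 : 0 < c by rewrite mulr_gt0 ?expR_gt0.
have W0 : 0 < W by rewrite mulr_gt0 ?expR_gt0// divr_gt0// mulr_gt0.
have dm0 : 0 < e / (2 * W) by rewrite divr_gt0// mulr_gt0.
have [d [eta [d0 dd eta0 H]]] := push_upper sig cOm ch chx dhx N c0 e30 dm0 W0.
exists eta => // l a r l2l ca cr da dr bnd.
pose z w := expR (V w) * ((r w - a w) * (s w - a w) / (s w - r w)).
pose ra w := lev h l w (r w); pose aa w := lev h l w (a w).
pose rho w := V' w + (ra w - aa w) / (r w - a w) + (s' w - aa w) / (s w - a w) - (s' w - ra w) / (s w - r w).
have n1 w : 0 < r w - a w by have [_ ? _] := bnd w; lra.
have n2 w : 0 < s w - a w by have [_ ? ?] := bnd w; lra.
have n3 w : 0 < s w - r w by have [_ _ ?] := bnd w; lra.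
have sub (u v : Om -> R) : continuous u -> continuous v -> continuous (fun w => u w - v w).
  by move=> cu cv w; apply: cvgB; [exact: cu|exact: cv].
have dvd (u v : Om -> R) : continuous u -> continuous v -> (forall w, 0 < v w) ->
    continuous (fun w => u w / v w).
  by move=> cu cv v0 w; apply: cvgM; [exact: cu|apply: cvgV; [rewrite gt_eqF|exact: cv]].
have cra : continuous ra by exact: lev_comp_continuous.
have caa : continuous aa by exact: lev_comp_continuous.
have cz : continuous z.
  move=> w; apply: cvgM.
    by apply: (@continuous_comp _ _ _ V expR); [exact: cVV|exact: continuous_expR].
  apply: (dvd) => // [v|]; last exact: (sub).
  by apply: cvgM; apply: (sub).
have crho : continuous rho.
  move=> w; apply: cvgB; last by apply: (dvd) => //; exact: (sub).
  apply: cvgD; last by apply: (dvd) => //; exact: (sub).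
  by apply: cvgD; [exact: cV'|by apply: (dvd) => //; exact: (sub)].
have z0 w : 0 < z w by rewrite mulr_gt0 ?expR_gt0// divr_gt0// mulr_gt0.
have cz' : continuous (fun w => z w * rho w) by move=> w; apply: cvgM; [exact: cz|exact: crho].
have dz : orbit_der sig z (fun w => z w * rho w).
  move=> w t.
  have k1 := isD_exp (dV w t).
  have k2 := isD_mul (isD_sub (dr w t) (da w t)) (isD_sub (ds w t) (da w t)).
  have k3 : s (sig t w) - r (sig t w) != 0 by rewrite gt_eqF.
  have k4 := @isD_div R _ (fun t => s (sig t w) - r (sig t w)) _ _ t k3 k2 (isD_sub (ds w t) (dr w t)).
  apply: (isD_eq (isD_mul k1 k4)).
  rewrite /z /rho /ra /aa; field; rewrite k3 !gt_eqF//.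
have zb w : c <= z w <= W.
  have := HD w I; rewrite ler_norml => /andP[v1 v2].
  have [b1 b2 b3] := bnd w; have sDw := sD w.
  apply/andP; split; apply: ler_pM; rewrite ?expR_ge0 ?(ltW e0) ?ler_expR//.
    rewrite -mulrA; apply: le_trans (_ : r w - a w <= _); first by lra.
    by rewrite ler_pMr// ler_pdivlMr// mul1r; have := n1 w; lra.
  - by rewrite divr_ge0 ?mulr_ge0// ltW.
  - apply: ler_pM; rewrite ?invr_ge0 ?mulr_ge0 ?(ltW (n1 _)) ?(ltW (n2 _)) ?(ltW (n3 _))//.
      by apply: ler_pM; rewrite ?(ltW (n1 _)) ?(ltW (n2 _))//; have := n3 w; have := n1 w; lra.
    by rewrite lef_pV2 ?posrE//; lra.
have Hz w : (hx w (a w) + e1 / 2) * z w <= z w * rho w.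
  rewrite mulrC ler_pM2l//.
  have [b1 b2 b3] := bnd w.
  have := ratele w (a w) (r w) b1 b2; rewrite lerBrDr => /(_ b3); have := HV w.
  have q1 : (ra w - aa w) / (r w - a w) = (lev h l2 w (a w) - lev h l2 w (r w)) / (a w - r w).
    by rewrite /ra /aa /lev; field; rewrite -[a w - r w]opprB oppr_eq0 !gt_eqF.
  have q2 : (s' w - aa w) / (s w - a w) - (s' w - ra w) / (s w - r w) =
     (s' w - lev h l2 w (a w)) / (s w - a w) - (s' w - lev h l2 w (r w)) / (s w - r w)
     + (l - l2) * ((s w - r w)^-1 - (s w - a w)^-1).
    by rewrite /ra /aa /lev; field; rewrite !gt_eqF.
  have q3 : 0 <= (l - l2) * ((s w - r w)^-1 - (s w - a w)^-1).
    rewrite mulr_ge0 ?subr_ge0// lef_pV2 ?posrE//; have := n1 w; lra.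
  rewrite /rate /rho; move: q1 q2 q3; move: (_ / (r w - a w)) (_ / (a w - r w)) => A1 A2.
  move: ((s' w - aa w) / _) ((s' w - ra w) / _) ((s' w - lev _ _ _ _) / _) ((s' w - lev _ _ _ _) / _) => A3 A4 A5 A6.
  move: ((l - l2) * _) => A7; lra.
have aN w : `|a w| <= N.
  have [b1 b2 b3] := bnd w; have := HN1 w I; have := HN2 w I.
  by rewrite !ler_norml /N => /andP[? ?] /andP[? ?]; apply/andP; split; lra.
have su := H l a z _ ca da aN cz cz' dz zb Hz.
eexists; eexists; split; first exact: su.
move=> w; have [b1 b2 b3] := bnd w; have /andP[_ zW] := zb w.
have dz0 : 0 < d * z w by rewrite mulr_gt0.
have : d * z w <= e / (2 * W) * W by apply: ler_pM => //; exact: ltW.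
have -> : e / (2 * W) * W = e / 2 by field; rewrite gt_eqF.
by move=> ?; apply/andP; split; lra.
Qed.

Lemma pair_level_bound (sg l0 l C0 : R) (b1 b2 q q0 : Om -> R) : sg = 1 \/ sg = -1 -> 0 < C0 ->
  (forall w (x y : R -> R) (k1 k2 : R),
    (forall t : R, is_derive t 1 x (- sg * lev h l0 (dir_flow sig sg t w) (x t) + k1)) ->
    (forall t : R, is_derive t 1 y (- sg * lev h l0 (dir_flow sig sg t w) (y t) + k2)) ->
    (forall t, b1 (dir_flow sig sg t w) <= x t <= b2 (dir_flow sig sg t w)) ->
    (forall t, b1 (dir_flow sig sg t w) <= y t <= b2 (dir_flow sig sg t w)) ->
    (forall t, x t <= y t) -> forall t, y t - x t <= C0 * (`|k1| + `|k2|)) ->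
  orbit_der sig q (fun w => lev h l w (q w)) -> orbit_der sig q0 (fun w => lev h l0 w (q0 w)) ->
  (forall w, b1 w <= q w <= b2 w) -> (forall w, b1 w <= q0 w <= b2 w) ->
  (forall w, q w <= q0 w) \/ (forall w, q0 w <= q w) ->
  forall w, `|q w - q0 w| <= C0 * `|l - l0|.
Proof.
move=> hsg C00 pair dq dq0 rq rq0 ord w.
have nsg (x : R) : `|- sg * x| = `|x|.
  by case: hsg => ->; rewrite ?opprK ?mul1r ?mulN1r ?normrN.
have T0 : dir_flow sig sg 0 w = w by rewrite /dir_flow mulr0 flow0.
have Dq (t : R) : is_derive t 1 (fun t => q (dir_flow sig sg t w))
    (- sg * lev h l0 (dir_flow sig sg t w) (q (dir_flow sig sg t w)) + - sg * (l - l0)).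
  by apply: (isD_eq (@dir_flow_orbit_der R Om sig sg _ _ dq w t)); rewrite /lev; ring.
have Dq0 (t : R) : is_derive t 1 (fun t => q0 (dir_flow sig sg t w))
    (- sg * lev h l0 (dir_flow sig sg t w) (q0 (dir_flow sig sg t w)) + 0).
  by rewrite addr0; exact: (@dir_flow_orbit_der R Om sig sg _ _ dq0 w t).
case: ord => ord.
  have := pair w _ _ _ _ Dq Dq0 (fun t => rq _) (fun t => rq0 _) (fun t => ord _) 0.
  by rewrite T0 nsg normr0 addr0 [`|q w - _|]distrC [`|q0 w - _|]ger0_norm ?subr_ge0.
have := pair w _ _ _ _ Dq0 Dq (fun t => rq0 _) (fun t => rq _) (fun t => ord _) 0.
by rewrite T0 nsg normr0 add0r [`|q w - _|]ger0_norm ?subr_ge0.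
Qed.

Lemma orbit_der_equilibrium l b : orbit_der sig b (fun w => lev h l w (b w)) ->
  equilibrium sig (lev h l) b.
Proof. by move=> db w t; apply/entire_derP; exact: db. Qed.

Lemma lin_sol_derive l b w (z : R -> R) : lin_sol sig (lev h l) b w z ->
  forall t : R, is_derive t 1 z (hx (sig t w) (b (sig t w)) * z t).
Proof.
move=> H t; apply/entire_derP; have [dz ->] := H t; split=> //.
by have /entire_derP[_ ->] := lev_derive dhx l (sig t w) (b (sig t w)).
Qed.

Hypothesis dlo : orbit_der sig lo (fun w => lev h l2 w (lo w)).

Theorem saddle_node_family (u2 u2' : Om -> R) : strict_upper sig h l2 u2 u2' ->
  (forall w, lo w < u2 w < s w) -> exists2 xi : R, l2 < xi & saddle_node_up sig (lev h) xi.
Proof.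
move=> su2 lou2.
have [B HB] := upper_at_bounded cOm ch clo sl2.
have U2 : upper_at sig h lo s l2 by exists u2, u2'.
pose E := [set l | upper_at sig h lo s l].
have E0 : E !=set0 by exists l2.
have hE : has_sup E by split=> //; exists B => l; exact: HB.
pose xi := sup E.
have leE l : upper_at sig h lo s l -> l <= xi by move=> Ul; apply: ub_le_sup => //; case: hE.
have op l : upper_at sig h lo s l -> l < xi.
  move=> /(upper_at_open cOm ch chx dhx)[eta eta0 /leE]; lra.
have l2xi : l2 < xi by exact: op.
have Ult l : l < xi -> upper_at sig h lo s l.
  move=> lx; have e0 : 0 < xi - l by rewrite subr_gt0.
  have [l' El' h1] := sup_adherent e0 hE; apply: (@upper_at_down _ _ _ _ _ _ l') => //.
  by move: h1; rewrite -/xi; lra.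
have [ar Har] : exists ar : R -> (Om -> R) * (Om -> R), forall l, l2 < l < xi ->
    ar_pair sig h hx lo s l (ar l).1 (ar l).2 /\
    forall u u', strict_upper sig h l u u' -> (forall w, lo w < u w < s w) ->
    forall w, (ar l).1 w < u w < (ar l).2 w.
  suff : forall l, exists p : (Om -> R) * (Om -> R), l2 < l < xi ->
      ar_pair sig h hx lo s l p.1 p.2 /\
      forall u u', strict_upper sig h l u u' -> (forall w, lo w < u w < s w) ->
      forall w, p.1 w < u w < p.2 w by move=> /choice[ar Har]; exists ar.
  move=> l; have [/andP[h1 h2]|] := boolP (l2 < l < xi); last by exists (lo, lo).
  have [a [r H]] := upper_at_pair cOm flow ch chx dhx clo dlo sl2 conc (ltW h1) (Ult l h2).
  by exists (a, r).
pose a l := (ar l).1; pose r l := (ar l).2.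
pose I := [set l | l2 < l < xi].
have P1 l : I l -> [/\ continuous (a l), continuous (r l),
    orbit_der sig (a l) (fun w => lev h l w (a l w)) & orbit_der sig (r l) (fun w => lev h l w (r l w))].
  by move=> /Har[[]].
have P2 l w : I l -> [/\ lo w <= a l w, a l w < r l w & r l w < s w] by move=> /Har[[]].
have loa l w : I l -> lo w < a l w.
  move=> Il; have [ca _ da _] := P1 l Il; have /andP[l2l _] := Il.
  have sll : strict_lower sig h l lo (fun w => lev h l2 w (lo w)).
    by split=> //; [exact: lev_comp_continuous|move=> v; rewrite /lev ltrD2l].
  have [dl [eta [dl0 eta0 Hm]]] := strict_lower_margin cOm ch chx dhx sll.
  have := @barrier_rev R (fun t => a l (sig t w) - lo (sig t w)) _ dl eta 0 eta0
      (fun t => isD_sub (da w t) (dlo w t)) _ _ 0.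
  rewrite flow0 => H; suff : dl < a l w - lo w by lra.
  apply: H => t; last by rewrite subr_ge0; have [] := P2 l (sig t w) Il.
  move=> hd; have := Hm (sig t w) (a l (sig t w)); rewrite ger0_norm; first by move=> /(_ hd); lra.
  by rewrite subr_ge0; have [] := P2 l (sig t w) Il.
have up l l' b : l < l' -> continuous b -> orbit_der sig b (fun w => lev h l' w (b w)) ->
    strict_upper sig h l b (fun w => lev h l' w (b w)).
  by move=> ll cb db; split=> //; [exact: lev_comp_continuous|move=> w; rewrite /lev ltrD2l].
have mono l l' w : I l -> I l' -> l < l' -> a l w < a l' w /\ r l' w < r l w.
  move=> Il Il' ll; have [ca cr da dr] := P1 l' Il'; have [_ H] := Har l Il; split.
    suff : a l w < a l' w < r l w by move=> /andP[].
    apply: (H _ _ (up _ _ _ ll ca da)) => v; rewrite loa//=; have [_ j1 j2] := P2 l' v Il'.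
    exact: lt_trans j1 j2.
  suff : a l w < r l' w < r l w by move=> /andP[].
  apply: (H _ _ (up _ _ _ ll cr dr)) => v; have [_ ? ?] := P2 l' v Il'.
  by apply/andP; split=> //; apply: lt_trans (loa _ _ Il') _.
have monoW l l' w : I l -> I l' -> l <= l' -> a l w <= a l' w /\ r l' w <= r l w.
  move=> Il Il'; rewrite le_eqVlt => /orP[/eqP ->//|ll].
  by have [/ltW ? /ltW ?] := mono l l' w Il Il' ll.
have arle l l' w : I l -> I l' -> a l w <= r l' w.
  move=> Il Il'; have [ll|/ltW ll] := leP l l'.
    by have [h1 _] := monoW l l' w Il Il' ll; have [_ /ltW ? _] := P2 l' w Il'; exact: le_trans h1 _.
  by have [_ h1] := monoW l' l w Il' Il ll; have [_ /ltW ? _] := P2 l w Il; exact: le_trans h1.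
have Imid l l' : l2 <= l -> l < l' -> l' <= xi -> I ((l + l') / 2) /\ l < (l + l') / 2 < l'.
  by move=> h1 h2 h3; split; apply/andP; split; lra.
have sll l : I l -> strict_lower sig h l s s'.
  move=> /andP[h1 _]; have [? ? ? H] := sl2; split=> // w.
  by apply: lt_trans (H w) _; rewrite /lev ltrD2l.
have levle l l' w x : l < l' -> lev h l w x <= lev h l' w x by move=> /ltW; rewrite /lev lerD2l.
have cont_of l0 (C0 : R) (q : R -> Om -> R) (c1 c2 : R) : 0 < C0 -> c1 < l0 < c2 ->
    (forall l, I l -> c1 < l < c2 -> forall w, `|q l w - q l0 w| <= C0 * `|l - l0|) ->
    forall e : R, 0 < e -> exists2 dl : R, 0 < dl &
    forall l, I l -> `|l - l0| < dl -> forall w, `|q l w - q l0 w| < e.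
  move=> C00 /andP[h1 h2] H e e0.
  exists (Num.min (Num.min (l0 - c1) (c2 - l0)) (e / C0)).
    by rewrite !lt_min !subr_gt0 h1 h2 divr_gt0.
  move=> l Il; rewrite !lt_min => /andP[/andP[k1 k2] k3] w.
  apply: le_lt_trans (H l Il _ w) _.
    by move: k1 k2; rewrite !ltr_norml => /andP[? ?] /andP[? ?]; apply/andP; split; lra.
  by rewrite mulrC -ltr_pdivlMr.
have sca : sup_continuous_on I a.
  move=> l0 Il0; have /andP[k1 k2] := Il0.
  have [Ib /andP[lb1 lb2]] := Imid l0 xi (ltW k1) k2 (lexx _); set lb := (l0 + xi) / 2 in Ib lb1 lb2.
  have [Ic /andP[lc1 lc2]] := Imid lb xi (ltW (lt_trans k1 lb1)) lb2 (lexx _); set lc := (lb + xi) / 2 in Ic lc1 lc2.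
  have [cb _ _ _] := P1 lb Ib; have [cc _ dc _] := P1 lc Ic.
  have [||||||C0 [_ [_ [C00 _ _ pair _]]]] := @band_contraction R Om sig cOm flow h hx ch chx dhx (-1) l0
    (a lc) (fun w => lev h lc w (a lc w)) s s' lo lo (a lb) (or_intror erefl) cc
    (lev_comp_continuous ch cc) dc (fun w => levle _ _ _ _ (lt_trans lb1 lc1)) (sll _ Il0) conc clo cb.
  - by move=> w; exact: ltW (loa _ _ Ib).
  - by move=> w x /andP[_ h1]; have [h2 _] := mono lb lc w Ib Ic lc1; lra.
  - by move=> w; have [_ j1 j2] := P2 lb w Ib; exact: lt_trans j1 j2.
  - by move=> w; have [_ j1 j2] := P2 lc w Ic; exact: lt_trans j1 j2.
  - by move=> w; exact: ltW (loa _ _ Ic).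
  - by move=> w; exact: lexx.
  apply: (cont_of l0 C0 a l2 lb C00); first by rewrite k1 lb1.
  move=> l Il /andP[_ llb].
  have [_ _ da _] := P1 l Il; have [_ _ da0 _] := P1 l0 Il0.
  apply: (@pair_level_bound (-1) l0 l C0 lo (a lb) (a l) (a l0) (or_intror erefl) C00 pair da da0).
  - by move=> w; rewrite (ltW (loa _ _ Il))/=; have [-> _] := monoW l lb w Il Ib (ltW llb).
  - by move=> w; rewrite (ltW (loa _ _ Il0))/=; have [-> _] := monoW l0 lb w Il0 Ib (ltW lb1).
  - have [ll|/ltW ll] := leP l l0; [left|right] => w; first by have [] := monoW l l0 w Il Il0 ll.
    by have [] := monoW l0 l w Il0 Il ll.
have scr : sup_continuous_on I r.
  move=> l0 Il0; have /andP[k1 k2] := Il0.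
  have [Ib /andP[lb1 lb2]] := Imid l0 xi (ltW k1) k2 (lexx _); set lb := (l0 + xi) / 2 in Ib lb1 lb2.
  have [Ic /andP[lc1 lc2]] := Imid lb xi (ltW (lt_trans k1 lb1)) lb2 (lexx _); set lc := (lb + xi) / 2 in Ic lc1 lc2.
  have [Id /andP[ld1 ld2]] := Imid l2 l0 (lexx _) k1 (ltW k2); set ld := (l2 + l0) / 2 in Id ld1 ld2.
  have [_ cb _ _] := P1 lb Ib; have [_ cc _ dc] := P1 lc Ic; have [_ cd _ _] := P1 ld Id.
  have [||||||C0 [_ [_ [C00 _ _ pair _]]]] := @band_contraction R Om sig cOm flow h hx ch chx dhx 1 l0
    (r lc) (fun w => lev h lc w (r lc w)) s s' lo (r lb) (r ld) (or_introl erefl) cc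
    (lev_comp_continuous ch cc) dc (fun w => levle _ _ _ _ (lt_trans lb1 lc1)) (sll _ Il0) conc cb cd.
  - by move=> w; have [_ /ltW] := mono ld lb w Id Ib (lt_trans ld2 lb1).
  - by move=> w x /andP[h1 _]; have [_ h2] := mono lb lc w Ib Ic lc1; lra.
  - by move=> w; have [_ _] := P2 ld w Id.
  - by move=> w; have [_ _] := P2 lc w Ic.
  - by move=> w; exact: le_trans (ltW (loa _ _ Ic)) (arle _ _ _ Ic Ic).
  - by move=> w; exact: le_trans (ltW (loa _ _ Ib)) (arle _ _ _ Ib Ib).
  apply: (cont_of l0 C0 r ld lb C00); first by rewrite ld2 lb1.
  move=> l Il /andP[ldl llb].
  have [_ _ _ dr] := P1 l Il; have [_ _ _ dr0] := P1 l0 Il0.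
  apply: (@pair_level_bound 1 l0 l C0 (r lb) (r ld) (r l) (r l0) (or_introl erefl) C00 pair dr dr0).
  - by move=> w; have [_ ->] := monoW l lb w Il Ib (ltW llb); have [_ ->] := monoW ld l w Id Il (ltW ldl).
  - by move=> w; have [_ ->] := monoW l0 lb w Il0 Ib (ltW lb1); have [_ ->] := monoW ld l0 w Id Il0 (ltW ld2).
  - have [ll|/ltW ll] := leP l l0; [right|left] => w; first by have [] := monoW l l0 w Il Il0 ll.
    by have [] := monoW l0 l w Il0 Il ll.
have [aX HaX] : exists aX : Om -> R, forall w, [/\ (fun l => a l w) @ xi^'- --> aX w,
    forall l, I l -> a l w <= aX w & forall B', (forall l, I l -> a l w <= B') -> aX w <= B'].
  suff /choice[aX HaX] : forall w, exists L : R, [/\ (fun l => a l w) @ xi^'- --> L,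
      forall l, I l -> a l w <= L & forall B', (forall l, I l -> a l w <= B') -> L <= B'] by exists aX.
  move=> w; apply: (@nondecreasing_left_limit R (fun l => a l w) l2 xi (s w) l2xi).
    move=> x y h1 h2 h3.
    by have [] := monoW x y w _ _ h2; rewrite /I /= ?h1 ?h3 ?(lt_le_trans h1 h2) ?(le_lt_trans h2 h3).
  by move=> x Ix; have [_ j1 j2] := P2 x w Ix; apply: ltW; exact: lt_trans j1 j2.
have [rX HrX] : exists rX : Om -> R, forall w, [/\ (fun l => r l w) @ xi^'- --> rX w,
    forall l, I l -> rX w <= r l w & forall B', (forall l, I l -> B' <= r l w) -> B' <= rX w].
  suff /choice[rX HrX] : forall w, exists L : R, [/\ (fun l => r l w) @ xi^'- --> L,
      forall l, I l -> L <= r l w & forall B', (forall l, I l -> B' <= r l w) -> B' <= L] by exists rX.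
  move=> w.
  have [||L [cL L1 L2]] := @nondecreasing_left_limit R (fun l => - r l w) l2 xi (- lo w) l2xi.
  - move=> x y h1 h2 h3; rewrite lerN2.
    by have [] := monoW x y w _ _ h2; rewrite /I /= ?h1 ?h3 ?(lt_le_trans h1 h2) ?(le_lt_trans h2 h3).
  - by move=> x Ix; rewrite lerN2; exact: le_trans (ltW (loa _ _ Ix)) (arle _ _ _ Ix Ix).
  exists (- L); split.
  - have -> : (fun l => r l w) = (fun l => - (- r l w)) by apply/funext => l; rewrite opprK.
    exact: cvgN.
  - by move=> l /L1; rewrite lerNl.
  - by move=> B' H; rewrite lerNr; apply: L2 => l Il; rewrite lerN2; exact: H.
have [N1 N10 HN1] := compact_norm_bound cOm clo.
have [N2 N20 HN2] := compact_norm_bound cOm cs.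
have inN w x : lo w <= x <= s w -> `|x| <= N1 + N2.
  move=> /andP[h1 h2]; have := HN1 w Logic.I; have := HN2 w Logic.I.
  by rewrite !ler_norml => /andP[? ?] /andP[? ?]; apply/andP; split; lra.
have daX : orbit_der sig aX (fun w => lev h xi w (aX w)).
  apply: (@limit_equilibrium R Om sig cOm flow h hx ch chx dhx l2 xi (N1 + N2) a) => //.
  - by move=> l /P1[].
  - move=> l w Il; apply: (inN w); rewrite (ltW (loa _ _ Il))/=.
    by have [_ j1 j2] := P2 l w Il; apply: ltW; exact: lt_trans j1 j2.
  - by move=> w; have [] := HaX w.
have drX : orbit_der sig rX (fun w => lev h xi w (rX w)).
  apply: (@limit_equilibrium R Om sig cOm flow h hx ch chx dhx l2 xi (N1 + N2) r) => //.
  - by move=> l /P1[].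
  - move=> l w Il; apply: (inN w); rewrite (le_trans (ltW (loa _ _ Il)) (arle _ _ _ Il Il))/=.
    by have [_ _ /ltW] := P2 l w Il.
  - by move=> w; have [] := HrX w.
exists xi => //; exists (xi - l2); first by rewrite subr_gt0.
have -> : [set l | xi - (xi - l2) < l < xi] = I by rewrite opprB addrC subrK.
exists a, r, aX, rX; split.
- move=> l Il; have [[[ca cr da dr] H _ Ha Hr] _] := Har l Il; split.
  + split; first by split=> //; exact: orbit_der_equilibrium.
    have [k [be [k0 be0 dec]]] := Ha; exists k, be; split=> // w z /lin_sol_derive; exact: dec.
  + split; first by split=> //; exact: orbit_der_equilibrium.
    have [k [be [k0 be0 dec]]] := Hr; exists k, be; split=> // w z /lin_sol_derive; exact: dec.
  + by move=> w; have [] := H w.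
- split=> // l0 Il0 e e0; have [dl dl0 H] := scr l0 Il0 e e0; exists dl => // l Il ll w.
  by rewrite -opprD normrN; exact: H.
- split=> l l' Il Il' ll w; first by have [] := mono l l' w Il Il' ll.
  by rewrite ltrN2; have [] := mono l l' w Il Il' ll.
- by split=> w; [have [] := HaX w|have [] := HrX w].
split; [exact: orbit_der_equilibrium|exact: orbit_der_equilibrium|].
move=> e e0; apply: contrapT => /forallNP H.
have sep l w : I l -> a l w + e <= r l w.
  move=> Il; have [_ a1 a2] := HaX w; have [_ r1 r2] := HrX w.
  have ax : aX w <= rX w by apply: a2 => l' Il'; apply: r2 => l'' Il''; exact: arle.
  have := H w; move=> /negP; rewrite -leNgt distrC ger0_norm ?subr_ge0//.
  by have := a1 l Il; have := r1 l Il; lra.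
have [I3 /andP[l31 l32]] := Imid l2 xi (lexx _) l2xi (lexx _); set l3 := (l2 + xi) / 2 in I3 l31 l32.
have [_ cr3 _ _] := P1 l3 I3.
have [||m m0 Hm] := @compact_lower_bound R Om (fun w => s w - r l3 w) setT cOm.
- by move=> w; apply: cvgB; [exact: cs|exact: cr3].
- by move=> w _; rewrite subr_gt0; have [] := P2 l3 w I3.
have [|eta eta0 Heta] := @separated_push e m e0 m0.
  by move=> w; have := Hm w Logic.I; have := sep l3 w I3; have := loa l3 w I3; lra.
pose l := Num.max l3 (xi - eta / 2).
have ll3 : l3 <= l by rewrite le_max lexx.
have ll4 : xi - eta / 2 <= l by rewrite le_max lexx orbT.
have Il : I l by rewrite /I /= (lt_le_trans l31 ll3)/= gt_max l32/=; lra.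
have [ca cr da dr] := P1 l Il.
have : l + eta <= xi.
  apply: leE; apply: (Heta l (a l) (r l)) => //; first by apply: ltW; exact: lt_le_trans l31 ll3.
  move=> w; split; [exact: ltW (loa _ _ Il)|exact: sep|].
  by have [_ h1] := monoW l3 l w I3 Il ll3; have := Hm w Logic.I; lra.
lra.
Qed.

End saddle_node.

(** * The lower equilibrium *)

Section convex_derivative.
Context {R : realType}.
Implicit Types (F dF : R -> R) (I : set R).

Lemma convex_chord_slope F dF I x y : I x -> I y -> x < y -> convex_on F I ->
  (forall z : R, is_derive z 1 F (dF z)) ->
  dF x <= (F y - F x) / (y - x) <= dF y.
Proof.
move=> Ix Iy xy cv HF; have yx : 0 < y - x by rewrite subr_gt0.
set S := (F y - F x) / (y - x).
have ES : F y - F x = S * (y - x) by rewrite /S divfK// gt_eqF.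
have chord u : 0 < u < 1 -> F (x + u * (y - x)) <= F x + u * S * (y - x).
  move=> /andP[u0 u1].
  have := cv x y (1 - u) Ix Iy; rewrite subr_gt0 u1 gtrBl u0 => /(_ isT).
  have -> : (1 - u) * x + (1 - (1 - u)) * y = x + u * (y - x) by ring.
  move=> /le_trans; apply.
  by rewrite -mulrA -ES; lra.
apply/andP; split; rewrite leNgt; apply/negP => lt.
  have e0 : 0 < (dF x - S) / 2 by rewrite divr_gt0// subr_gt0.
  have [dl dl0 Hd] := (is_derive_epsP _ _ _).1 (HF x) _ e0.
  pose u := Num.min (1 / 2) (dl / (2 * (y - x))).
  have u0 : 0 < u by rewrite lt_min !divr_gt0// mulr_gt0.
  have u1 : u < 1 by rewrite gt_min; apply/orP; left; lra.
  have ud : u * (y - x) < dl.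
    have : u * (y - x) <= dl / (2 * (y - x)) * (y - x) by rewrite ler_pM2r// ge_min lexx orbT.
    have -> : dl / (2 * (y - x)) * (y - x) = dl / 2 by field; rewrite gt_eqF.
    lra.
  have p0 : 0 < u * (y - x) by rewrite mulr_gt0.
  have := Hd (x + u * (y - x)); rewrite [x + _ - x]addrC addKr gtr0_norm// => /(_ ud).
  have := chord u; rewrite u0 u1 => /(_ isT).
  rewrite ler_norml => ? /andP[? _]; nra.
have e0 : 0 < (S - dF y) / 2 by rewrite divr_gt0// subr_gt0.
have [dl dl0 Hd] := (is_derive_epsP _ _ _).1 (HF y) _ e0.
pose u := Num.min (1 / 2) (dl / (2 * (y - x))).
have u0 : 0 < u by rewrite lt_min !divr_gt0// mulr_gt0.
have u1 : u < 1 by rewrite gt_min; apply/orP; left; lra.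
have ud : u * (y - x) < dl.
  have : u * (y - x) <= dl / (2 * (y - x)) * (y - x) by rewrite ler_pM2r// ge_min lexx orbT.
  have -> : dl / (2 * (y - x)) * (y - x) = dl / 2 by field; rewrite gt_eqF.
  lra.
have p0 : 0 < u * (y - x) by rewrite mulr_gt0.
have := Hd (x + (1 - u) * (y - x)).
have -> : x + (1 - u) * (y - x) - y = - (u * (y - x)) by ring.
rewrite normrN gtr0_norm// => /(_ ud).
have := chord (1 - u); rewrite subr_gt0 u1 gtrBl u0 => /(_ isT).
rewrite ler_norml => ? /andP[? _]; nra.
Qed.

Lemma convex_derive_le F dF I x y : I x -> I y -> x <= y -> convex_on F I ->
  (forall z : R, is_derive z 1 F (dF z)) -> dF x <= dF y.
Proof.
move=> Ix Iy; rewrite le_eqVlt => /orP[/eqP ->//|xy] cv HF.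
by have /andP[h1 h2] := convex_chord_slope Ix Iy xy cv HF; exact: le_trans h1 h2.
Qed.

Lemma concave_derive_ge F dF I x y : I x -> I y -> x <= y -> concave_on F I ->
  (forall z : R, is_derive z 1 F (dF z)) -> dF y <= dF x.
Proof.
move=> Ix Iy xy cc HF; rewrite -lerN2.
have cvN : convex_on (fun z => - F z) I by move=> a b t Ia Ib t01; have := cc a b t Ia Ib t01; lra.
exact: (convex_derive_le Ix Iy xy cvN (fun z => isD_opp (HF z))).
Qed.

Lemma concave_of_derive F dF (A B : R) : (forall z : R, is_derive z 1 F (dF z)) ->
  (forall p q, A < p -> p <= q -> q < B -> dF q <= dF p) -> concave_on F [set z | A <= z <= B].
Proof.
move=> HF mono.
suff H a b t : A <= a -> a < b -> b <= B -> 0 < t < 1 ->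
    t * F a + (1 - t) * F b <= F (t * a + (1 - t) * b).
  move=> a b t /= /andP[a1 a2] /andP[b1 b2] t01; have [ab|ba|->] := ltgtP a b; first exact: H.
    have := H b a (1 - t) b1 ba a2; rewrite subr_gt0 gtrBl andbC => /(_ t01).
    have -> : 1 - (1 - t) = t by ring.
    by rewrite addrC [(1 - t) * b + _]addrC.
  by have -> : t * b + (1 - t) * b = b; [ring|lra].
move=> Aa ab bB /andP[t0 t1]; set m := t * a + (1 - t) * b.
have s0 : 0 < 1 - t by rewrite subr_gt0.
have ba : 0 < b - a by rewrite subr_gt0.
have E1 : m - a = (1 - t) * (b - a) by rewrite /m; ring.
have E2 : b - m = t * (b - a) by rewrite /m; ring.
have am : a < m by rewrite -subr_gt0 E1 mulr_gt0.
have mb : m < b by rewrite -subr_gt0 E2 mulr_gt0.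
have [c1 /andP[c11 c12] H1] := mvt am (fun z _ => HF z).
have [c2 /andP[c21 c22] H2] := mvt mb (fun z _ => HF z).
have c12' := mono c1 c2 (le_lt_trans Aa c11) (ltW (lt_trans c12 c21)) (lt_le_trans c22 bB).
move: H1 H2; rewrite E1 E2 => H1 H2.
have k : 0 < t * (1 - t) * (b - a) by rewrite !mulr_gt0.
have k2 : t * (1 - t) * (b - a) * dF c2 <= t * (1 - t) * (b - a) * dF c1 by rewrite ler_pM2l.
have h1 : t * F m - t * F a = t * (1 - t) * (b - a) * dF c1 by rewrite -mulrBr H1; ring.
have h2 : (1 - t) * F b - (1 - t) * F m = t * (1 - t) * (b - a) * dF c2 by rewrite -mulrBr H2; ring.
nra.
Qed.

(* Concavity on both sides of [0] glues because the derivative [dF] exists at [0]. *)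
Lemma band_concave {Om : pseudoPMetricType R} (g : Om -> R -> R) (w : Om) dF (b1 b2 : R) :
  (forall x : R, is_derive x 1 (gx g w) (dF x)) ->
  [set x | b1 <= x <= b2] `<=` band_fiber concave_on g w ->
  concave_on (gx g w) [set x | b1 <= x <= b2].
Proof.
move=> HF sub; apply: (concave_of_derive HF) => p q b1p pq qb2.
have b12 : b1 <= b2 by exact: le_trans (ltW b1p) (le_trans pq (ltW qb2)).
have [al _] : band_fiber concave_on g w b1 by apply: sub; rewrite /= lexx.
have [_ be] : band_fiber concave_on g w b2 by apply: sub; rewrite /= lexx b12.
have neg u v : p <= u -> u <= v -> v <= 0 -> dF v <= dF u.
  move=> pu uv v0; move: uv; rewrite le_eqVlt => /orP[/eqP ->//|uv].
  have p0 : p < 0 by exact: le_lt_trans pu (lt_le_trans uv v0).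
  move: al; rewrite /alpha_band; case: pselect => [S0|S0]; last first.
    by rewrite lee_fin leNgt (lt_trans b1p p0).
  set S := [set x : R | _] => al.
  have [x [x0 cx] xp] : exists2 x, S x & x < p.
    have /ereal_inf_lt[_ [x Sx <-]] : (ereal_inf [set x%:E | x in S] < p%:E)%E.
      by apply: le_lt_trans al _; rewrite lte_fin.
    by rewrite lte_fin => ?; exists x.
  apply: (concave_derive_ge _ _ (ltW uv) cx HF).
    by rewrite /= (ltW (lt_le_trans xp pu)) (ltW (lt_le_trans uv v0)).
  by rewrite /= v0 andbT (ltW (lt_trans (lt_le_trans xp pu) uv)).
have pos u v : 0 <= u -> u <= v -> v <= q -> dF v <= dF u.
  move=> u0 uv vq; move: uv; rewrite le_eqVlt => /orP[/eqP ->//|uv].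
  have q0 : 0 < q by exact: lt_le_trans (le_lt_trans u0 uv) vq.
  move: be; rewrite /beta_band; case: pselect => [S0|S0]; last first.
    by rewrite lee_fin leNgt (lt_trans q0 qb2).
  set S := [set x : R | _] => be.
  have [x [x0 cx] qx] : exists2 x, S x & q < x.
    have /ereal_sup_gt[_ [x Sx <-]] : (q%:E < ereal_sup [set x%:E | x in S])%E.
      by apply: lt_le_trans be; rewrite lte_fin.
    by rewrite lte_fin => ?; exists x.
  apply: (concave_derive_ge _ _ (ltW uv) cx HF).
    by rewrite /= u0 (ltW (lt_trans uv (le_lt_trans vq qx))).
  by rewrite /= (le_trans u0 (ltW uv)) (ltW (le_lt_trans vq qx)).
have [q0|q0] := leP q 0; first exact: neg.
have [p0|p0] := leP p 0; last exact: pos (ltW p0) pq (lexx _).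
exact: le_trans (pos 0 q (lexx _) (ltW q0) (lexx _)) (neg p 0 (lexx _) p0 (lexx _)).
Qed.

End convex_derivative.

Section hyperbolic.
Context {R : realType} {Om : pseudoPMetricType R} (sig : R -> Om -> Om).
Hypothesis cOm : compact [set: Om].
Hypothesis flow : is_flow sig.

Lemma hyperbolic_cohomologous (phi : Om -> R) (k be : R) : continuous phi -> 0 < k -> 0 < be ->
  (forall w (z : R -> R), (forall t : R, is_derive t 1 z (phi (sig t w) * z t)) ->
    forall t, 0 <= t -> `|z t| <= k * expR (- (be * t)) * `|z 0|) ->
  exists V V', cohomologous_below sig phi V V' (be / 4).
Proof.
move=> cphi k0 be0 dec; have [_ [flow0 flowD]] := flow.
have be4 : 0 < be / 4 by rewrite divr_gt0.
have [dl dl0 Hdl] := flow_tube_time cOm flow cphi be4.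
pose T := 2 * `|ln k| / be + 1.
have T0 : 0 < T by rewrite ltr_wpDl// divr_ge0 ?mulr_ge0// ltW.
have kT : ln k <= be * T / 2.
  have -> : be * T / 2 = `|ln k| + be / 2 by rewrite /T; field; rewrite gt_eqF.
  by have := ler_norm (ln k); lra.
pose n := (Num.truncn (T / dl)).+1.
have n0 : (0 : R) < n%:R by rewrite ltr0n.
pose tau := T / n%:R.
have tau0 : 0 < tau by rewrite divr_gt0.
have taudl : tau < dl.
  by rewrite ltr_pdivrMr// mulrC -ltr_pdivrMr// /n truncnS_gt.
apply: (@avg_cohomologous R Om sig flow phi [seq j%:R * tau | j <- iota 0 n]) => // w.
rewrite size_map size_iota big_map.
have [F HF] := @antiderivative R (fun t => phi (sig t w)) (@continuous_along_orbit R Om sig flow phi w cphi).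
have FT : F T - F 0 <= - (be * T / 2).
  have dz (t : R) : is_derive t 1 (fun t => expR (F t)) (phi (sig t w) * expR (F t)).
    by apply: (isD_eq (isD_exp (HF t))); rewrite mulrC.
  have := dec w _ dz T (ltW T0).
  have {1}-> : k = expR (ln k) by rewrite lnK ?posrE.
  rewrite !gtr0_norm ?expR_gt0// -!expRD ler_expR; lra.
have step m : (\sum_(j <- iota 0 m) phi (sig (j%:R * tau) w)) * tau <=
    F (m%:R * tau) - F 0 + m%:R * (be / 4 * tau).
  elim: m => [|m IH]; first by rewrite big_nil !mul0r subrr addr0.
  rewrite -addn1 iotaD big_cat /= big_seq1 add0n mulrDl.
  have lt : m%:R * tau < (m + 1)%:R * tau by rewrite ltr_pM2r// ltr_nat addn1.
  have [c /andP[c1 c2] E] := mvt lt (fun t _ => HF t).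
  have E2 : (m + 1)%:R * tau = m%:R * tau + tau by rewrite natrD mulrDl mul1r.
  move: c2 E; rewrite E2 [_ + tau - _]addrC addKr => c2 E.
  have := Hdl (sig (m%:R * tau) w) (c - m%:R * tau); rewrite -flowD [_ + (c - _)]addrC subrK.
  rewrite gtr0_norm ?subr_gt0// => /(_ _)/wrap[|]; first lra.
  rewrite ltr_norml => /andP[h1 _].
  have : phi (sig (m%:R * tau) w) * tau <= (phi (sig c w) + be / 4) * tau.
    by rewrite ler_pM2r//; lra.
  by move: IH; rewrite natrD; lra.
have nT : n%:R * tau = T by rewrite /tau mulrC divfK// gt_eqF.
have := step n; rewrite [n%:R * (_ * _)]mulrCA nT => H.
have : (\sum_(j <- iota 0 n) phi (sig (j%:R * tau) w)) * tau <= - (be / 4) * T by lra.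
have -> : - (be / 4) * T = - (be / 4) * n%:R * tau by rewrite -mulrA nT.
by rewrite ler_pM2r.
Qed.

Lemma cohomologous_ae_le (phi psi V V' : Om -> R) (e : R) : continuous phi -> continuous psi ->
  cohomologous_below sig phi V V' e ->
  (forall m : probability (@borelOm R Om) R, ergodic_meas sig m -> full_meas m [set w | psi w <= phi w]) ->
  exists W W', cohomologous_below sig psi W W' (e / 2).
Proof.
move=> cphi cpsi [cV cV' dV e0 HV] ae.
have e40 : 0 < e / 4 by rewrite divr_gt0.
have e20 : 0 < e / 2 by rewrite divr_gt0.
have cf : continuous (fun w => psi w - phi w) by move=> w; apply: cvgB; [exact: cpsi|exact: cphi].
have [|ts ts0 Hts] := @ergodic_average_lt R Om sig cOm flow (fun w => psi w - phi w) (e / 4) cf e40.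
  by move=> m /ae[A [mA As mA1]]; exists A; split=> // w /As /=; rewrite subr_le0.
have [||W [W' [cW cW' dW _ HW]]] := @avg_cohomologous R Om sig flow (fun w => psi w - phi w - e / 2) ts (e / 4) _ e40 ts0.
- by move=> w; apply: cvgB; [exact: cf|exact: cvg_cst].
- move=> w; rewrite big_split /= big_const_seq count_predT iter_addr_0 -[(- (e / 2)) *+ _]mulr_natr.
  by have := Hts w; lra.
exists (fun w => V w + W w), (fun w => V' w + W' w); split=> //.
- exact: continuous_fun_add.
- exact: continuous_fun_add.
- by move=> w t; apply: isD_add; [exact: dV|exact: dW].
- by move=> w; have := HV w; have := HW w; lra.
Qed.

End hyperbolic.

Section lower_family.
Context {R : realType} {Om : pseudoPMetricType R} (sig : R -> Om -> Om).
Hypothesis cOm : compact [set: Om].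
Hypothesis flow : is_flow sig.
Variables (c d : Om -> R) (g gd : Om -> R -> R).
Hypotheses (cc : continuous c) (cd : continuous d).
Hypothesis cg : continuous (fun p : Om * R => g p.1 p.2).
Hypothesis cgd : continuous (fun p : Om * R => gd p.1 p.2).
Hypothesis dg : forall w (x : R), is_derive x 1 (g w) (gd w x).
Hypothesis low : forall M : R, exists K : R, forall w x, x <= - K -> M <= d w * x + g w x.
Hypotheses (g0 : forall w, g w 0 = 0) (gd0 : forall w, gd w 0 = 0).
Hypotheses (gneg : forall w x, 0 <= x -> g w x <= 0) (gpos : forall w x, x <= 0 -> 0 <= g w x).

Definition unimodal_slope w := forall x y : R, x <= y -> gd w x <= gd w (Num.min y 0).

Hypothesis uni : forall m : probability (@borelOm R Om) R, ergodic_meas sig m ->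
  full_meas m unimodal_slope.

Let h w x := c w + d w * x + g w x.
Let hx w x := d w + gd w x.

Let flow0 w : sig 0 w = w. Proof. by have [_ []] := flow. Qed.

Lemma gmax_derive w (x : R) : is_derive x 1 (gmax g w) (gd w (Num.min x 0)).
Proof.
have gle y : y <= 0 -> gmax g w y = g w y by move=> y0; rewrite /gmax max_r// gpos.
have gge y : 0 <= y -> gmax g w y = 0 by move=> y0; rewrite /gmax max_l// gneg.
apply/is_derive_epsP => e e0; have [x0|x0|->] := ltgtP x 0.
- have [dl dl0 H] := (is_derive_epsP _ _ _).1 (dg w x) e e0.
  exists (Num.min dl (- x)); first by rewrite lt_min dl0 oppr_gt0.
  move=> y; rewrite lt_min => /andP[y1 y2]; rewrite !gle ?(ltW x0)//; first exact: H.
  by move: y2; rewrite ltr_norml => /andP[? ?]; lra.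
- exists x => // y; rewrite ltr_norml => /andP[y1 y2].
  by rewrite !gge ?(ltW x0)//; [rewrite gd0 mul0r !subr0 normr0 mulr_ge0// ltW|lra].
- have [dl dl0 H] := (is_derive_epsP _ _ _).1 (dg w 0) e e0.
  exists dl => // y y1; have := H y y1; rewrite (gle 0)// gd0 g0 mul0r.
  have [y0|/ltW y0] := leP y 0; first by rewrite gle.
  by rewrite gge// !subr0 normr0 mulr_ge0// ltW.
Qed.

Let ch : continuous (fun p : Om * R => h p.1 p.2).
Proof.
move=> p; apply: cvgD; last exact: cg.
have cf (b : Om -> R) : continuous b -> {for p, continuous (fun q : Om * R => b q.1)}.
  by move=> cb; apply: (@continuous_comp _ _ _ fst b); [exact: cvg_fst|exact: cb].
apply: cvgD; first exact: cf.
by apply: cvgM; [exact: cf|exact: cvg_snd].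
Qed.

Let chx : continuous (fun p : Om * R => hx p.1 p.2).
Proof.
move=> p; apply: cvgD; last exact: cgd.
by apply: (@continuous_comp _ _ _ fst d); [exact: cvg_fst|exact: cd].
Qed.

Let rhs_derive (k : Om -> R -> R) l w (x v : R) : is_derive x 1 (k w) v ->
  is_derive x 1 (rhs c d k l w) (d w + v).
Proof.
move=> H.
have := isD_add (isD_add (isD_add (isD_cst (c w) x) (isD_scale (d w) (isD_id x))) H) (isD_cst l x).
by apply: is_derive_ext => //; ring.
Qed.

Let dhx w (x : R) : is_derive x 1 (h w) (hx w x).
Proof.
have := isD_add (isD_add (isD_cst (c w) x) (isD_scale (d w) (isD_id x))) (dg w x).
by apply: is_derive_ext => //; rewrite /hx; ring.
Qed.

Section level.
Variable l2 : R.
Hypothesis AR : AR_pair sig (rhs c d (gmax g) l2).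

(* The attractor of the family with [max 0 g] bounds the lower equilibrium from above, and below
   it the slope of [h] is dominated by the slope along that attractor. *)
Lemma lower_equilibrium : exists (lo psi V V' : Om -> R) (e : R), [/\ continuous lo,
  orbit_der sig lo (fun w => lev h l2 w (lo w)), lo = l_att sig (rhs c d g l2),
  cohomologous_below sig psi V V' e & forall w, hx w (lo w) <= psi w].
Proof.
have [a [r [[[ca ea] [k [be [k0 be0 dec]]]] _]]] := AR.
pose phi w := hx w (Num.min (a w) 0).
have cmin : continuous (fun w => Num.min (a w) 0).
  by move=> w; apply: (@continuous_min _ _ a (fun=> 0)); [exact: ca|exact: cvg_cst].
have cphi : continuous phi.
  move=> w; apply: (@continuous_at2 _ _ _ _ (fun p : Om * R => hx p.1 p.2) id (fun w => Num.min (a w) 0)).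
  - exact: chx.
  - by [].
  - exact: cmin.
have [|V0 [V0' coh0]] := hyperbolic_cohomologous cOm flow cphi k0 be0.
  move=> w z dz; apply: (dec w z) => t; apply/entire_derP.
  have /entire_derP[_ ->] := rhs_derive l2 (gmax_derive (sig t w) (a (sig t w))).
  exact: dz.
have da : orbit_der sig a (fun w => rhs c d (gmax g) l2 w (a w)).
  by move=> w t; apply/entire_derP; exact: ea.
have [Na Na0 HNa] := compact_norm_bound cOm ca.
have [Nc Nc0 HNc] := compact_norm_bound cOm cc.
have [K HK] := low (Nc + `|l2| + 1).
pose N := Num.max K Na.
have hN w x : x <= - N -> 1 <= lev h l2 w x.
  move=> xN; have xK : x <= - K by apply: le_trans xN _; rewrite lerN2 le_max lexx.
  have := HK w x xK; have := HNc w I; rewrite ler_norml => /andP[? _].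
  by have := ler_norm (- l2); rewrite normrN /lev /h; lra.
have Na' w : - N <= a w.
  have : Na <= N by rewrite le_max lexx orbT.
  by have := HNa w I; rewrite ler_norml => /andP[? _]; lra.
pose X (q : Om * R) := - N + clamp01 q.2 * (a q.1 - - N).
have cX : continuous X.
  move=> q; apply: cvgD; first exact: cvg_cst.
  apply: cvgM.
    apply: (@continuous_comp _ _ _ snd (@clamp01 R)); first exact: cvg_snd.
    by apply: (@clamp01_continuous R R id) => x; exact: cvg_id.
  apply: cvgB; last exact: cvg_cst.
  by apply: (@continuous_comp _ _ _ fst a); [exact: cvg_fst|exact: ca].
have Xle q : X q <= a q.1.
  have /andP[c0 c1] := clamp01_bound q.2; have := Na' q.1 => ?.
  have k1 : 0 <= a q.1 - - N by lra.
  by have := ler_piMl k1 c1; rewrite /X; lra.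
pose Q (q : Om * R) := hx q.1 (X q).
have cQ : continuous Q.
  move=> q; apply: (@continuous_at2 _ _ _ _ (fun p : Om * R => hx p.1 p.2) fst X).
  - exact: chx.
  - exact: cvg_fst.
  - exact: cX.
pose J := `[(0 : R), 1]%classic.
have cJ : compact J by exact: segment_compact.
have J0 : J !=set0 by exists 0; rewrite /J /= in_itv /= lexx ler01.
pose psi := sup_over Q J.
have cpsi : continuous psi by exact: sup_over_continuous.
have psiub w x : - N <= x <= a w -> hx w x <= psi w.
  move=> /clamp01_onto[tau Kt Et].
  by have := sup_over_ub cJ J0 cQ w Kt; rewrite /Q /X /= Et.
have [|V [V' coh]] := cohomologous_ae_le cOm flow cphi cpsi coh0.
  move=> m /uni[A [mA As mA1]]; exists A; split=> // w /As uw /=.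
  have [tau Kt [E _]] := sup_over_attained cJ J0 cQ w; rewrite /psi E.
  by rewrite /Q /phi /hx lerD2l; apply: uw; exact: (Xle (w, tau)).
have [cV _ _ e0 _] := coh.
have [D D0 HD] := compact_norm_bound cOm cV.
have HD' w : `|V w| <= D by exact: HD.
have levD := lev_derive dhx l2.
have pair w (x y : R -> R) : solution sig (lev h l2) w x -> solution sig (lev h l2) w y ->
    (forall t, - N <= x t <= a (sig t w)) -> (forall t, - N <= y t <= a (sig t w)) ->
    (forall t, x t <= y t) -> forall t, y t <= x t.
  move=> sx sy rx ry xy t.
  have := @contraction_bound R Om sig psi V V' _ D coh HD' w (fun t => y t - x t) _ (Na + N) 0 (lexx _)
    (fun t => isD_sub (sy t) (sx t)) _ _ t.
  rewrite !mul0r subr_le0; apply => u.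
    rewrite subr_ge0 xy/=; have /andP[h1 _] := rx u; have /andP[_ h2] := ry u.
    by have := HNa (sig u w) I; rewrite ler_norml => /andP[_ ?]; lra.
  have := xy u; rewrite addr0 le_eqVlt => /orP[/eqP ->|lt]; first by rewrite !subrr mulr0.
  have [z /andP[z1 z2] ->] := mvt lt (fun z _ => levD (sig u w) z).
  rewrite ler_pM2r ?subr_gt0//; apply: psiub.
  have /andP[h1 _] := rx u; have /andP[_ h2] := ry u.
  by rewrite (ltW (le_lt_trans h1 z1)) (ltW (lt_le_trans z2 h2)).
have cN : continuous (fun _ : Om => - N) by move=> w; exact: cvg_cst.
have dN : orbit_der sig (fun _ : Om => - N) (fun=> 0) by move=> w t; exact: isD_cst.
have [||||lo [clo rlo dlo]] := @unique_equilibrium R Om sig cOm flow (lev h l2) hx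
    (@lev_continuous R Om h ch l2) chx levD (fun=> - N) (fun=> 0) a (fun w => rhs c d (gmax g) l2 w (a w)) cN ca dN da.
- by move=> w; apply: le_trans ler01 _; exact: hN.
- by move=> w; rewrite /lev /h /rhs /gmax lerD2r lerD2l le_max lexx orbT.
- exact: Na'.
- move=> w x y sx sy rx ry xy; apply/eqP; rewrite eq_le xy/=; exact: (pair w).
have [Nl Nl0 HNl] := compact_norm_bound cOm clo.
have lol : lo = l_att sig (rhs c d g l2).
  apply/funext => w; rewrite /l_att.
  have inlo : attractor_fiber sig (rhs c d g l2) w (lo w).
    exists (fun t => lo (sig t w)); split=> [t||]; first by apply/entire_derP; exact: dlo.
      by rewrite flow0.
    by exists Nl => t; exact: HNl.
  have lbo : lbound (attractor_fiber sig (rhs c d g l2) w) (lo w).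
    move=> _ [v [ev <- [M HM]]].
    have sv : solution sig (lev h l2) w v by move=> t; apply/entire_derP; exact: ev.
    have vN t : - N < v t.
      apply: (@barrier_rev R v _ (- N) 1 (- M) ltr01 sv) => u; first exact: hN.
      by have := HM u; rewrite ler_norml => /andP[].
    rewrite leNgt; apply/negP => lt.
    have M1 u : `|v u| <= M + Nl by apply: le_trans (HM u) _; rewrite lerDl ltW.
    have M0 : 0 <= M by exact: le_trans (normr_ge0 _) (HM 0).
    have M2 u : `|lo (sig u w)| <= M + Nl by apply: le_trans (HNl _ I) _; rewrite lerDr.
    have ord : forall t, v t < lo (sig t w).
      apply: (@solution_ordered R Om sig cOm (lev h l2) hx chx levD w v _ (M + Nl) sv (dlo w) M1 M2).
      by exists 0; rewrite flow0.
    have := pair w v (fun t => lo (sig t w)) sv (dlo w) _ _ (fun t => ltW (ord t)) 0.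
    rewrite leNgt ord => H; apply: notF; apply: H => t; last exact: rlo.
    by rewrite (ltW (vN t)) (le_trans (ltW (ord t)))//; have /andP[] := rlo (sig t w).
  apply/eqP; rewrite eq_le; apply/andP; split.
    by apply: lb_le_inf => //; exists (lo w).
  by apply: ge_inf => //; exists (lo w).
exists lo, psi, V, V', (be / 4 / 2); split=> // w.
exact: psiub.
Qed.

Theorem lower_saddle_node (s s' : Om -> R) : strict_lower sig h l2 s s' ->
  (forall w, l_att sig (rhs c d g l2) w < s w) ->
  ae_concave sig hx (l_att sig (rhs c d g l2)) s ->
  exists2 xi : R, l2 < xi & saddle_node_up sig (rhs c d g) xi.
Proof.
have [lo [psi [V [V' [e [clo dlo <- [cV cV' dV e0 HV] Hpsi]]]]]] := lower_equilibrium.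
move=> sl los conc; have [cs _ _ _] := sl.
have [||m m0 Hm] := @compact_lower_bound R Om (fun w => s w - lo w) setT cOm.
- by move=> w; apply: cvgB; [exact: cs|exact: clo].
- by move=> w _; rewrite subr_gt0.
have [D D0 HD] := compact_norm_bound cOm cV.
have [N N0 HN] := compact_norm_bound cOm clo.
have W0 := expR_gt0 D; have c0 := expR_gt0 (- D).
have dm0 : 0 < m / (2 * expR D) by rewrite divr_gt0// mulr_gt0.
have [dd [eta [dd0 ddm eta0 H]]] := push_upper sig cOm ch chx dhx N c0 e0 dm0 W0.
pose z w := expR (V w).
have cz : continuous z.
  by move=> w; apply: (@continuous_comp _ _ _ V expR); [exact: cV|exact: continuous_expR].
have zb w : expR (- D) <= z w <= expR D.
  by have := HD w I; rewrite ler_norml => /andP[? ?]; rewrite !ler_expR; apply/andP.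
have [||cu cu' du Hu] := H l2 lo z (fun w => z w * V' w) clo dlo (fun w => HN w I) cz _
    (fun w t => isD_exp (dV w t)) zb _.
- by move=> w; apply: cvgM; [exact: cz|exact: cV'].
- by move=> w; rewrite mulrC ler_pM2l ?expR_gt0//; have := HV w; have := Hpsi w; lra.
apply: (@saddle_node_family R Om sig cOm flow h hx ch chx dhx l2 lo s s' clo sl conc dlo
  (fun w => lo w + dd * z w) (fun w => lev h l2 w (lo w) + dd * (z w * V' w))).
  by split=> // w; apply: lt_trans (Hu w); rewrite /lev ltrD2l ltrDl.
move=> w; have /andP[z1 z2] := zb w.
have p0 : 0 < dd * z w by rewrite mulr_gt0// expR_gt0.
have : dd * z w <= m / (2 * expR D) * expR D by apply: ler_pM => //; [exact: ltW|exact: expR_ge0].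
have -> : m / (2 * expR D) * expR D = m / 2 by field; rewrite gt_eqF.
by have := Hm w I => ? ?; apply/andP; split; lra.
Qed.

End level.
End lower_family.

(** * Reflection *)

Section reflection.
Context {R : realType} {Om : pseudoPMetricType R} (sig : R -> Om -> Om).
Implicit Types (f : Om -> R -> R) (b : Om -> R).

Definition reflect_field f w x := - f w (- x).

Lemma reflect_derive f v w (x : R) : is_derive (- x) 1 (f w) v ->
  is_derive x 1 (reflect_field f w) v.
Proof.
move=> H; have := isD_opp (isD_comp H (isD_opp (isD_id x))).
by apply: is_derive_ext => //; ring.
Qed.

Lemma reflect_entire_sol f w (v : R -> R) : entire_sol sig f w v ->
  entire_sol sig (reflect_field f) w (fun t => - v t).
Proof.
move=> H t; apply/entire_derP; rewrite /reflect_field opprK.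
by apply: isD_opp; apply/entire_derP; exact: H.
Qed.

Lemma reflect_copy_base f b : copy_base sig f b ->
  copy_base sig (reflect_field f) (fun w => - b w).
Proof.
move=> [cb eb]; split=> [w|w]; first by apply: cvgN; exact: cb.
exact: (@reflect_entire_sol f w (fun t => b (sig t w))).
Qed.

Lemma reflect_lin_sol f fd b w z : (forall w (x : R), is_derive x 1 (f w) (fd w x)) ->
  lin_sol sig (reflect_field f) (fun w => - b w) w z -> lin_sol sig f b w z.
Proof.
move=> df H t; have [dz ->] := H t; split=> //.
have /entire_derP[_ ->] := df (sig t w) (b (sig t w)).
have H1 : is_derive (- - b (sig t w)) 1 (f (sig t w)) (fd (sig t w) (b (sig t w))).
  by rewrite opprK; exact: df.
by have /entire_derP[_ ->] := reflect_derive H1.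
Qed.

Lemma reflect_hyp_attractive f fd b : (forall w (x : R), is_derive x 1 (f w) (fd w x)) ->
  hyp_attractive sig f b -> hyp_attractive sig (reflect_field f) (fun w => - b w).
Proof.
move=> df [/reflect_copy_base cb [k [be [k0 be0 H]]]]; split=> //; exists k, be; split=> // w z.
by move=> /(reflect_lin_sol df); exact: H.
Qed.

Lemma reflect_hyp_repulsive f fd b : (forall w (x : R), is_derive x 1 (f w) (fd w x)) ->
  hyp_repulsive sig f b -> hyp_repulsive sig (reflect_field f) (fun w => - b w).
Proof.
move=> df [/reflect_copy_base cb [k [be [k0 be0 H]]]]; split=> //; exists k, be; split=> // w z.
by move=> /(reflect_lin_sol df); exact: H.
Qed.

Lemma reflect_fieldK f : reflect_field (reflect_field f) = f.
Proof. by apply/funext => w; apply/funext => x; rewrite /reflect_field !opprK. Qed.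

Lemma reflect_l_att f w : l_att sig (reflect_field f) w = - u_att sig f w.
Proof.
rewrite /l_att /u_att /inf; congr (- sup _); apply/seteqP; split=> x.
  move=> [_ [v [ev <- [M HM]]] <-]; exists (fun t => - v t); split=> //.
    by rewrite -[f]reflect_fieldK; exact: reflect_entire_sol.
  by exists M => t; rewrite normrN.
move=> [v [ev <- [M HM]]]; exists (- v 0); last by rewrite opprK.
exists (fun t => - v t); split=> //; first exact: reflect_entire_sol.
by exists M => t; rewrite normrN.
Qed.

Lemma reflect_saddle_node (F : R -> Om -> R -> R) (Fd : Om -> R -> R) (xi : R) :
  (forall l w (x : R), is_derive x 1 (F l w) (Fd w x)) ->
  saddle_node_up sig F xi -> saddle_node_down sig (fun l => reflect_field (F (- l))) (- xi).
Proof.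
move=> dF [dl dl0 [a [r [aX [rX [H [ca cr] [ia ir] [la lr] [ea er sep]]]]]]]; exists dl => //.
have neg l : - xi < l < - xi + dl -> xi - dl < - l < xi.
  by move=> /andP[? ?]; apply/andP; split; lra.
exists (fun l w => - a (- l) w), (fun l w => - r (- l) w), (fun w => - aX w), (fun w => - rX w); split.
- move=> l /= /neg Il; have [h1 h2 h3] := H _ Il; split.
  + exact: reflect_hyp_attractive (dF _) h1.
  + exact: reflect_hyp_repulsive (dF _) h2.
  + by move=> w; rewrite ltrN2; exact: h3.
- split=> l0 /= /neg Il0 e e0; [have [d d0 Hd] := ca _ Il0 e e0|have [d d0 Hd] := cr _ Il0 e e0];
  exists d => // l /neg Il ll w; (have ll' : `|- l - - l0| < d by rewrite -opprD normrN);
  by rewrite -opprD normrN; exact: Hd.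
- split=> l1 l2 /= /neg I1 /neg I2 ll w.
    by rewrite ltrN2; apply: ia => //; rewrite ltrN2.
  by rewrite ltrN2; apply: ir => //; rewrite ltrN2.
- split=> w; apply: cvgN; rewrite -[- xi]opprK.
    by apply/(@cvg_at_leftNP _ _ (fun l => a l w)); rewrite opprK; exact: la.
  by apply/(@cvg_at_leftNP _ _ (fun l => r l w)); rewrite opprK; exact: lr.
split.
- by move=> w; rewrite opprK; exact: (@reflect_entire_sol (F xi) w (fun t => aX (sig t w)) (ea w)).
- by move=> w; rewrite opprK; exact: (@reflect_entire_sol (F xi) w (fun t => rX (sig t w)) (er w)).
- by move=> e /sep[w Hw]; exists w; rewrite -opprD normrN.
Qed.

End reflection.

Lemma orbit_C1_orbit_der {R : realType} {Om : pseudoPMetricType R} (sig : R -> Om -> Om)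
    (s : Om -> R) : is_flow sig -> orbit_C1 sig s ->
  [/\ continuous s, continuous (orbit_deriv sig s) & orbit_der sig s (orbit_deriv sig s)].
Proof.
move=> flow [cs [ds cs']]; split=> //; apply: (orbit_der_at0 flow) => w.
by apply/entire_derP; split=> //; have [] := ds w.
Qed.

Unset Implicit Arguments.

Theorem mainTheorem11 (R : realType) (Om : pseudoPMetricType R) (sig : R -> Om -> Om)
    (c d : Om -> R) (g : Om -> R -> R) (lam_minus lam_plus : R) :
  hausdorff_space Om -> compact [set: Om] -> is_flow sig ->
  cc_hyps sig c d g -> C02 g ->
  (forall l, AR_pair sig (rhs c d (gmin g) l) <-> lam_minus < l) ->
  (forall l, AR_pair sig (rhs c d (gmax g) l) <-> l < lam_plus) ->
  (forall (l2 : R) (s : Om -> R), l2 < lam_plus ->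
     strict_lower_sol sig (rhs c d g l2) s ->
     (forall w, l_att sig (rhs c d g l2) w < s w) ->
     jointly_included sig g (l_att sig (rhs c d g l2)) s ->
     exists2 xi : R, l2 < xi & saddle_node_up sig (rhs c d g) xi) /\
  (forall (l1 : R) (s : Om -> R), lam_minus < l1 ->
     strict_upper_sol sig (rhs c d g l1) s ->
     (forall w, s w < u_att sig (rhs c d g l1) w) ->
     jointly_included sig g s (u_att sig (rhs c d g l1)) ->
     exists2 xi : R, xi < l1 & saddle_node_down sig (rhs c d g) xi).
Proof.
move=> _ cOm flow [[cc cd cg dg cgx] [_ [cc3 [[g00 [gneg [gpos _]]] [cc5 _]]]]] [_ [dgx _]] ARmin ARmax.
have Dg w (x : R) : is_derive x 1 (g w) (gx g w x) by apply/entire_derP.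
have Dgx w (x : R) : is_derive x 1 (gx g w) (gxx g w x) by apply/entire_derP.
have g0 w : g w 0 = 0 by have [] := g00 w.
have gd0 w : gx g w 0 = 0 by have [] := g00 w.
have mono w : concave_on (g w) [set x | 0 <= x] /\ convex_on (g w) [set x | x <= 0] ->
    (forall x y, x <= y -> y <= 0 -> gx g w x <= gx g w y) /\
    (forall x y, 0 <= x -> x <= y -> gx g w y <= gx g w x).
  move=> [hc hv]; split=> x y h1 h2.
    by apply: (convex_derive_le _ _ h1 hv (Dg w)) => //=; exact: le_trans h1 h2.
  by apply: (concave_derive_ge _ _ h2 hc (Dg w)) => //=; exact: le_trans h1 h2.
have conc b1 b2 : jointly_included sig g b1 b2 -> forall m : probability (@borelOm R Om) R,
    ergodic_meas sig m -> full_meas m [set w | concave_on (gx g w) [set x | b1 w <= x <= b2 w]].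
  move=> ji m /ji[[A [mA As mA1]] _]; exists A; split=> // w /As /=.
  exact: band_concave.
split=> [l2 s l2p [sC Hs] ls ji|l1 s l1p [sC Hs] su ji].
  have [cs cs' ds] := orbit_C1_orbit_der flow sC.
  apply: (@lower_saddle_node R Om sig cOm flow c d g (gx g) cc cd cg cgx Dg _ g0 gd0 gneg gpos _
    l2 _ s (orbit_deriv sig s)) => //.
  - by move=> M; have [K HK] := cc3 M; exists K => w x; have [_] := HK w x.
  - move=> m /cc5[A [mA As mA1]]; exists A; split=> // w /As /mono[m1 m2] x y xy.
    have [y0|/ltW y0] := leP y 0; first exact: m1.
    have [x0|/ltW x0] := leP x 0; first exact: m1.
    exact: m2.
  - exact/ARmax.
  - move=> m /(conc _ _ ji)[A [mA As mA1]]; exists A; split=> // w /As /= H a b t Ia Ib t01.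
    by have := H a b t Ia Ib t01; lra.
have [cs cs' ds] := orbit_C1_orbit_der flow sC.
pose gr := reflect_field g; pose gdr w x := gx g w (- x); pose cr w := - c w.
have copp (q : Om -> R -> R) : continuous (fun p : Om * R => q p.1 p.2) ->
    continuous (fun p : Om * R => q p.1 (- p.2)).
  move=> cq p; apply: (@continuous_at2 _ _ _ _ (fun p : Om * R => q p.1 p.2) fst (fun p : Om * R => - p.2)).
  - exact: cq.
  - exact: cvg_fst.
  - by apply: cvgN; exact: cvg_snd.
have Dgr w (x : R) : is_derive x 1 (gr w) (gdr w x) by exact: reflect_derive.
have gr0 w : gr w 0 = 0 by rewrite /gr /reflect_field oppr0 g0 oppr0.
have gdr0 w : gdr w 0 = 0 by rewrite /gdr oppr0 gd0.
have grneg w x : 0 <= x -> gr w x <= 0 by move=> x0; rewrite oppr_le0; apply: gpos; rewrite oppr_le0.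
have grpos w x : x <= 0 -> 0 <= gr w x by move=> x0; rewrite oppr_ge0; apply: gneg; rewrite oppr_ge0.
have Erhs l : reflect_field (rhs c d g (- l)) = rhs cr d gr l.
  by apply/funext => w; apply/funext => x; rewrite /reflect_field /rhs /gr /reflect_field /cr; ring.
have Emax l : reflect_field (rhs c d (gmin g) (- l)) = rhs cr d (gmax gr) l.
  apply/funext => w; apply/funext => x; rewrite /reflect_field /rhs /gmin /gmax /gr /reflect_field /cr.
  have -> : Num.max 0 (- g w (- x)) = - Num.min 0 (g w (- x)) by rewrite oppr_min oppr0.
  by ring.
have rhsD (c0 : Om -> R) k l w (x v : R) : is_derive x 1 (k w) v -> is_derive x 1 (rhs c0 d k l w) (d w + v).
  move=> H.
  have := isD_add (isD_add (isD_add (isD_cst (c0 w) x) (isD_scale (d w) (isD_id x))) H) (isD_cst l x).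
  by apply: is_derive_ext => //; ring.
have Dmin l w (x : R) : is_derive x 1 (rhs c d (gmin g) l w) (d w + gdr w (Num.min (- x) 0)).
  have := rhsD cr (gmax gr) (- l) w (- x) _ (gmax_derive Dgr gr0 gdr0 grneg grpos w (- x)).
  by rewrite -Emax opprK => /reflect_derive; rewrite reflect_fieldK.
have [||||||||xi xil sn] := @lower_saddle_node R Om sig cOm flow cr d gr gdr _ cd _ (copp _ cgx) Dgr _ gr0 gdr0
    grneg grpos _ (- l1) _ (fun w => - s w) (fun w => - orbit_deriv sig s w).
- by move=> w; apply: cvgN; exact: cc.
- by move=> p; apply: cvgN; exact: copp.
- move=> M; have [K HK] := cc3 M; exists K => w x xK.
  have [H _] := HK w (- x); have := H; rewrite lerNr => /(_ xK).
  by rewrite /gr /reflect_field; lra.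
- move=> m /cc5[A [mA As mA1]]; exists A; split=> // w /As /mono[m1 m2] x y xy; rewrite /gdr.
  have [y0|/ltW y0] := leP y 0; first by apply: m2; rewrite ?oppr_ge0// lerN2.
  have [x0|/ltW x0] := leP x 0; first by apply: m2; rewrite oppr0 ?oppr_ge0// lerN2.
  by apply: m1; rewrite oppr0 ?oppr_le0.
- have [a [r [ha hr]]] := (ARmin l1).2 l1p; exists (fun w => - a w), (fun w => - r w).
  rewrite -Emax opprK; split; first exact: reflect_hyp_attractive (Dmin l1) ha.
  exact: reflect_hyp_repulsive (Dmin l1) hr.
- split.
  + by move=> w; apply: cvgN; exact: cs.
  + by move=> w; apply: cvgN; exact: cs'.
  + by move=> w t; apply: isD_opp; exact: ds.
  + move=> w; have := Hs w; rewrite /lev /gr /reflect_field /cr /rhs opprK; lra.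
- by move=> w; rewrite -Erhs opprK reflect_l_att ltrN2.
- move=> m /(conc _ _ ji)[A [mA As mA1]]; exists A; split=> // w /As /= H a b t.
  rewrite -Erhs opprK reflect_l_att /= => /andP[a1 a2] /andP[b1 b2] t01.
  have ia : s w <= - a <= u_att sig (rhs c d g l1) w by apply/andP; split; lra.
  have ib : s w <= - b <= u_att sig (rhs c d g l1) w by apply/andP; split; lra.
  have := H (- a) (- b) t ia ib t01.
  have -> : t * - a + (1 - t) * - b = - (t * a + (1 - t) * b) by ring.
  by rewrite /gdr; lra.
exists (- xi); first by rewrite ltrNl.
have -> : rhs c d g = (fun l => reflect_field (rhs cr d gr (- l))).
  by apply/funext => l; rewrite -Erhs opprK reflect_fieldK.
by apply: (@reflect_saddle_node R Om sig (rhs cr d gr) (fun w x => d w + gdr w x)).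
Qed.
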